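(* Let $m\ge2$ and $n\ge2$ be integers with $m$ odd and $2m<n$, and let $0<\sigma<\frac{n}{n-2m}$. Set $b=\frac{2m(n-2)}{n-\sigma(n-2m)}$. Let $g:\mathbb{R}^n\setminus B_{1/2}(0)\to[1,\infty)$ be continuous with $g(y)=O(|y|^b)$ as $|y|\to\infty$. Let $v$ be a $C^{2m}$ nonnegative solution of $$0\le-\Delta^m v\le(v+g)^\sigma\quad\text{in }\mathbb{R}^n\setminus B_{1/2}(0).$$ Then $v(y)=O(|y|^b)$ as $|y|\to\infty$.
   Context: $\Delta^m$ is the $m$-fold iterated Laplacian; $B_{1/2}(0)$ is the open ball of radius $1/2$ about the origin. *)

(* Defs.v *)
From Stdlib Require Import Reals ClassicalEpsilon.
From mathcomp Require Import all_boot.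
Set Implicit Arguments. Unset Strict Implicit. Unset Printing Implicit Defensive.
Open Scope R_scope.

Definition point (n : nat) := 'I_n -> R.

Definition enorm (n : nat) (x : point n) : R :=
  sqrt (\big[Rplus/0]_(i < n) Rsqr (x i)).

Definition upd (n : nat) (x : point n) (i : 'I_n) (t : R) : point n :=
  fun j => if j == i then t else x j.

Definition partial (n : nat) (i : 'I_n) (f : point n -> R) (x : point n) : R :=
  epsilon (inhabits 0)
    (fun l => derivable_pt_lim (fun t => f (upd x i t)) (x i) l).

Definition laplacian (n : nat) (f : point n -> R) : point n -> R :=
  fun x => \big[Rplus/0]_(i < n) partial i (partial i f) x.

Fixpoint iter_lap (n m : nat) (f : point n -> R) : point n -> R :=
  match m with
  | O => f
  | S k => @laplacian n (@iter_lap n k f)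
  end.

Definition cont_on (n : nat) (D : point n -> Prop) (f : point n -> R) : Prop :=
  forall x, D x -> forall eps, 0 < eps -> exists delta, 0 < delta /\
    forall y, D y -> enorm (fun j => y j - x j) < delta -> Rabs (f y - f x) < eps.

Fixpoint Ck (n : nat) (k : nat) (D : point n -> Prop) (f : point n -> R) : Prop :=
  match k with
  | O => cont_on D f
  | S k' => cont_on D f /\
      forall i : 'I_n,
        (forall x, D x -> exists l, derivable_pt_lim (fun t => f (upd x i t)) (x i) l) /\
        @Ck n k' D (partial i f)
  end.

Definition bigO_pow (n : nat) (f : point n -> R) (b : R) : Prop :=
  exists C R0, forall y, R0 <= enorm y -> Rabs (f y) <= C * Rpower (enorm y) b.

(* Main.v *)
(** Put [f = - Delta^m v], [de = 1 - sigma (n - 2m) / n > 0] and cut [v] off near the inner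
    boundary, so that it becomes a nonnegative [C^{2m}] function [w] on the whole space.

    Testing against a compactly supported radial function that behaves like [|y|^(2-n)] and whose
    [m]-fold iterated Laplacian is nonnegative outside the unit ball gives, on the annulus
    [|y| ~ R], the bounds [O(R^(n-2))] for the mass of [f] and [O(R^(n-2+2m))] for that of [v].
    Testing against differences of regularized fundamental solutions at the scales [r < R] with
    pole [y] then gives, since [m] is odd,
      [v y <= C (R^(n-2) r^(2m-n) + R^(2m-2) + r^(2m) sup_{B(y,r)} f)].
    If [v y0 / R^b] were large for some [|y0| = R], a doubling argument would yield [y] near [y0]
    such that [v] is at most a multiple of [A = v y] on a ball around [y] that is not too small.
    There [f <= C A^sigma], and the [r] with [r^n A^sigma = R^(n-2)] turns the bound into
    [A <= C A (R^b / A)^de], a contradiction.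

    The integrals are iterated Riemann integrals over a large cube, for which Green's identity
    reduces to [int d_i phi = 0] for [phi] supported inside the cube. *)
Require Import Defs.
From Stdlib Require Import Reals Lra ClassicalEpsilon FunctionalExtensionality PropExtensionality.
From HB Require Import structures.
From mathcomp Require Import all_boot.
From Coquelicot Require Import Coquelicot.
Set Implicit Arguments. Unset Strict Implicit. Unset Printing Implicit Defensive.
Open Scope R_scope.

(** * Euclidean norm on points *)

(** Green's identity is used without boundary terms, so every test function must have compact
    support. A fundamental solution has not, but its regularizations at two scales agree beyond the
    larger one, so their difference has. No sign is claimed for the kernel [-Delta^m Gam_r]: the
    argument uses its support, its size [r^(-n)] and a positive lower bound for its total mass. That
    bound is where [m] odd enters: [Delta^(m-1) |z|^(2m-n) = c1 |z|^(2-n)], where [c1] has the sign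
    of [(-1)^(m-1)] and [|z|^(2-n)] is superharmonic. For the mass bounds, a test function written
    down directly would leave the sign of its [m]-fold Laplacian open. So that Laplacian is
    prescribed, nonnegative, and inverted [m] times by radial integration, with constants uniform in
    the scale. The weight in the doubling argument has the exponent [n-2m], that of [1/r] in the
    potential of the far mass: if the balancing radius exceeds the radius [d/2] that doubling
    provides, the loss is paid by the doubling inequality together with [2m-2 <= b]. *)

Lemma RplusA : associative Rplus. Proof. move=> x y z; ring. Qed.
HB.instance Definition _ := Monoid.isComLaw.Build R 0 Rplus RplusA Rplus_comm Rplus_0_l.

Lemma sumR_le {n : nat} (f g : 'I_n -> R) :
  (forall i, f i <= g i) -> \big[Rplus/0]_(i < n) f i <= \big[Rplus/0]_(i < n) g i.
Proof.
move=> h; apply: (big_ind2 (fun a b => a <= b)); [lra| move=> *; lra|by move=> i _; apply: h].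
Qed.

Lemma sumR_const (n : nat) (c : R) : \big[Rplus/0]_(i < n) c = INR n * c.
Proof.
elim: n => [|n IH]; first by rewrite big_ord0 /=; ring.
by rewrite big_ord_recr IH S_INR /=; ring.
Qed.

Lemma sumR_scal {n : nat} (c : R) (f : 'I_n -> R) :
  \big[Rplus/0]_(i < n) (c * f i) = c * \big[Rplus/0]_(i < n) f i.
Proof.
apply: (big_ind2 (fun a b => a = c * b)); [ring|by move=> ? ? ? ? -> ->; ring|by []].
Qed.

Definition sqn {n : nat} (x : point n) : R := \big[Rplus/0]_(i < n) Rsqr (x i).

Lemma sqn_ge0 {n : nat} (x : point n) : 0 <= sqn x.
Proof. by apply: (big_ind (fun a => 0 <= a)) => [|*|i _]; [lra|lra|apply: Rle_0_sqr]. Qed.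

Lemma sqn_coord {n : nat} (x : point n) (i : 'I_n) : Rsqr (x i) <= sqn x.
Proof.
rewrite /sqn (bigD1 i) //=.
have : 0 <= \big[Rplus/0]_(j < n | j != i) Rsqr (x j).
  by apply: (big_ind (fun a => 0 <= a)) => [|*|k _]; [lra|lra|apply: Rle_0_sqr].
by move=> h; rewrite -{1}[Rsqr (x i)]Rplus_0_r; apply: Rplus_le_compat_l.
Qed.

Lemma enorm_ge0 {n : nat} (x : point n) : 0 <= enorm x.
Proof. exact: sqrt_pos. Qed.

Lemma enorm_sqr {n : nat} (x : point n) : enorm x * enorm x = sqn x.
Proof. exact: (sqrt_sqrt _ (sqn_ge0 x)). Qed.

Lemma coord_le_enorm {n : nat} (x : point n) (i : 'I_n) : Rabs (x i) <= enorm x.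
Proof. by rewrite -sqrt_Rsqr_abs; apply: sqrt_le_1_alt; apply: sqn_coord. Qed.

Lemma enorm_le_coord {n : nat} (x : point n) (d : R) : 0 <= d ->
  (forall i, Rabs (x i) <= d) -> enorm x <= INR n * d.
Proof.
move=> d0 h; have n0 := pos_INR n.
have nd : 0 <= INR n * d by nra.
rewrite -(sqrt_Rsqr _ nd); apply: sqrt_le_1_alt.
have -> : Rsqr (INR n * d) = INR n * Rsqr d * INR n by rewrite /Rsqr; ring.
have H : \big[Rplus/0]_(i < n) Rsqr (x i) <= INR n * Rsqr d.
  by rewrite -sumR_const; apply: sumR_le => i; apply: Rsqr_le_abs_1; rewrite (Rabs_pos_eq d).
apply: Rle_trans H _.
case: n x h n0 nd => [|n] x h n0 nd; first by rewrite (_ : INR 0 = 0) //; nra.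
have n1 : 1 <= INR n.+1 by rewrite S_INR; have := pos_INR n; move=> ?; lra.
have d2 := Rmult_le_pos _ _ n0 (Rle_0_sqr d); nra.
Qed.

(** The planar case, which adds one coordinate to the norm of the others in [enorm_triangle].
    Cauchy-Schwarz comes from the square of [p b - a q]. *)
Lemma sqrt_minkowski2 (p q a b : R) : 0 <= p -> 0 <= q ->
  sqrt ((p + q) * (p + q) + (a + b) * (a + b)) <=
  sqrt (p * p + a * a) + sqrt (q * q + b * b).
Proof.
move=> p0 q0.
have s1 : sqrt (p * p + a * a) * sqrt (p * p + a * a) = p * p + a * a by apply: sqrt_sqrt; nra.
have s2 : sqrt (q * q + b * b) * sqrt (q * q + b * b) = q * q + b * b by apply: sqrt_sqrt; nra.
have h1 := sqrt_pos (p * p + a * a). have h2 := sqrt_pos (q * q + b * b).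
set u := sqrt (p * p + a * a) in s1 h1 *. set w := sqrt (q * q + b * b) in s2 h2 *.
have uw : p * q + a * b <= u * w.
  have sq : Rsqr (p * q + a * b) <= Rsqr (u * w).
    rewrite /Rsqr; have -> : u * w * (u * w) = (u * u) * (w * w) by ring.
    rewrite s1 s2; have := Rle_0_sqr (p * b - a * q); rewrite /Rsqr => ?; nra.
  have := Rsqr_incr_0_var _ _ sq; apply; nra.
rewrite -(sqrt_Rsqr (u + w)); last lra.
apply: sqrt_le_1_alt; rewrite /Rsqr; nra.
Qed.

Lemma enorm_triangle {n : nat} (x y : point n) :
  enorm (fun i => x i + y i) <= enorm x + enorm y.
Proof.
rewrite /enorm.
suff H : forall r : seq 'I_n, sqrt (\big[Rplus/0]_(i <- r) Rsqr (x i + y i)) <=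
  sqrt (\big[Rplus/0]_(i <- r) Rsqr (x i)) + sqrt (\big[Rplus/0]_(i <- r) Rsqr (y i)) by exact: H.
elim=> [|i r IH]; first by rewrite !big_nil sqrt_0; lra.
rewrite !big_cons.
have g (f : 'I_n -> R) : 0 <= \big[Rplus/0]_(j <- r) Rsqr (f j).
  by apply: (big_ind (fun a => 0 <= a)) => [|*|k _]; [lra|lra|apply: Rle_0_sqr].
have e f : \big[Rplus/0]_(j <- r) Rsqr (f j) = sqrt (\big[Rplus/0]_(j <- r) Rsqr (f j)) * sqrt (\big[Rplus/0]_(j <- r) Rsqr (f j)).
  by rewrite sqrt_sqrt //; exact: g.
rewrite (e x) (e y) (e (fun j => x j + y j)) /Rsqr.
set P := sqrt (\big[Rplus/0]_(j <- r) (x j * x j)).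
set Q := sqrt (\big[Rplus/0]_(j <- r) (y j * y j)).
set V := sqrt (\big[Rplus/0]_(j <- r) ((x j + y j) * (x j + y j))).
have P0 : 0 <= P by exact: sqrt_pos. have Q0 : 0 <= Q by exact: sqrt_pos.
have V0 : 0 <= V by exact: sqrt_pos.
have VPQ : V <= P + Q by exact: IH.
apply: Rle_trans; last first.
  have := sqrt_minkowski2 (x i) (y i) P0 Q0.
  by rewrite (Rplus_comm (P * P)) (Rplus_comm (Q * Q)); apply.
apply: sqrt_le_1_alt; nra.
Qed.

Definition edist {n : nat} (x y : point n) : R := enorm (fun i => x i - y i).

Lemma edist_triangle {n : nat} (x y z : point n) : edist x z <= edist x y + edist y z.
Proof.
rewrite /edist; apply: Rle_trans (enorm_triangle _ _).
apply: Req_le; congr enorm; apply: functional_extensionality => i; ring.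
Qed.

Lemma edist_sym {n : nat} (x y : point n) : edist x y = edist y x.
Proof.
rewrite /edist /enorm; congr sqrt; apply: eq_bigr => i _; rewrite /Rsqr; ring.
Qed.

Lemma edist_refl {n : nat} (x : point n) : edist x x = 0.
Proof.
rewrite /edist /enorm big1 ?sqrt_0 // => i _; rewrite /Rsqr; ring.
Qed.

Lemma enorm_edist {n : nat} (x y : point n) : enorm x <= enorm y + edist x y.
Proof.
apply: Rle_trans (enorm_triangle _ _).
apply: Req_le; congr enorm; apply: functional_extensionality => i; ring.
Qed.

Lemma updE {n : nat} (x : point n) i t : upd x i t i = t.
Proof. by rewrite /upd eqxx. Qed.

Lemma upd_neq {n : nat} (x : point n) i j t : j <> i -> upd x i t j = x j.
Proof. by move=> /eqP /negbTE h; rewrite /upd h. Qed.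

Lemma upd_id {n : nat} (x : point n) i : upd x i (x i) = x.
Proof. by apply: functional_extensionality => j; rewrite /upd; case: eqP => // ->. Qed.

Lemma upd_upd {n : nat} (x : point n) i s t : upd (upd x i s) i t = upd x i t.
Proof. by apply: functional_extensionality => j; rewrite /upd; case: eqP. Qed.

Lemma upd_comm {n : nat} (x : point n) i j s t : i <> j ->
  upd (upd x i s) j t = upd (upd x j t) i s.
Proof.
move=> ij; apply: functional_extensionality => k; rewrite /upd.
case: eqP => // ->; case: eqP => // ji; by case: ij.
Qed.

(** * Partial derivatives and the classes C^k *)

(** Sup-norm balls suit [upd], which moves a single coordinate; [opens_edist] passes to Euclidean
    balls. *)
Definition opens {n : nat} (D : point n -> Prop) :=
  forall x, D x -> exists d, 0 < d /\ forall y, (forall i, Rabs (y i - x i) < d) -> D y.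

(** The trace on [D] of the neighbourhood filter of [x]: it turns [cont_on] into a [filterlim], so
    that limit theorems give sums, products and compositions. *)
Definition within_pt {n : nat} (D : point n -> Prop) (x : point n) (P : point n -> Prop) :=
  exists d, 0 < d /\ forall y, D y -> edist y x < d -> P y.

#[global] Instance within_pt_filter {n : nat} (D : point n -> Prop) (x : point n) :
  Filter (within_pt D x).
Proof.
split.
- by exists 1; split; [lra|].
- move=> P Q [d1 [d1p h1]] [d2 [d2p h2]]; exists (Rmin d1 d2); split; first exact: Rmin_pos.
  move=> y Dy yd; split; [apply: h1|apply: h2] => //.
    by apply: Rlt_le_trans yd (Rmin_l _ _).
  by apply: Rlt_le_trans yd (Rmin_r _ _).
- by move=> P Q PQ [d [dp h]]; exists d; split => // y Dy yd; apply: PQ; apply: h.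
Qed.

Lemma cont_onP {n : nat} (D : point n -> Prop) (f : point n -> R) :
  cont_on D f <-> forall x, D x -> filterlim f (within_pt D x) (locally (f x)).
Proof.
split=> [h x Dx P [eps Pe]|h x Dx eps ep].
  have [d [dp hd]] := h x Dx eps (cond_pos eps).
  by exists d; split => // y Dy yd; apply: Pe; apply: hd.
have L : locally (f x) (fun r => Rabs (r - f x) < eps) by exists (mkposreal eps ep).
have [d [dp hd]] := h x Dx _ L.
by exists d; split.
Qed.

Section Continuity.
Context {n : nat} (D : point n -> Prop).

Lemma cont_const (c : R) : cont_on D (fun _ => c).
Proof. by move=> x Dx e e0; exists 1; split; [lra|move=> y _ _; rewrite Rminus_diag Rabs_R0]. Qed.

Lemma cont_comp (h : R -> R) (f : point n -> R) :
  (forall t, continuous h t) -> cont_on D f -> cont_on D (fun x => h (f x)).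
Proof.
move=> hh /cont_onP hf; apply/cont_onP => x Dx.
by apply: filterlim_comp; [apply: hf|apply: hh].
Qed.

Lemma cont_add (f g : point n -> R) :
  cont_on D f -> cont_on D g -> cont_on D (fun x => f x + g x).
Proof.
move=> /cont_onP hf /cont_onP hg; apply/cont_onP => x Dx.
refine (filterlim_comp_2 f g Rplus (hf x Dx) (hg x Dx) _).
exact: (@filterlim_plus R_AbsRing R_NormedModule (f x) (g x)).
Qed.

Lemma cont_mul (f g : point n -> R) :
  cont_on D f -> cont_on D g -> cont_on D (fun x => f x * g x).
Proof.
move=> /cont_onP hf /cont_onP hg; apply/cont_onP => x Dx.
refine (filterlim_comp_2 f g Rmult (hf x Dx) (hg x Dx) _).
exact: (@filterlim_mult R_AbsRing (f x) (g x)).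
Qed.

Lemma cont_coord (i : 'I_n) : cont_on D (fun x => x i).
Proof.
move=> x Dx e e0; exists e; split => // y Dy yd.
exact: Rle_lt_trans (coord_le_enorm (fun j => y j - x j) i) yd.
Qed.

Lemma cont_sum (I : Type) (r : seq I) (F : I -> point n -> R) :
  (forall i, cont_on D (F i)) -> cont_on D (fun x => \big[Rplus/0]_(i <- r) F i x).
Proof.
move=> h; elim: r => [|i r IH].
  by rewrite (_ : (fun _ => _) = (fun _ => 0)); [apply: cont_const|apply: functional_extensionality => x; rewrite big_nil].
rewrite (_ : (fun _ => _) = (fun x => F i x + \big[Rplus/0]_(i <- r) F i x)); first exact: cont_add.
by apply: functional_extensionality => x; rewrite big_cons.
Qed.

Lemma cont_scal (c : R) (f : point n -> R) : cont_on D f -> cont_on D (fun x => c * f x).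
Proof. by move=> h; apply: cont_mul => //; apply: cont_const. Qed.

Lemma cont_opp (f : point n -> R) : cont_on D f -> cont_on D (fun x => - f x).
Proof.
move=> h; rewrite (_ : (fun _ => _) = (fun x => (-1) * f x)); first exact: cont_scal.
by apply: functional_extensionality => x; ring.
Qed.

Lemma cont_sub (f g : point n -> R) :
  cont_on D f -> cont_on D g -> cont_on D (fun x => f x - g x).
Proof. by move=> hf hg; apply: cont_add => //; apply: cont_opp. Qed.

Lemma cont_ext (f g : point n -> R) :
  (forall x, D x -> f x = g x) -> cont_on D f -> cont_on D g.
Proof.
move=> e h x Dx eps ep; have [d [dp hd]] := h x Dx eps ep.
by exists d; split => // y Dy yd; rewrite -!e //; apply: hd.
Qed.

End Continuity.

Lemma cont_subset {n : nat} (D D' : point n -> Prop) (f : point n -> R) :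
  (forall x, D' x -> D x) -> cont_on D f -> cont_on D' f.
Proof.
move=> s h x Dx e e0; have [d [dp hd]] := h x (s x Dx) e e0.
by exists d; split => // y Dy; apply: hd; apply: s.
Qed.

Lemma opens_edist {n : nat} (D : point n -> Prop) x : opens D -> D x ->
  exists d, 0 < d /\ forall y, edist y x < d -> D y.
Proof.
move=> o Dx; have [d [dp hd]] := o x Dx; exists d; split => // y yd.
apply: hd => i; exact: Rle_lt_trans (coord_le_enorm (fun j => y j - x j) i) yd.
Qed.

Lemma cont_union {n : nat} (D D' : point n -> Prop) (f : point n -> R) :
  opens D -> opens D' -> cont_on D f -> cont_on D' f -> cont_on (fun x => D x \/ D' x) f.
Proof.
move=> o o' h h' x Dx e e0.
have aux (E : point n -> Prop) : opens E -> cont_on E f -> E x ->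
    exists d, 0 < d /\ forall y, edist y x < d -> Rabs (f y - f x) < e.
  move=> oE hE Ex; have [d [dp hd]] := hE x Ex e e0.
  have [d' [dp' hd']] := opens_edist oE Ex.
  exists (Rmin d d'); split; first exact: Rmin_pos.
  move=> y yd; apply: hd; first by apply: hd'; apply: Rlt_le_trans yd (Rmin_r _ _).
  exact: Rlt_le_trans yd (Rmin_l _ _).
have [d [dp hd]] : exists d, 0 < d /\ forall y, edist y x < d -> Rabs (f y - f x) < e.
  by case: Dx => Dx; [apply: (aux D)|apply: (aux D')].
by exists d; split => // y _; apply: hd.
Qed.

Lemma partial_is {n : nat} (i : 'I_n) (f : point n -> R) x l :
  is_derive (fun t => f (upd x i t)) (x i) l -> partial i f x = l.
Proof.
move=> /is_derive_Reals h.
have := epsilon_spec (inhabits 0)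
  (fun l => derivable_pt_lim (fun t => f (upd x i t)) (x i) l) (ex_intro _ l h).
move=> h'; exact: uniqueness_limite h' h.
Qed.

Lemma partial_correct {n : nat} (i : 'I_n) (f : point n -> R) x :
  (exists l, derivable_pt_lim (fun t => f (upd x i t)) (x i) l) ->
  is_derive (fun t => f (upd x i t)) (x i) (partial i f x).
Proof.
move=> h; apply/is_derive_Reals.
exact: (epsilon_spec (inhabits 0)
  (fun l => derivable_pt_lim (fun t => f (upd x i t)) (x i) l) h).
Qed.

Lemma opens_line {n : nat} (D : point n -> Prop) x i : opens D -> D x ->
  locally (x i) (fun t => D (upd x i t)).
Proof.
move=> o Dx; have [d [dp hd]] := o x Dx.
exists (mkposreal d dp) => t ht; apply: hd => j; rewrite /upd; case: eqP => [->|_]; first exact: ht.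
by rewrite Rminus_diag Rabs_R0.
Qed.

(** No differentiability is assumed: the two predicates under [epsilon] coincide, hence so do the
    chosen values, even where no derivative exists. *)
Lemma partial_loc {n : nat} (D : point n -> Prop) i (f g : point n -> R) x :
  opens D -> (forall y, D y -> f y = g y) -> D x -> partial i f x = partial i g x.
Proof.
move=> o e Dx; rewrite /partial; congr epsilon.
apply: functional_extensionality => l; apply: propositional_extensionality.
have h := opens_line i o Dx.
split=> /is_derive_Reals H; apply/is_derive_Reals; apply: is_derive_ext_loc H;
  apply: filter_imp h => t Dt; by rewrite e.
Qed.

Lemma laplacian_loc {n : nat} (D : point n -> Prop) (f g : point n -> R) x :
  opens D -> (forall y, D y -> f y = g y) -> D x -> laplacian f x = laplacian g x.
Proof.
move=> o e Dx; apply: eq_bigr => i _; apply: (partial_loc i o) => // y Dy.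
exact: (partial_loc i o).
Qed.

Lemma iter_lap_loc {n : nat} (D : point n -> Prop) k (f g : point n -> R) x :
  opens D -> (forall y, D y -> f y = g y) -> D x -> iter_lap k f x = iter_lap k g x.
Proof.
move=> o e; elim: k x => [|k IH] x Dx; first exact: e.
exact: (laplacian_loc o).
Qed.

Lemma iter_lap_lap {n : nat} k (f : point n -> R) :
  iter_lap k (laplacian f) = iter_lap k.+1 f.
Proof. by elim: k => [|k IH] //=; rewrite IH. Qed.

Section Ck.
Context {n : nat} (D : point n -> Prop) (oD : opens D).
Implicit Types f g : point n -> R.

Lemma Ck_cont k f : Ck k D f -> cont_on D f.
Proof. by case: k => [|k] // []. Qed.

Lemma Ck_pred k f : Ck k.+1 D f -> Ck k D f.
Proof.
elim: k f => [|k IH] f [c h] //; split => // i; have [e h'] := h i; split => //.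
exact: IH.
Qed.

Lemma Ck_le j k f : (j <= k)%N -> Ck k D f -> Ck j D f.
Proof.
elim: k => [|k IH]; first by case: j.
rewrite leq_eqVlt => /orP [/eqP -> //|h] hf; apply: IH => //; exact: Ck_pred.
Qed.

Lemma Ck_ext k f g : (forall x, D x -> f x = g x) -> Ck k D f -> Ck k D g.
Proof.
elim: k f g => [|k IH] f g e; first exact: cont_ext.
move=> [c h]; split; first exact: cont_ext c.
move=> i; have [ex hk] := h i; split.
  move=> x Dx; have [l hl] := ex x Dx; exists l.
  apply/is_derive_Reals; move/is_derive_Reals: hl; apply: is_derive_ext_loc.
  by apply: filter_imp (opens_line i oD Dx) => t Dt; apply: e.
by apply: IH hk => x Dx; apply: (partial_loc i oD).
Qed.

Lemma Ck_const k c : Ck k D (fun _ => c).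
Proof.
elim: k c => [|k IH] c; first exact: cont_const.
split; first exact: cont_const.
move=> i; split; first by move=> x Dx; exists 0; exact: derivable_pt_lim_const.
apply: (Ck_ext (f := fun _ => 0)) (IH _) => x Dx; symmetry; apply: partial_is.
exact: is_derive_const.
Qed.

Lemma Ck_add k f g : Ck k D f -> Ck k D g -> Ck k D (fun x => f x + g x).
Proof.
elim: k f g => [|k IH] f g; first exact: cont_add.
move=> [cf hf] [cg hg]; split; first exact: cont_add.
move=> i; have [ef kf] := hf i; have [eg kg] := hg i.
have d x : D x -> is_derive (fun t => f (upd x i t) + g (upd x i t)) (x i)
    (partial i f x + partial i g x).
  by move=> Dx; apply: (@is_derive_plus R_AbsRing R_NormedModule);
    apply: partial_correct; [apply: ef|apply: eg].
split; first by move=> x Dx; eexists; apply/is_derive_Reals; exact: d.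
by apply: Ck_ext (IH _ _ kf kg) => x Dx; symmetry; apply: partial_is; exact: d.
Qed.

Lemma Ck_mul k f g : Ck k D f -> Ck k D g -> Ck k D (fun x => f x * g x).
Proof.
elim: k f g => [|k IH] f g; first exact: cont_mul.
move=> Hf Hg; have [cf hf] := Hf; have [cg hg] := Hg; split; first exact: cont_mul.
move=> i; have [ef kf] := hf i; have [eg kg] := hg i.
have d x : D x -> is_derive (fun t => f (upd x i t) * g (upd x i t)) (x i)
    (partial i f x * g x + f x * partial i g x).
  move=> Dx; have := is_derive_mult _ _ _ _ _ (partial_correct (ef x Dx)) (partial_correct (eg x Dx)).
  by rewrite upd_id; apply; exact: Rmult_comm.
split; first by move=> x Dx; eexists; apply/is_derive_Reals; exact: d.
apply: (Ck_ext (f := fun x => partial i f x * g x + f x * partial i g x)).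
  by move=> x Dx; symmetry; apply: partial_is; exact: d.
by apply: Ck_add; apply: IH => //; apply: Ck_pred.
Qed.

Lemma Ck_coord k i : Ck k D (fun x => x i).
Proof.
case: k => [|k]; first exact: cont_coord.
split; first exact: cont_coord.
move=> j.
have d x : is_derive (fun t => upd x j t i) (x j) (if i == j then 1 else 0).
  by rewrite /upd; case: ifP => _; [exact: is_derive_id|exact: is_derive_const].
split; first by move=> x _; eexists; apply/is_derive_Reals; exact: d.
apply: (Ck_ext (f := fun _ => if i == j then 1 else 0)); last exact: Ck_const.
by move=> x _; symmetry; apply: partial_is.
Qed.

Lemma Ck_sum k (I : Type) (r : seq I) (F : I -> point n -> R) :
  (forall i, Ck k D (F i)) -> Ck k D (fun x => \big[Rplus/0]_(i <- r) F i x).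
Proof.
move=> h; elim: r => [|i r IH].
  by rewrite (_ : (fun _ => _) = (fun _ => 0)); [apply: Ck_const|apply: functional_extensionality => x; rewrite big_nil].
rewrite (_ : (fun _ => _) = (fun x => F i x + \big[Rplus/0]_(i <- r) F i x)); first exact: Ck_add.
by apply: functional_extensionality => x; rewrite big_cons.
Qed.

Lemma Ck_laplacian k f : Ck k.+2 D f -> Ck k D (laplacian f).
Proof. by move=> [_ h]; apply: Ck_sum => i; have [_ [_ h']] := h i; have [_ h''] := h' i. Qed.

Lemma Ck_iter_lap k j f : Ck (k + 2 * j) D f -> Ck k D (iter_lap j f).
Proof.
elim: j k f => [|j IH] k f; first by rewrite muln0 addn0.
rewrite mulnS addnA => h; rewrite -iter_lap_lap; apply: IH.
by apply: Ck_laplacian; rewrite -addn2 addnAC.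
Qed.

End Ck.

Lemma Ck_subset {n : nat} (D D' : point n -> Prop) k (f : point n -> R) :
  (forall x, D' x -> D x) -> Ck k D f -> Ck k D' f.
Proof.
move=> s; elim: k f => [|k IH] f; first exact: cont_subset.
move=> [c h]; split; first exact: cont_subset c.
move=> i; have [e hk] := h i; split; first by move=> x Dx; apply: e; apply: s.
exact: IH.
Qed.

(** Glues the cut-off function from its formula away from the origin and its zero values near it. *)
Lemma Ck_union {n : nat} (D D' : point n -> Prop) k (f : point n -> R) :
  opens D -> opens D' -> Ck k D f -> Ck k D' f -> Ck k (fun x => D x \/ D' x) f.
Proof.
move=> o o'; elim: k f => [|k IH] f; first exact: cont_union.
move=> [c h] [c' h']; split; first exact: cont_union.
move=> i; have [e hk] := h i; have [e' hk'] := h' i; split; last exact: IH.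
by move=> x [Dx|Dx]; [apply: e|apply: e'].
Qed.

(** * Iterated integrals and Green's identity *)

Definition contg {n : nat} (f : point n -> R) := cont_on (fun _ => True) f.

Lemma cont_sup {n : nat} (D : point n -> Prop) (f : point n -> R) : cont_on D f ->
  forall x, D x -> forall e, 0 < e -> exists d, 0 < d /\
    forall y, D y -> (forall i, Rabs (y i - x i) < d) -> Rabs (f y - f x) < e.
Proof.
move=> h x Dx e e0; have [d [dp hd]] := h x Dx e e0.
have n0 := pos_INR n; have n1 : 0 < INR n + 1 by lra.
have dn : 0 < d / (INR n + 1) by apply: Rdiv_lt_0_compat.
exists (d / (INR n + 1)); split => // y Dy yd; apply: hd => //.
apply: Rle_lt_trans (enorm_le_coord (Rlt_le _ _ dn) _) _.
  by move=> i; apply: Rlt_le; apply: yd.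
have -> : INR n * (d / (INR n + 1)) = d - d / (INR n + 1) by field; lra.
lra.
Qed.

Lemma cont_of_sup {n : nat} (D : point n -> Prop) (f : point n -> R) :
  (forall x, D x -> forall e, 0 < e -> exists d, 0 < d /\
    forall y, D y -> (forall i, Rabs (y i - x i) < d) -> Rabs (f y - f x) < e) -> cont_on D f.
Proof.
move=> h x Dx e e0; have [d [dp hd]] := h x Dx e e0.
exists d; split => // y Dy yd; apply: hd => // i.
exact: Rle_lt_trans (coord_le_enorm (fun j => y j - x j) i) yd.
Qed.

(** Compactness in gauge form: finitely many gauge intervals cover [[a, b]], and [d] bounds their
    gauges from below. *)
Lemma interval_gauge (a b : R) (delta : R -> R) : (forall t, 0 < delta t) ->
  exists d, 0 < d /\ forall x, a <= x <= b ->
    exists t, a <= t <= b /\ Rabs (x - t) < delta t /\ d <= delta t.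
Proof.
move=> dp; have [d hd] := compactness_value_1d a b (fun t => mkposreal _ (dp t)).
exists d; split; first exact: cond_pos.
move=> x hx; exact: Classical_Prop.NNPP (hd x hx).
Qed.

Lemma upd_close {n : nat} (x y : point n) i s t d : 0 < d -> Rabs (s - t) < d ->
  (forall j, Rabs (y j - x j) < d) -> forall j, Rabs (upd y i s j - upd x i t j) < d.
Proof. by move=> d0 st h j; rewrite /upd; case: ifP. Qed.

(** The tube lemma around the segment [a <= t <= b] in direction [i]; it makes the partial integrals
    [J] continuous. *)
Lemma tube {n : nat} (f : point n -> R) (x : point n) i a b e : contg f -> 0 < e ->
  exists d, 0 < d /\ forall y, (forall j, Rabs (y j - x j) < d) ->
    forall t, a <= t <= b -> Rabs (f (upd y i t) - f (upd x i t)) < e.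
Proof.
move=> cf e0; have e2 : 0 < e / 2 by lra.
have ex t : {d | 0 < d /\ forall y, (forall j, Rabs (y j - upd x i t j) < d) ->
    Rabs (f y - f (upd x i t)) < e / 2}.
  apply: constructive_indefinite_description.
  have [d [dp hd]] := cont_sup cf (x := upd x i t) I e2.
  by exists d; split => // y; apply: hd.
pose delta t := sval (ex t).
have dp t : 0 < delta t by have [] := svalP (ex t).
have [d [d0 hd]] := interval_gauge a b dp.
exists d; split => // y yd t ht; have [s [hs [st ds]]] := hd t ht.
have [_ H] := svalP (ex s).
have A1 : Rabs (f (upd y i t) - f (upd x i s)) < e / 2.
  by apply: H; apply: (@upd_close _ _ _ _ _ _ (delta s)) => // j; exact: Rlt_le_trans (yd j) ds.
have A2 : Rabs (f (upd x i t) - f (upd x i s)) < e / 2.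
  by apply: H; apply: (@upd_close _ _ _ _ _ _ (delta s)) => // j; rewrite ?Rminus_diag ?Rabs_R0; exact: dp.
have -> : f (upd y i t) - f (upd x i t) =
  (f (upd y i t) - f (upd x i s)) + - (f (upd x i t) - f (upd x i s)) by ring.
apply: Rle_lt_trans (Rabs_triang _ _) _; rewrite Rabs_Ropp; lra.
Qed.

(** Compactness of the cube, one coordinate at a time: in the induction the coordinates in [l] run
    through all of [[-a, a]] while the others stay close to those of [x0]. *)
Lemma bounded_cube {n : nat} (f : point n -> R) (a : R) : contg f ->
  exists C, forall x, (forall i, Rabs (x i) <= a) -> Rabs (f x) <= C.
Proof.
move=> cf.
suff H : forall (l : seq 'I_n) (x0 : point n), exists C d, 0 < d /\ forall x,
    (forall i, i \in l -> Rabs (x i) <= a) ->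
    (forall i, i \notin l -> Rabs (x i - x0 i) < d) -> Rabs (f x) <= C.
  have [C [d [_ h]]] := H (enum 'I_n) (fun _ => 0).
  exists C => x hx; apply: h => i; [by move=> _|by rewrite mem_enum].
elim=> [|j l IH] x0.
  have [d [d0 hd]] := cont_sup cf (x := x0) I Rlt_0_1.
  exists (Rabs (f x0) + 1), d; split => // x _ hx.
  have := hd x I (fun i => hx i isT); have := Rabs_triang (f x - f x0) (f x0).
  rewrite (_ : f x - f x0 + f x0 = f x); [move=> *; lra|ring].
have ex t : {p : R * R | 0 < p.1 /\ forall x,
    (forall i, i \in l -> Rabs (x i) <= a) ->
    (forall i, i \notin l -> Rabs (x i - upd x0 j t i) < p.1) -> Rabs (f x) <= p.2}.
  apply: constructive_indefinite_description.
  by have [C [d [d0 h]]] := IH (upd x0 j t); exists (d, C).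
(* The gauge also controls 1/C, so that one lower bound bounds all the local constants. *)
pose delta t := Rmin (sval (ex t)).1 (/ (Rabs (sval (ex t)).2 + 1)).
have dp t : 0 < delta t.
  apply: Rmin_pos; first by have [] := svalP (ex t).
  apply: Rinv_0_lt_compat; have := Rabs_pos (sval (ex t)).2; move=> *; lra.
have [d [d0 hd]] := interval_gauge (- a) a dp.
exists (/ d), d; split => // x hx hx'.
have xj : - a <= x j <= a by apply/Rabs_le_between; apply: hx; rewrite inE eqxx.
have [t [ht [xt dt]]] := hd _ xj; have [_ H] := svalP (ex t).
have C0 := Rabs_pos (sval (ex t)).2.
have le2 : d <= / (Rabs (sval (ex t)).2 + 1) by apply: Rle_trans dt (Rmin_r _ _).
have le3 : Rabs (sval (ex t)).2 + 1 <= / d.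
  rewrite -(Rinv_inv (Rabs _ + 1)); apply: Rinv_le_contravar => //.
have C1 := Rle_abs (sval (ex t)).2.
have : Rabs (f x) <= (sval (ex t)).2; last by move=> ?; lra.
apply: H => [i il|i il]; first by apply: hx; rewrite inE il orbT.
rewrite /upd; case: eqP => [->|/eqP ij].
  exact: Rlt_le_trans xt (Rmin_l _ _).
apply: Rlt_le_trans (hx' i _) _; first by rewrite inE negb_or ij.
exact: Rle_trans dt (Rmin_l _ _).
Qed.

Lemma continuous_line {n : nat} (f : point n -> R) x i t : contg f ->
  continuous (fun t => f (upd x i t)) t.
Proof.
move=> cf P [e Pe]; have [d [dp hd]] := cont_sup cf (x := upd x i t) I (cond_pos e).
exists (mkposreal d dp) => s hs; apply: Pe; apply: hd => // j.
apply: upd_close => // k; by rewrite Rminus_diag Rabs_R0.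
Qed.

Lemma ex_RInt_line {n : nat} (f : point n -> R) x i a b : contg f ->
  ex_RInt (fun t => f (upd x i t)) a b.
Proof. by move=> cf; apply: ex_RInt_continuous => t _; apply: continuous_line. Qed.

Lemma RInt_null (h : R -> R) a b : (forall t, h t = 0) -> RInt h a b = 0.
Proof.
move=> h0; rewrite (_ : h = fun _ => 0); last exact: functional_extensionality.
by rewrite RInt_const; apply: Rmult_0_r.
Qed.

Lemma RInt_ge_sub (h : R -> R) a y z b K : (forall t, continuous h t) ->
  a <= y -> y <= z -> z <= b -> (forall t, a <= t <= b -> 0 <= h t) ->
  (forall t, y < t < z -> K <= h t) -> K * (z - y) <= RInt h a b.
Proof.
move=> ch h1 h2 h3 h0 hK.
have ex u v : ex_RInt h u v by apply: ex_RInt_continuous.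
rewrite -(RInt_Chasles h a y b) // -(RInt_Chasles h y z b) //.
have A1 : 0 <= RInt h a y by apply: RInt_ge_0 => // t ht; apply: h0; lra.
have A3 : 0 <= RInt h z b by apply: RInt_ge_0 => // t ht; apply: h0; lra.
have A2 : K * (z - y) <= RInt h y z.
  apply: Rle_trans (_ : RInt (fun _ => K) y z <= _).
    by rewrite RInt_const /scal /= /mult /=; apply: Req_le; ring.
  by apply: RInt_le => //; exact: ex_RInt_const.
rewrite /plus /=; lra.
Qed.

(** * Iterated integration over the cube of half-side [S] *)

Section Integral.
Context {n : nat} (S : R) (S0 : 0 < S).
Implicit Types (f g : point n -> R) (x : point n) (l : seq 'I_n).

Definition J (i : 'I_n) f : point n -> R := fun x => RInt (fun t => f (upd x i t)) (- S) S.

Definition Jl l f : point n -> R := foldr J f l.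

(** Every coordinate is integrated out, so the base point does not affect the value. *)
Definition Iint f : R := Jl (enum 'I_n) f (fun _ => 0).

Lemma J_cont i f : contg f -> contg (J i f).
Proof.
move=> cf; apply: cont_of_sup => x _ e e0.
have e1 : 0 < e / (4 * S) by apply: Rdiv_lt_0_compat; lra.
have [d [dp hd]] := tube x i (- S) S cf e1.
exists d; split => // y _ yd.
have E := @RInt_minus R_CompleteNormedModule _ _ _ _ (ex_RInt_line y i (- S) S cf) (ex_RInt_line x i (- S) S cf).
rewrite /J -[X in Rabs X](_ : RInt (fun t => minus (f (upd y i t)) (f (upd x i t))) (- S) S = _) //.
apply: Rle_lt_trans (_ : _ <= (S - - S) * (e / (4 * S))) _.
  apply: abs_RInt_le_const; [lra| |].
    by apply: ex_RInt_minus; apply: ex_RInt_line.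
  by move=> t ht; apply: Rlt_le; apply: hd.
have -> : (S - - S) * (e / (4 * S)) = e / 2 by field; lra.
lra.
Qed.

Lemma J_add i f g : contg f -> contg g ->
  J i (fun x => f x + g x) = (fun x => J i f x + J i g x).
Proof.
move=> cf cg; apply: functional_extensionality => x.
by apply: RInt_plus; apply: ex_RInt_line.
Qed.

Lemma J_scal i c f : contg f -> J i (fun x => c * f x) = (fun x => c * J i f x).
Proof.
move=> cf; apply: functional_extensionality => x.
by apply: (@RInt_scal R_CompleteNormedModule); apply: ex_RInt_line.
Qed.

Lemma J_le i f g : contg f -> contg g -> (forall x, f x <= g x) -> forall x, J i f x <= J i g x.
Proof.
by move=> cf cg h x; apply: RInt_le; [lra|apply: ex_RInt_line|apply: ex_RInt_line|].
Qed.

Lemma Jl_cont l f : contg f -> contg (Jl l f).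
Proof. by elim: l => //= i l IH cf; apply: J_cont; apply: IH. Qed.

Lemma Jl_add l f g : contg f -> contg g ->
  Jl l (fun x => f x + g x) = (fun x => Jl l f x + Jl l g x).
Proof.
move=> cf cg; elim: l => //= i l ->; exact: J_add (Jl_cont _ _) (Jl_cont _ _).
Qed.

Lemma Jl_scal l c f : contg f -> Jl l (fun x => c * f x) = (fun x => c * Jl l f x).
Proof. move=> cf; elim: l => //= i l ->; exact: J_scal (Jl_cont _ _). Qed.

Lemma Iint_add f g : contg f -> contg g -> Iint (fun x => f x + g x) = Iint f + Iint g.
Proof. by move=> cf cg; rewrite /Iint Jl_add. Qed.

Lemma Iint_scal c f : contg f -> Iint (fun x => c * f x) = c * Iint f.
Proof. by move=> cf; rewrite /Iint Jl_scal. Qed.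

Lemma Iint_sub f g : contg f -> contg g -> Iint (fun x => f x - g x) = Iint f - Iint g.
Proof.
move=> cf cg.
rewrite (_ : (fun x => f x - g x) = (fun x => f x + (-1) * g x)).
  by rewrite Iint_add ?Iint_scal //; [ring|apply: cont_scal].
by apply: functional_extensionality => x; ring.
Qed.

Lemma Iint_le f g : contg f -> contg g -> (forall x, f x <= g x) -> Iint f <= Iint g.
Proof.
move=> cf cg h; rewrite /Iint.
suff H : forall l x, Jl l f x <= Jl l g x by apply: H.
by elim=> //= i l IH; apply: J_le => //; apply: Jl_cont.
Qed.

Lemma RInt_le_window (h : R -> R) c r C : (forall t, continuous h t) ->
  - S <= c - r -> c + r <= S -> 0 <= r -> (forall t, h t <= C) ->
  (forall t, r < Rabs (t - c) -> h t <= 0) -> RInt h (- S) S <= C * (2 * r).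
Proof.
move=> ch h1 h2 r0 hC hz.
have ex a b : ex_RInt h a b by apply: ex_RInt_continuous.
rewrite -(RInt_Chasles h (- S) (c - r) S) // -(RInt_Chasles h (c - r) (c + r) S) //.
have z0 a b : RInt (fun _ => 0) a b = 0 by exact: RInt_null.
have A1 : RInt h (- S) (c - r) <= 0.
  rewrite -(z0 (- S) (c - r)); apply: RInt_le => //; first exact: ex_RInt_const.
  by move=> t ht; apply: hz; rewrite Rabs_left; lra.
have A3 : RInt h (c + r) S <= 0.
  rewrite -(z0 (c + r) S); apply: RInt_le => //; first exact: ex_RInt_const.
  by move=> t ht; apply: hz; rewrite Rabs_right; lra.
have A2 : RInt h (c - r) (c + r) <= C * (2 * r).
  apply: Rle_trans (_ : _ <= RInt (fun _ => C) (c - r) (c + r)) _.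
    by apply: RInt_le => //; [lra|exact: ex_RInt_const].
  by rewrite RInt_const /scal /= /mult /=; apply: Req_le; ring.
rewrite /plus /=; lra.
Qed.

(** Off the cube of half-side [r] around [y] only a sign is required. The second clause of the
    induction keeps this sign in the coordinates that are not integrated yet. *)
Lemma Iint_upper f y r C : contg f -> 0 <= r -> 0 <= C ->
  (forall i, - S <= y i - r /\ y i + r <= S) -> (forall x, f x <= C) ->
  (forall x i, r < Rabs (x i - y i) -> f x <= 0) -> Iint f <= C * (2 * r) ^ n.
Proof.
move=> cf r0 C0 hy hC hz.
suff H : forall l, uniq l -> (forall x, Jl l f x <= C * (2 * r) ^ (size l)) /\
    (forall x i, i \notin l -> r < Rabs (x i - y i) -> Jl l f x <= 0).
  have [H1 _] := H _ (enum_uniq 'I_n); have := H1 (fun _ => 0); by rewrite size_enum_ord.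
have p0 k : 0 <= C * (2 * r) ^ k by apply: Rmult_le_pos => //; apply: pow_le; lra.
elim=> [_|i l IH] /=; first by split => [x|x i _]; [rewrite Rmult_1_r|exact: hz].
move=> /andP [il ul]; have [IH1 IH2] := IH ul.
have cl : contg (Jl l f) by exact: Jl_cont.
split=> [x|x j]; last first.
  rewrite inE negb_or => /andP [ji jl] hj.
  have z0 : RInt (fun _ => 0) (- S) S = 0 by exact: RInt_null.
  rewrite -{1}z0; apply: RInt_le; [lra|exact: ex_RInt_line|exact: ex_RInt_const|].
  by move=> t _; apply: (IH2 _ j jl); rewrite upd_neq //; apply/eqP.
have [hy1 hy2] := hy i.
have -> : C * (2 * r * (2 * r) ^ size l) = C * (2 * r) ^ size l * (2 * r) by ring.
apply: RInt_le_window hy1 hy2 r0 _ _ => // t; first exact: continuous_line.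
by move=> ht; apply: (IH2 _ i il); rewrite updE.
Qed.

Lemma Iint_lower f y r C : contg f -> 0 <= r -> 0 <= C ->
  (forall i, - S <= y i - r /\ y i + r <= S) -> (forall x, 0 <= f x) ->
  (forall x, (forall i, Rabs (x i - y i) < r) -> C <= f x) -> C * (2 * r) ^ n <= Iint f.
Proof.
move=> cf r0 C0 hy hC hz.
suff H : forall l, (forall x, 0 <= Jl l f x) /\ (forall x,
    (forall i, i \notin l -> Rabs (x i - y i) < r) -> C * (2 * r) ^ (size l) <= Jl l f x).
  have [_ H1] := H (enum 'I_n); have := H1 (fun _ => 0); rewrite size_enum_ord; apply.
  by move=> i; rewrite mem_enum.
elim=> [|i l [IH1 IH2]] /=; first by split => // x hx; rewrite Rmult_1_r; apply: hz => i; apply: hx.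
have cl : contg (Jl l f) by exact: Jl_cont.
split=> [x|x hx]; first by apply: RInt_ge_0; [lra|exact: ex_RInt_line|].
have [hy1 hy2] := hy i.
have -> : C * (2 * r * (2 * r) ^ size l) = C * (2 * r) ^ size l * (y i + r - (y i - r)) by ring.
apply: (RInt_ge_sub _ hy1 _ hy2) => [t||t _|t ht]; [exact: continuous_line|lra|exact: IH1|].
apply: IH2 => j jl; rewrite /upd; case: eqP => [->|/eqP ji]; first by apply: Rabs_def1; lra.
by apply: hx; rewrite inE negb_or ji.
Qed.

(** * Integration by parts in the cube *)

Definition pd (i : 'I_n) f := forall x, exists c, derivable_pt_lim (fun t => f (upd x i t)) (x i) c.

Lemma J_is_derive i j f x : i <> j -> contg f -> pd i f -> contg (partial i f) ->
  is_derive (fun u => J j f (upd x i u)) (x i) (J j (partial i f) x).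
Proof.
move=> ij cf df cdf.
have ji : j <> i by move=> e; apply: ij.
have D u v : is_derive (fun z => f (upd (upd x i z) j v)) u (partial i f (upd (upd x i u) j v)).
  have := partial_correct (df (upd (upd x i u) j v)).
  rewrite upd_neq // updE; apply: is_derive_ext => t.
  by rewrite !(upd_comm _ _ _ ij) upd_upd.
have DE u v : Derive (fun z => f (upd (upd x i z) j v)) u = partial i f (upd (upd x i u) j v).
  exact: is_derive_unique (D u v).
have -> : J j (partial i f) x =
    RInt (fun t => Derive (fun u => f (upd (upd x i u) j t)) (x i)) (- S) S.
  by apply: RInt_ext => t _; rewrite DE upd_id.
apply: (is_derive_RInt_param (fun u t => f (upd (upd x i u) j t))).
- by apply: filter_forall => u t _; eexists; apply: D.
- move=> t _ e.
  have [d [dp hd]] := cont_sup cdf (x := upd x j t) I (cond_pos e).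
  exists (mkposreal d dp) => u v hu hv; rewrite !DE upd_id; apply: hd => // k.
  apply: upd_close => // k'; rewrite /upd; case: eqP => [->|_] //.
  by rewrite Rminus_diag Rabs_R0.
- by apply: filter_forall => u; exact: ex_RInt_line.
Qed.

Lemma Jl_is_derive i l f : i \notin l -> contg f -> pd i f -> contg (partial i f) ->
  forall x, is_derive (fun u => Jl l f (upd x i u)) (x i) (Jl l (partial i f) x).
Proof.
move=> il cf df cdf; elim: l il => [_|j l IH] /=.
  by move=> x; exact: partial_correct.
rewrite inE negb_or => /andP [ij il] x; have h := IH il.
have e : partial i (Jl l f) = Jl l (partial i f).
  by apply: functional_extensionality => z; exact: partial_is (h z).
rewrite -e; apply: J_is_derive.
- exact/eqP.
- exact: Jl_cont.
- by move=> z; eexists; apply/is_derive_Reals; exact: h.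
- by rewrite e; exact: Jl_cont.
Qed.

Lemma Jl_zero_off i l f : i \notin l -> (forall x, S <= Rabs (x i) -> f x = 0) ->
  forall x, S <= Rabs (x i) -> Jl l f x = 0.
Proof.
move=> + hz; elim: l => [_|j l IH] //=; rewrite inE negb_or => /andP [ij il] x hx.
apply: RInt_null => t; apply: IH => //; rewrite upd_neq //; exact/eqP.
Qed.

(** The order of integration is never exchanged: the derivative is pulled out of the integrals
    inside that of [i], where the fundamental theorem leaves boundary values, which vanish; the
    outer integrals then integrate zero. *)
Lemma Jl_partial i l f : uniq l -> i \in l -> contg f -> pd i f -> contg (partial i f) ->
  (forall x, S <= Rabs (x i) -> f x = 0) -> forall x, Jl l (partial i f) x = 0.
Proof.
move=> ul il cf df cdf hz; elim: l ul il => //= j l IH /andP [jl ul].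
rewrite inE; case: eqP jl => [<- jl _ x|_ jl /= il x]; last first.
  by apply: RInt_null => t; apply: IH.
have h := Jl_is_derive jl cf df cdf.
have H : is_RInt (fun t => Jl l (partial i f) (upd x i t)) (- S) S
    (minus (Jl l f (upd x i S)) (Jl l f (upd x i (- S)))).
  apply: (is_RInt_derive (fun t => Jl l f (upd x i t))) => t _; last first.
    by apply: continuous_line; exact: Jl_cont.
  have := h (upd x i t); rewrite updE; apply: is_derive_ext => s.
  by rewrite upd_upd.
rewrite /J (is_RInt_unique _ _ _ _ H) !(Jl_zero_off jl hz) ?updE ?Rabs_Ropp ?Rabs_pos_eq //; try lra.
exact: Rminus_diag.
Qed.

Lemma Iint_partial i f : contg f -> pd i f -> contg (partial i f) ->
  (forall x, S <= Rabs (x i) -> f x = 0) -> Iint (partial i f) = 0.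
Proof. by move=> *; apply: Jl_partial => //; rewrite ?enum_uniq ?mem_enum. Qed.

(** The margin [a < S] makes each set where [f] is known to vanish open, so that derivatives of [f]
    vanish there too. *)
Definition supp f := exists a, a < S /\ forall x i, a < Rabs (x i) -> f x = 0.

Lemma opens_off (a : R) (i : 'I_n) : opens (fun x => a < Rabs (x i)).
Proof.
move=> x hx; exists (Rabs (x i) - a); split; first lra.
move=> y hy; have := hy i; have := Rabs_triang_inv (x i) (y i).
rewrite (Rabs_minus_sym (x i)); move=> *; lra.
Qed.

Lemma partial_0 (i : 'I_n) x : partial i (fun _ : point n => 0) x = 0.
Proof. by apply: partial_is; apply: is_derive_const. Qed.

Lemma supp_partial i f : supp f -> supp (partial i f).
Proof.
move=> [a [aS h]]; exists a; split => // x j hx.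
rewrite (partial_loc (g := fun _ => 0) i (@opens_off a j)) ?partial_0 // => y hy.
exact: h hy.
Qed.

Lemma supp_laplacian f : supp f -> supp (laplacian f).
Proof.
move=> [a [aS h]]; exists a; split => // x j hx.
rewrite (laplacian_loc (g := fun _ => 0) (@opens_off a j)) //.
  rewrite /laplacian big1 // => i _.
  rewrite (_ : partial i (fun _ => 0) = (fun _ => 0)) ?partial_0 //.
  by apply: functional_extensionality => y; rewrite partial_0.
by move=> y hy; exact: h hy.
Qed.

Lemma opens_all : opens (fun _ : point n => True).
Proof. by move=> x _; exists 1; split; [lra|]. Qed.

Lemma Iint_0 : Iint (fun _ => 0) = 0.
Proof.
have := Iint_scal 0 (@cont_const n (fun _ => True) 0); by rewrite !Rmult_0_l.
Qed.

Lemma Iint_sum (I : Type) (r : seq I) (F : I -> point n -> R) : (forall i, contg (F i)) ->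
  Iint (fun x => \big[Rplus/0]_(i <- r) F i x) = \big[Rplus/0]_(i <- r) Iint (F i).
Proof.
move=> h; elim: r => [|i r IH].
  rewrite [RHS]big_nil -[RHS]Iint_0; congr (Iint _); apply: functional_extensionality => x; by rewrite big_nil.
rewrite big_cons -IH -Iint_add //; last exact: cont_sum.
by congr (Iint _); apply: functional_extensionality => x; rewrite big_cons.
Qed.

Notation CK k f := (Ck k (fun _ : point n => True) f).

Lemma green_coord i u f : CK 2 u -> CK 2 f -> supp f ->
  Iint (fun x => u x * partial i (partial i f) x - partial i (partial i u) x * f x) = 0.
Proof.
move=> hu hf sf.
have [cu /(_ i) [eu [cpu /(_ i) [epu cppu]]]] := hu.
have [cf /(_ i) [ef [cpf /(_ i) [epf cppf]]]] := hf.
(* The integrand is the [i]-th derivative of this [h]: the mixed terms cancel. *)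
pose h x := u x * partial i f x - partial i u x * f x.
have d x : is_derive (fun t => h (upd x i t)) (x i)
    (u x * partial i (partial i f) x - partial i (partial i u) x * f x).
  have du := partial_correct (eu x I). have df := partial_correct (ef x I).
  have ddu := partial_correct (epu x I). have ddf := partial_correct (epf x I).
  have A := is_derive_mult _ _ _ _ _ du ddf Rmult_comm.
  have B := is_derive_mult _ _ _ _ _ ddu df Rmult_comm.
  have := is_derive_minus _ _ _ _ _ A B.
  rewrite upd_id /minus /plus /opp /mult /=.
  rewrite (_ : _ + _ + - _ = u x * partial i (partial i f) x - partial i (partial i u) x * f x) //.
  ring.
have e : partial i h = (fun x => u x * partial i (partial i f) x - partial i (partial i u) x * f x).
  by apply: functional_extensionality => x; exact: partial_is (d x).
rewrite -e; apply: Iint_partial.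
- by apply: cont_sub; apply: cont_mul.
- by move=> x; eexists; apply/is_derive_Reals; exact: d.
- by rewrite e; apply: cont_sub; apply: cont_mul.
- move=> x hx; have [a [aS ha]] := sf; have [b [bS hb]] := supp_partial i sf.
  by rewrite /h (ha x i) ?(hb x i); [ring|lra|lra].
Qed.

Lemma green u f : CK 2 u -> CK 2 f -> supp f ->
  Iint (fun x => u x * laplacian f x) = Iint (fun x => laplacian u x * f x).
Proof.
move=> hu hf sf; apply: Rminus_diag_uniq.
have cu := Ck_cont hu; have cf := Ck_cont hf.
have clu : contg (laplacian u) by exact: (Ck_cont (Ck_laplacian opens_all hu)).
have clf : contg (laplacian f) by exact: (Ck_cont (Ck_laplacian opens_all hf)).
rewrite -Iint_sub; try exact: cont_mul.
rewrite -[RHS](_ : \big[Rplus/0]_(i < n) 0 = 0); last exact: big1.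
rewrite -(eq_bigr _ (fun i _ => green_coord i hu hf sf)) -Iint_sum.
  congr (Iint _); apply: functional_extensionality => x; rewrite /laplacian.
  rewrite (eq_bigr (fun i => u x * partial i (partial i f) x + (- f x) * partial i (partial i u) x)).
    by rewrite big_split /= !sumR_scal Ropp_mult_distr_l_reverse (Rmult_comm (f x)).
  by move=> i _; ring.
have [_ hu'] := hu; have [_ hf'] := hf.
move=> i; apply: cont_sub; apply: cont_mul => //.
  by have [_ [_ /(_ i) []]] := hf' i.
by have [_ [_ /(_ i) []]] := hu' i.
Qed.

Lemma green_iter k u f : CK (2 * k) u -> CK (2 * k) f -> supp f ->
  Iint (fun x => u x * iter_lap k f x) = Iint (fun x => iter_lap k u x * f x).
Proof.
elim: k u f => // k IH u f; rewrite mulnS => hu hf sf.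
rewrite -iter_lap_lap IH //.
- rewrite green //.
  + by apply: (Ck_iter_lap opens_all).
  + apply: (Ck_le _ hf); exact: leq_addr.
- by apply: (Ck_le _ hu); exact: leq_addl.
- exact: (Ck_laplacian opens_all).
- exact: supp_laplacian.
Qed.

End Integral.

(** * Families of smooth functions of one variable *)

(* [U T] is [C^k] for every [T], with derivatives bounded on [0,1] uniformly in [T >= 1]. *)
Fixpoint smooth (k : nat) (U : R -> R -> R) : Prop :=
  (exists C, forall T s, 1 <= T -> 0 <= s <= 1 -> Rabs (U T s) <= C) /\
  (forall T s, continuous (U T) s) /\
  match k with
  | O => True
  | k'.+1 => (forall T s, ex_derive (U T) s) /\ smooth k' (fun T => Derive (U T))
  end.

Definition smooth1 k (f : R -> R) := smooth k (fun _ => f).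

Lemma is_derive_mulR (f g : R -> R) x df dg :
  is_derive f x df -> is_derive g x dg ->
  is_derive (fun t => f t * g t) x (df * g x + f x * dg).
Proof. move=> hf hg; exact: (is_derive_mult f g x df dg hf hg Rmult_comm). Qed.

Lemma is_derive_addR (f g : R -> R) x df dg :
  is_derive f x df -> is_derive g x dg ->
  is_derive (fun t => f t + g t) x (df + dg).
Proof. exact: (@is_derive_plus R_AbsRing R_NormedModule). Qed.

Lemma bounded01 (f : R -> R) : (forall s, continuous f s) ->
  exists C, forall s, 0 <= s <= 1 -> Rabs (f s) <= C.
Proof.
move=> cf; have cf' s : 0 <= s <= 1 -> continuity_pt (fun s => Rabs (f s)) s.
  move=> _; apply/continuity_pt_filterlim.
  by apply: (continuous_comp f Rabs) => //; exact: continuous_Rabs.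
have [M [hM _]] := continuity_ab_maj _ _ _ Rle_0_1 cf'.
by exists (Rabs (f M)).
Qed.

Section Smooth.
Implicit Types U V : R -> R -> R.

Lemma smooth_bound k U : smooth k U ->
  exists C, forall T s, 1 <= T -> 0 <= s <= 1 -> Rabs (U T s) <= C.
Proof. by case: k => [|k] []. Qed.

Lemma smooth_cont k U : smooth k U -> forall T s, continuous (U T) s.
Proof. by case: k => [|k] [_ []]. Qed.

Lemma smooth_ex_derive k U : smooth k.+1 U -> forall T s, ex_derive (U T) s.
Proof. by move=> [_ [_ []]]. Qed.

Lemma smooth_derive k U : smooth k.+1 U -> smooth k (fun T => Derive (U T)).
Proof. by move=> [_ [_ []]]. Qed.

Lemma smooth_intro k U V :
  (exists C, forall T s, 1 <= T -> 0 <= s <= 1 -> Rabs (U T s) <= C) ->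
  (forall T s, is_derive (U T) s (V T s)) -> smooth k V -> smooth k.+1 U.
Proof.
move=> b d h; split=> //; split.
  by move=> T s; apply: ex_derive_continuous; eexists; exact: d.
split; first by move=> T s; eexists; exact: d.
rewrite (_ : (fun T => Derive (U T)) = V) //.
by apply: functional_extensionality => T; apply: functional_extensionality => s; exact: is_derive_unique.
Qed.

Lemma smooth_pred k U : smooth k.+1 U -> smooth k U.
Proof.
elim: k U => [|k IH] U; first by move=> [b [c _]].
by move=> [b [c [e h]]]; split => //; split => //; split => //; exact: IH.
Qed.

Lemma smooth_le j k U : (j <= k)%N -> smooth k U -> smooth j U.
Proof.
elim: k => [|k IH]; first by case: j.
rewrite leq_eqVlt => /orP [/eqP -> //|h] hf; apply: IH => //; exact: smooth_pred.
Qed.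

Lemma smooth_const k c : smooth k (fun _ _ => c).
Proof.
elim: k c => [|k IH] c.
  split; first by exists (Rabs c) => *; exact: Rle_refl.
  by split=> // T s; exact: continuous_const.
apply: (@smooth_intro _ _ (fun _ _ => 0)) => //.
  by exists (Rabs c) => *; exact: Rle_refl.
by move=> T s; exact: is_derive_const.
Qed.

Lemma smooth_add k U V : smooth k U -> smooth k V -> smooth k (fun T s => U T s + V T s).
Proof.
elim: k U V => [|k IH] U V hU hV.
  have [C hC] := smooth_bound hU; have [C' hC'] := smooth_bound hV.
  split.
    exists (C + C') => T s T1 hs; apply: Rle_trans (Rabs_triang _ _) _.
    by apply: Rplus_le_compat; [apply: hC|apply: hC'].
  by split => // T s; apply: (@continuous_plus _ R_AbsRing R_NormedModule); [exact: (smooth_cont hU)|exact: (smooth_cont hV)].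
apply: (@smooth_intro _ _ (fun T s => Derive (U T) s + Derive (V T) s)).
- exact: (smooth_bound (IH _ _ (smooth_pred hU) (smooth_pred hV))).
- move=> T s; apply: is_derive_addR; apply: Derive_correct; [exact: (smooth_ex_derive hU)|exact: (smooth_ex_derive hV)].
- by apply: IH; exact: smooth_derive.
Qed.

Lemma smooth_mul k U V : smooth k U -> smooth k V -> smooth k (fun T s => U T s * V T s).
Proof.
elim: k U V => [|k IH] U V hU hV.
  have [C hC] := smooth_bound hU; have [C' hC'] := smooth_bound hV.
  split.
    exists (C * C') => T s T1 hs; rewrite Rabs_mult.
    by apply: Rmult_le_compat; try exact: Rabs_pos; [apply: hC|apply: hC'].
  by split => // T s; apply: (@continuous_mult _ R_AbsRing); [exact: (smooth_cont hU)|exact: (smooth_cont hV)].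
apply: (@smooth_intro _ _ (fun T s => Derive (U T) s * V T s + U T s * Derive (V T) s)).
- exact: (smooth_bound (IH _ _ (smooth_pred hU) (smooth_pred hV))).
- move=> T s; apply: is_derive_mulR; apply: Derive_correct; [exact: (smooth_ex_derive hU)|exact: (smooth_ex_derive hV)].
- by apply: smooth_add; apply: IH; try exact: smooth_derive; exact: smooth_pred.
Qed.

Lemma smooth_scal k c U : smooth k U -> smooth k (fun T s => c * U T s).
Proof. by move=> h; apply: smooth_mul => //; exact: smooth_const. Qed.

Lemma smooth_id k : smooth k (fun _ s => s).
Proof.
have b : exists C, forall T s, 1 <= T -> 0 <= s <= 1 -> Rabs s <= C.
  by exists 1 => T s _ hs; rewrite Rabs_pos_eq; lra.
case: k => [|k]; first by split=> //; split => // T s; exact: continuous_id.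
apply: (@smooth_intro _ _ (fun _ _ => 1)) => //; last exact: smooth_const.
by move=> T s; exact: is_derive_id.
Qed.

End Smooth.

Lemma smooth1_bound k f : smooth1 k f -> exists C, forall s, 0 <= s <= 1 -> Rabs (f s) <= C.
Proof. move=> /smooth_bound [C h]; exists C => s hs; exact: (h 1 s (Rle_refl 1) hs). Qed.

Lemma smooth1_cont k f : smooth1 k f -> forall s, continuous f s.
Proof. by move=> /smooth_cont h; exact: (h 0). Qed.

Lemma smooth1_0 f : (forall s, continuous f s) -> smooth1 0 f.
Proof. by move=> c; have [C hC] := bounded01 c; split => //; exists C => T s _; exact: hC. Qed.

Lemma smooth1_intro k f f' : (forall s, is_derive f s (f' s)) -> smooth1 k f' -> smooth1 k.+1 f.
Proof.
move=> d h; apply: (@smooth_intro _ _ (fun _ => f')) => //.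
have [C hC] : exists C, forall s, 0 <= s <= 1 -> Rabs (f s) <= C.
  by apply: bounded01 => s; apply: ex_derive_continuous; eexists; exact: d.
by exists C => T s _; exact: hC.
Qed.

Lemma smooth1_derive k f : smooth1 k.+1 f ->
  (forall s, is_derive f s (Derive f s)) /\ smooth1 k (Derive f).
Proof.
move=> h; split; last exact: smooth_derive h.
move=> s; apply: Derive_correct; exact: (smooth_ex_derive h 0).
Qed.

Lemma smooth1_comp k f g : smooth1 k f -> smooth1 k g -> smooth1 k (fun s => f (g s)).
Proof.
elim: k f => [|k IH] f hf hg.
  apply: smooth1_0 => s; apply: continuous_comp; [exact: (smooth1_cont hg)|exact: (smooth1_cont hf)].
have [df hf'] := smooth1_derive hf; have [dg hg'] := smooth1_derive hg.
apply: (@smooth1_intro _ _ (fun s => Derive g s * Derive f (g s))).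
  by move=> s; apply: (@is_derive_comp R_AbsRing R_NormedModule).
by apply: smooth_mul => //; apply: IH => //; exact: smooth_pred.
Qed.

Lemma smooth1_scale k c f : smooth1 k f -> smooth1 k (fun s => f (c * s)).
Proof. by move=> h; apply: (smooth1_comp h); apply: smooth_scal; exact: smooth_id. Qed.

Lemma smooth1_sub k f g : smooth1 k f -> smooth1 k g -> smooth1 k (fun s => f s - g s).
Proof.
move=> hf hg; rewrite (_ : (fun s => f s - g s) = (fun s => f s + (-1) * g s)).
  by apply: smooth_add => //; exact: smooth_scal.
by apply: functional_extensionality => s; ring.
Qed.

Lemma is_derive_Rpower (s p : R) : 0 < s -> is_derive (fun t => Rpower t p) s (p * Rpower s (p - 1)).
Proof. by move=> s0; apply/is_derive_Reals; exact: derivable_pt_lim_power. Qed.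

Lemma smooth1_Rpower k f p : smooth1 k f -> (forall s, 0 < f s) ->
  smooth1 k (fun s => Rpower (f s) p).
Proof.
move=> + f0; elim: k p => [|k IH] p hf.
  apply: smooth1_0 => s; apply: (continuous_comp f (fun t => Rpower t p)); first exact: (smooth1_cont hf).
  by apply: ex_derive_continuous; eexists; exact: is_derive_Rpower.
have [df hf'] := smooth1_derive hf.
apply: (@smooth1_intro _ _ (fun s => Derive f s * (p * Rpower (f s) (p - 1)))).
  move=> s; apply: (@is_derive_comp R_AbsRing R_NormedModule (fun t => Rpower t p)) => //.
  exact: is_derive_Rpower.
apply: smooth_mul => //; apply: smooth_scal; apply: IH; exact: smooth_pred.
Qed.

(** The truncated power [(1-s)_+^N], of class [C^(N-1)]. Its derivative is of the same kind, and
    finite smoothness suffices, so the smooth cutoff and the regularizations are built from it. *)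
Definition ppow (N : nat) (s : R) : R := (Rmax 0 (1 - s)) ^ N.

Lemma continuous_pos_part s : continuous (fun t => Rmax 0 (1 - t)) s.
Proof.
apply: (@continuous_ext _ _ (fun t => (1 - t + Rabs (1 - t)) / 2)).
  move=> t; rewrite /Rmax; case: Rle_dec => h; [rewrite Rabs_pos_eq|rewrite Rabs_left]; lra.
have c : continuous (fun t => 1 - t) s.
  by apply: (@continuous_minus _ R_AbsRing R_NormedModule); [exact: continuous_const|exact: continuous_id].
apply: (@continuous_mult _ R_AbsRing); last exact: continuous_const.
apply: (@continuous_plus _ R_AbsRing R_NormedModule) => //.
by apply: (continuous_comp (fun t => 1 - t) Rabs) => //; exact: continuous_Rabs.
Qed.

Lemma ppow_right N s : 1 <= s -> ppow N.+1 s = 0.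
Proof. by move=> h; rewrite /ppow Rmax_left /=; [ring|lra]. Qed.

Lemma ppow_left N s : s <= 1 -> ppow N s = (1 - s) ^ N.
Proof. by move=> h; rewrite /ppow Rmax_right //; lra. Qed.

Lemma ppow_ge0 N s : 0 <= ppow N s.
Proof. by apply: pow_le; exact: Rmax_l. Qed.

Lemma is_derive_ppow N s : is_derive (ppow N.+2) s (- INR N.+2 * ppow N.+1 s).
Proof.
have dl t : is_derive (fun t => (1 - t) ^ N.+2) t (- INR N.+2 * (1 - t) ^ N.+1).
  auto_derive => //; rewrite -/(INR N.+1) -(S_INR N.+1) -tech_pow_Rmult /Rminus; ring.
case: (Rtotal_order s 1) => [h|[->|h]].
- rewrite ppow_left; last lra.
  apply: is_derive_ext_loc (dl s); apply: filter_imp (open_lt 1 s h) => t ht.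
  by rewrite ppow_left //; lra.
(* At [s = 1] the difference quotient is 0 from the right and [-(-h)^(N+1)] from the left, and the
   latter is at most [|h|] in absolute value. *)
- rewrite ppow_right; last lra.
  rewrite Rmult_0_r; apply/is_derive_Reals => e e0.
  exists (mkposreal _ (Rmin_pos _ _ e0 Rlt_0_1)) => h h0 hd /=.
  have he : Rabs h < e by apply: Rlt_le_trans hd (Rmin_l _ _).
  have h1 : Rabs h < 1 by apply: Rlt_le_trans hd (Rmin_r _ _).
  rewrite (@ppow_right _ 1); last lra.
  have [hp|hn] := Rle_or_lt 0 h.
    rewrite ppow_right; last lra.
    by rewrite (_ : (0 - 0) / h - 0 = 0) ?Rabs_R0 //; field.
  rewrite ppow_left; last lra.
  rewrite (_ : ((1 - (1 + h)) ^ N.+2 - 0) / h - 0 = - (- h) ^ N.+1).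
    rewrite Rabs_Ropp -RPow_abs Rabs_Ropp; apply: Rle_lt_trans he.
    rewrite -tech_pow_Rmult -[X in _ <= X]Rmult_1_r; apply: Rmult_le_compat_l; first exact: Rabs_pos.
    rewrite -(pow1 N); apply: pow_incr; split; [exact: Rabs_pos|lra].
  by rewrite (_ : 1 - (1 + h) = - h); [rewrite -tech_pow_Rmult; field|ring].
- rewrite ppow_right; last lra.
  rewrite Rmult_0_r; apply: (@is_derive_ext_loc _ _ (fun _ => 0)); last exact: is_derive_const.
  by apply: filter_imp (open_gt 1 s h) => t ht; rewrite ppow_right //; lra.
Qed.

Lemma smooth1_ppow k : smooth1 k (ppow k.+1).
Proof.
elim: k => [|k IH].
  apply: smooth1_0 => s; apply: (continuous_ext (fun t => Rmax 0 (1 - t))); last exact: continuous_pos_part.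
  by move=> t; rewrite /ppow pow_1.
apply: smooth1_intro; first exact: is_derive_ppow.
exact: smooth_scal.
Qed.

(** * Radial functions *)

(* The Laplacian of [z |-> f (|z - y|^2)] is [z |-> Lop n f (|z - y|^2)]. *)
Definition Lop (n : nat) (f : R -> R) : R -> R :=
  fun s => 4 * s * Derive (Derive f) s + 2 * INR n * Derive f s.

Definition Lit (n k : nat) (f : R -> R) : R -> R := iter k (Lop n) f.

Lemma smooth_Lop n k (U : R -> R -> R) : smooth k.+2 U -> smooth k (fun T => Lop n (U T)).
Proof.
move=> h; have h1 := smooth_derive h; have h2 := smooth_derive h1.
apply: smooth_add; last by apply: smooth_scal; exact: smooth_pred h1.
by apply: smooth_mul h2; apply: smooth_scal; exact: smooth_id.
Qed.

Lemma smooth_Lit n k j (U : R -> R -> R) : smooth (k + 2 * j) U ->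
  smooth k (fun T => Lit n j (U T)).
Proof.
elim: j k U => [|j IH] k U; first by rewrite muln0 addn0.
rewrite mulnS addnA => h; rewrite /Lit /=; apply: smooth_Lop; rewrite -addn2.
exact: IH.
Qed.

Lemma Lop_loc n (f g : R -> R) a : (forall s, a < s -> f s = g s) ->
  forall s, a < s -> Lop n f s = Lop n g s.
Proof.
move=> e s hs; have L t : a < t -> locally t (fun u => a < u) by move=> h; exact: (open_gt a t h).
have e1 t : a < t -> Derive f t = Derive g t.
  by move=> ht; apply: Derive_ext_loc; apply: filter_imp (L t ht) => u; exact: e.
rewrite /Lop e1 //; congr (_ * _ + _); apply: Derive_ext_loc.
by apply: filter_imp (L s hs) => u; exact: e1.
Qed.

Lemma Lit_loc n k (f g : R -> R) a : (forall s, a < s -> f s = g s) ->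
  forall s, a < s -> Lit n k f s = Lit n k g s.
Proof. by elim: k => [|k IH] e s hs; [exact: e|apply: (@Lop_loc _ _ _ a) => //; exact: IH]. Qed.

Lemma Lop_scal n c f : Lop n (fun s => c * f s) = (fun s => c * Lop n f s).
Proof.
apply: functional_extensionality => s; rewrite /Lop.
have -> : Derive (fun s => c * f s) = (fun s => c * Derive f s).
  by apply: functional_extensionality => t; exact: Derive_scal.
rewrite Derive_scal; ring.
Qed.

Lemma Lit_scal n k c f : Lit n k (fun s => c * f s) = (fun s => c * Lit n k f s).
Proof. by elim: k => //= k IH; rewrite /Lit /= -/(Lit n k _) IH Lop_scal. Qed.

Lemma Lit_S n k f : Lit n k.+1 f = Lop n (Lit n k f).
Proof. by []. Qed.

Lemma Lit_Sr n k f : Lit n k.+1 f = Lit n k (Lop n f).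
Proof. by rewrite /Lit iterSr. Qed.

Lemma Lop_add n f g : smooth1 2 f -> smooth1 2 g ->
  Lop n (fun s => f s + g s) = (fun s => Lop n f s + Lop n g s).
Proof.
move=> hf hg; have [df hf'] := smooth1_derive hf; have [dg hg'] := smooth1_derive hg.
have [ddf _] := smooth1_derive hf'; have [ddg _] := smooth1_derive hg'.
apply: functional_extensionality => s; rewrite /Lop.
have -> : Derive (fun s => f s + g s) = (fun s => Derive f s + Derive g s).
  by apply: functional_extensionality => t; apply: is_derive_unique; exact: is_derive_addR.
rewrite (is_derive_unique _ _ _ (is_derive_addR (ddf s) (ddg s))); ring.
Qed.

Lemma Lop_sub n f g : smooth1 2 f -> smooth1 2 g ->
  Lop n (fun s => f s - g s) = (fun s => Lop n f s - Lop n g s).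
Proof.
move=> hf hg.
have -> : (fun s => f s - g s) = (fun s => f s + (-1) * g s).
  by apply: functional_extensionality => s; ring.
rewrite Lop_add ?Lop_scal //; first by apply: functional_extensionality => s; ring.
exact: smooth_scal.
Qed.

Lemma Lit_sub n k f g : smooth1 (2 * k) f -> smooth1 (2 * k) g ->
  Lit n k (fun s => f s - g s) = (fun s => Lit n k f s - Lit n k g s).
Proof.
elim: k => [|k IH] // hf hg; rewrite !Lit_S IH; try by apply: smooth_le; [|eassumption]; rewrite mulnS leq_addl.
have sf h : smooth1 (2 * k.+1) h -> smooth1 2 (Lit n k h).
  by rewrite mulnS => hh; exact: (@smooth_Lit n 2 k (fun _ => h)).
by rewrite Lop_sub //; exact: sf.
Qed.

Lemma Lop_scale n c f : smooth1 2 f ->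
  Lop n (fun s => f (c * s)) = (fun s => c * Lop n f (c * s)).
Proof.
move=> hf; have [df hf'] := smooth1_derive hf; have [ddf _] := smooth1_derive hf'.
have dl s : is_derive (fun s => c * s) s c by auto_derive => //; ring.
have D (h : R -> R) h' : (forall s, is_derive h s (h' s)) ->
    Derive (fun s => h (c * s)) = (fun s => c * h' (c * s)).
  move=> dh; apply: functional_extensionality => s; apply: is_derive_unique.
  exact: (@is_derive_comp R_AbsRing R_NormedModule h (fun s => c * s)).
apply: functional_extensionality => s; rewrite /Lop (D _ _ df) Derive_scal (D _ _ ddf); ring.
Qed.

Lemma Lit_scale n k c f : smooth1 (2 * k) f ->
  Lit n k (fun s => f (c * s)) = (fun s => c ^ k * Lit n k f (c * s)).
Proof.
elim: k => [|k IH] hf.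
  by apply: functional_extensionality => s; rewrite /Lit /=; ring.
rewrite Lit_S IH; last by apply: smooth_le hf; rewrite mulnS leq_addl.
rewrite Lop_scal Lop_scale; last by move: hf; rewrite mulnS; exact: (@smooth_Lit n 2 k (fun _ => f)).
by apply: functional_extensionality => s; rewrite Lit_S /=; ring.
Qed.

(** In terms of [z] this is [Delta |z|^(2p) = 2p (2p-2+n) |z|^(2p-2)]. *)
Lemma Lop_power n f a c p : 0 <= a -> (forall s, a < s -> f s = c * Rpower s p) ->
  forall s, a < s -> Lop n f s = (4 * c * p * (p - 1 + INR n / 2)) * Rpower s (p - 1).
Proof.
move=> a0 e s hs; rewrite (Lop_loc n e) // Lop_scal.
have s0 : 0 < s by lra.
have D q t : 0 < t -> Derive (fun u => Rpower u q) t = q * Rpower t (q - 1).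
  by move=> t0; apply: is_derive_unique; exact: is_derive_Rpower.
rewrite /Lop D // (Derive_ext_loc _ (fun t => p * Rpower t (p - 1))); last first.
  by apply: filter_imp (open_gt 0 s s0) => t; exact: D.
rewrite Derive_scal D //.
have -> : Rpower s (p - 1) = s * Rpower s (p - 1 - 1).
  by rewrite -{2}(Rpower_1 s) // -Rpower_plus; congr Rpower; ring.
field.
Qed.

Lemma Lop_continuous n f : smooth1 2 f -> forall s, continuous (Lop n f) s.
Proof. by move=> h; exact: (smooth1_cont (@smooth_Lop n 0 (fun _ => f) h)). Qed.

Section Radial.
Context {n : nat} (y : point n).

(** The squared distance is a polynomial, so smoothness of [U] passes to [rad U] at the centre [y]
    as well. *)
Definition rad (U : R -> R) : point n -> R := fun z => U (sqn (fun i => z i - y i)).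

Lemma is_derive_sqd z (i : 'I_n) t :
  is_derive (fun t => sqn (fun j => upd z i t j - y j)) t (2 * (t - y i)).
Proof.
pose c := \big[Rplus/0]_(j < n | j != i) Rsqr (z j - y j).
apply: (is_derive_ext (fun t => Rsqr (t - y i) + c)).
  move=> u; rewrite /sqn (bigD1 i) //= updE /c; congr (_ + _).
  by apply: eq_bigr => j /eqP ji; rewrite upd_neq.
by rewrite /Rsqr; auto_derive => //; ring.
Qed.

Lemma is_derive_rad U z i : (forall s, is_derive U s (Derive U s)) ->
  is_derive (fun t => rad U (upd z i t)) (z i) (2 * (z i - y i) * rad (Derive U) z).
Proof.
move=> d; have := @is_derive_comp R_AbsRing R_NormedModule U
  (fun t => sqn (fun j => upd z i t j - y j)) (z i) _ _ (d _) (is_derive_sqd z i (z i)).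
by rewrite upd_id.
Qed.

Lemma partial_rad U i : (forall s, is_derive U s (Derive U s)) ->
  partial i (rad U) = (fun z => 2 * (z i - y i) * rad (Derive U) z).
Proof.
by move=> d; apply: functional_extensionality => z; apply: partial_is; exact: is_derive_rad.
Qed.

Lemma cont_rad (D : point n -> Prop) U : (forall s, continuous U s) -> cont_on D (rad U).
Proof.
move=> c; apply: (cont_comp (h := U)) => //; apply: cont_sum => i.
rewrite /Rsqr; apply: cont_mul; apply: cont_sub; try exact: cont_coord; exact: cont_const.
Qed.

Lemma Ck_rad k U : smooth1 k U -> Ck k (fun _ => True) (rad U).
Proof.
elim: k U => [|k IH] U hU; first exact: cont_rad (smooth1_cont hU).
have [dU hU'] := smooth1_derive hU.
split; first exact: cont_rad (smooth1_cont hU).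
move=> i; split; first by move=> z _; eexists; apply/is_derive_Reals; exact: is_derive_rad.
rewrite partial_rad //; apply: Ck_mul; [exact: opens_all| |exact: IH].
apply: Ck_mul; [exact: opens_all|exact: (Ck_const opens_all)|].
apply: Ck_add; [exact: opens_all|exact: (Ck_coord opens_all)|exact: (Ck_const opens_all)].
Qed.

Lemma laplacian_rad U : smooth1 2 U -> laplacian (rad U) = rad (Lop n U).
Proof.
move=> hU; have [dU hU'] := smooth1_derive hU; have [ddU _] := smooth1_derive hU'.
apply: functional_extensionality => z; rewrite /laplacian /rad /Lop.
set s := sqn _.
rewrite (eq_bigr (fun i => (2 * Derive U s) + (4 * Derive (Derive U) s) * Rsqr (z i - y i))).
  rewrite big_split /= sumR_const sumR_scal -/(sqn (fun i => z i - y i)) -/s; ring.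
move=> i _; apply: partial_is; rewrite partial_rad //.
have d1 : is_derive (fun t => 2 * (upd z i t i - y i)) (z i) 2.
  apply: (is_derive_ext (fun t => 2 * (t - y i))); first by move=> t; rewrite updE.
  by auto_derive => //; ring.
have := is_derive_mulR d1 (is_derive_rad z i ddU).
rewrite updE upd_id /rad -/s.
rewrite (_ : 2 * Derive U s + 2 * (z i - y i) * (2 * (z i - y i) * Derive (Derive U) s) =
  2 * Derive U s + 4 * Derive (Derive U) s * Rsqr (z i - y i)) //.
by rewrite /Rsqr; ring.
Qed.

Lemma iter_lap_rad k U : smooth1 (2 * k) U -> iter_lap k (rad U) = rad (Lit n k U).
Proof.
elim: k U => [|k IH] U //; rewrite mulnS => hU.
rewrite -iter_lap_lap laplacian_rad; last by apply: smooth_le hU; exact: leq_addr.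
by rewrite IH ?Lit_Sr //; exact: (@smooth_Lop n _ (fun _ => U)).
Qed.

End Radial.

(* Equal to [s] for [s >= 1], positive everywhere and [C^(N-1)]: powers of [tau N (|z|^2)] are
   powers of [|z|^2] regularized at the origin. *)
Definition tau (N : nat) (s : R) : R := s + ppow N s / INR N.

Lemma bernoulli (x : R) N : -1 <= x -> 1 + INR N * x <= (1 + x) ^ N.
Proof.
move=> hx; elim: N => [|N IH]; first by rewrite /=; lra.
rewrite S_INR -tech_pow_Rmult.
have h1 : 0 <= 1 + x by lra.
have := Rmult_le_compat_l _ _ _ h1 IH; move=> A; have B := pos_INR N; have := Rle_0_sqr x; rewrite /Rsqr => C.
have D := Rmult_le_pos _ _ B C; lra.
Qed.

Section Tau.
Context (N : nat) (N1 : (1 < N)%N).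

Lemma INR_N : 1 < INR N.
Proof. by apply: (lt_INR 1); apply/ltP. Qed.

Lemma tau_right s : 1 <= s -> tau N s = s.
Proof. by case: N N1 => // M _ h; rewrite /tau ppow_right // /Rdiv; ring. Qed.

(** For [s < 1], negative [s] included, Bernoulli's inequality gives [(1-s)^N >= 1 - N s]; dividing
    by [N] and adding [s] leaves [1/N]. *)
Lemma tau_lower s : / INR N <= tau N s.
Proof.
have N0 := INR_N.
have [h|h] := Rle_or_lt 1 s.
  rewrite tau_right //; apply: Rle_trans h; rewrite -Rinv_1.
  by apply: Rinv_le_contravar; lra.
rewrite /tau ppow_left; last lra.
have s1 : -1 <= - s by lra.
have i0 : 0 <= / INR N by apply: Rlt_le; apply: Rinv_0_lt_compat; lra.
have := Rmult_le_compat_r (/ INR N) _ _ i0 (bernoulli N s1).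
rewrite (_ : (1 + INR N * - s) * / INR N = / INR N - s); last by field; lra.
rewrite /Rdiv /Rminus => ?; lra.
Qed.

Lemma tau_pos s : 0 < tau N s.
Proof.
apply: Rlt_le_trans (tau_lower s); apply: Rinv_0_lt_compat; have := INR_N => ?; lra.
Qed.

Lemma tau_ge s : s <= tau N s.
Proof.
have N0 := INR_N; have := ppow_ge0 N s => p.
have : 0 <= ppow N s / INR N by apply: Rdiv_le_0_compat; lra.
rewrite /tau => ?; lra.
Qed.

Lemma tau_le s : 0 <= s -> tau N s <= 1 + s.
Proof.
move=> s0; have N0 := INR_N.
have p1 : ppow N s <= 1.
  rewrite -(pow1 N); apply: pow_incr; split; [exact: Rmax_l|].
  by rewrite /Rmax; case: Rle_dec; lra.
have : ppow N s / INR N <= 1.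
  apply: (Rmult_le_reg_r (INR N)); first lra.
  rewrite /Rdiv Rmult_assoc Rinv_l; lra.
rewrite /tau => ?; lra.
Qed.

Lemma smooth1_tau k : (k < N)%N -> smooth1 k (tau N).
Proof.
case: N => // M hk; apply: smooth_add; first exact: smooth_id.
have := smooth_scal (/ INR M.+1) (@smooth_le k M (fun _ => ppow M.+1) hk (smooth1_ppow M)).
rewrite /smooth1 (_ : (fun _ s => ppow M.+1 s / INR M.+1) = (fun _ s => / INR M.+1 * ppow M.+1 s)) //.
by apply: functional_extensionality => _; apply: functional_extensionality => s; rewrite /Rdiv Rmult_comm.
Qed.

End Tau.

(** * Regularized fundamental solutions *)

Lemma Rpower_pos (x p : R) : 0 < Rpower x p.
Proof. exact: exp_pos. Qed.

Lemma Rpower_neg_le (x y p : R) : 0 < x -> x <= y -> p <= 0 -> Rpower y p <= Rpower x p.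
Proof.
move=> x0 xy p0; rewrite /Rpower.
have : p * ln y <= p * ln x by have := ln_le _ _ x0 xy => ?; nra.
by case=> [h|->]; [apply: Rlt_le; exact: exp_increasing|exact: Rle_refl].
Qed.

Lemma ppow_le1 N s : 0 <= s -> ppow N s <= 1.
Proof.
move=> s0; rewrite -(pow1 N); apply: pow_incr; split; [exact: Rmax_l|].
by rewrite /Rmax; case: Rle_dec => *; lra.
Qed.

Section TauDeriv.
Context (M : nat).
Let N := M.+3.

(** The factor [1/N] in [tau] is chosen so that the derivative lies between 0 and 1 for [s >= 0] and
    vanishes at 0. *)
Lemma is_derive_tau s : is_derive (tau N) s (1 - ppow M.+2 s).
Proof.
have Np : 0 < INR N by apply: lt_0_INR; apply/ltP.
have h t : t + / INR N * ppow N t = tau N t by rewrite /tau /Rdiv; ring.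
have := is_derive_addR (is_derive_id s) (is_derive_scal _ s (/ INR N) _ (is_derive_ppow M.+1 s)).
have -> : one + / INR N * (- INR N * ppow M.+2 s) = 1 - ppow M.+2 s.
  by transitivity (1 + / INR N * (- INR N * ppow M.+2 s)); last by field; lra.
exact: is_derive_ext h.
Qed.

Lemma is_derive_tau' s : is_derive (fun s => 1 - ppow M.+2 s) s (INR M.+2 * ppow M.+1 s).
Proof.
have e : INR M.+2 * ppow M.+1 s = minus zero (- INR M.+2 * ppow M.+1 s).
  by rewrite /minus /plus /opp /zero /=; ring.
rewrite e; exact: (is_derive_minus _ _ s _ _ (is_derive_const 1 s) (is_derive_ppow M s)).
Qed.

(* For the exponent [1 - n/2] the first order terms of [Lop] cancel up to a nonnegative
   remainder, so [rad (tau ^ (1 - n/2))] is a superharmonic regularization of [|z| ^ (2 - n)]. *)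
Lemma Lop_tau_le n s : 2 < INR n -> 0 <= s ->
  4 * (INR n / 2 - 1) * s * Rpower (tau N s) (- (INR n / 2)) * (INR M.+2 * ppow M.+1 s)
  <= - Lop n (fun s => Rpower (tau N s) (1 - INR n / 2)) s.
Proof.
move=> n2 s0; have N1 : (1 < N)%N by [].
have tp := tau_pos N1.
set a := INR n / 2; have a1 : 0 < a - 1 by rewrite /a; lra.
have D p t : is_derive (fun s => Rpower (tau N s) p) t ((1 - ppow M.+2 t) * (p * Rpower (tau N t) (p - 1))).
  apply: (@is_derive_comp R_AbsRing R_NormedModule (fun t => Rpower t p)); last exact: is_derive_tau.
  exact: is_derive_Rpower.
have D1 : Derive (fun s => Rpower (tau N s) (1 - a)) =
    (fun t => (1 - ppow M.+2 t) * ((1 - a) * Rpower (tau N t) (1 - a - 1))).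
  by apply: functional_extensionality => t; exact: is_derive_unique (D _ t).
have D2 := is_derive_mulR (is_derive_tau' s) (is_derive_scal _ s (1 - a) _ (D (1 - a - 1) s)).
rewrite /Lop D1 (is_derive_unique _ _ _ D2) /scal /= /mult /=.
set P := ppow M.+2 s; set Q := ppow M.+1 s.
have -> : INR n = 2 * a by rewrite /a; field.
set w := Rpower (tau N s) (1 - a - 1 - 1).
have e1 : Rpower (tau N s) (1 - a - 1) = tau N s * w.
  by rewrite -{2}(Rpower_1 (tau N s)) // /w -Rpower_plus; congr Rpower; ring.
have e2 : Rpower (tau N s) (- a) = tau N s * w by rewrite -e1; congr Rpower; ring.
rewrite e1 e2.
have w0 : 0 < w by exact: Rpower_pos.
have P1 : P <= 1 by exact: ppow_le1.
have P0 : 0 <= P by exact: ppow_ge0.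
have R0 : 0 <= tau N s - s * (1 - P).
  have := ppow_ge0 N s => h.
  have Np : 0 < INR N by apply: lt_0_INR; apply/ltP.
  have : 0 <= ppow N s / INR N by apply: Rdiv_le_0_compat.
  rewrite /tau => ?; have sP := Rmult_le_pos _ _ s0 P0; lra.
set q := INR (2 + M) * Q; set u := tau N s in R0 *.
(* The nonnegative remainder, by [tau >= s >= s (1 - P)]. For [s >= 1] it is zero, as [|z|^(2-n)] is
   harmonic away from the origin. *)
have K : 0 <= (a - 1) * w * (4 * a * (1 - P) * (u - s * (1 - P))).
  apply: Rmult_le_pos; first nra.
  apply: Rmult_le_pos => //; nra.
have -> : - (4 * s * (q * ((1 - a) * (u * w)) + (1 - P) * ((1 - a) * ((1 - P) * ((1 - a - 1) * w)))) +
   2 * (2 * a) * ((1 - P) * ((1 - a) * (u * w)))) =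
   4 * (a - 1) * s * (u * w) * q + (a - 1) * w * (4 * a * (1 - P) * (u - s * (1 - P))) by ring.
lra.
Qed.

End TauDeriv.

Section Kernel.
Context (m n : nat) (m0 : (0 < m)%N) (hodd : odd m) (hmn : (2 * m < n)%N).
(** This [N] makes [tau N] of class [C^(2m)], and [|z|^(2m-n)] is the power [q] of [|z|^2]. *)
Let N := (2 * m).+1.
Let q := INR m - INR n / 2.

Let N1 : (1 < N)%N.
Proof. by rewrite /N ltnS muln_gt0. Qed.

Let q0 : q < 0.
Proof.
have : INR (2 * m) < INR n by apply: lt_INR; apply/ltP.
by rewrite mult_INR /q /= => ?; lra.
Qed.

Definition gam (s : R) : R := Rpower (tau N s) q.

Lemma smooth1_gam : smooth1 (2 * m) gam.
Proof. by apply: smooth1_Rpower; [exact: smooth1_tau|exact: tau_pos]. Qed.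

(** Away from the origin, [Delta^k |z|^(2m-n) = gcoef k * |z|^(2m-n-2k)]. *)
Fixpoint gcoef (k : nat) : R :=
  if k is k'.+1 then 4 * gcoef k' * (q - INR k') * (q - INR k' - 1 + INR n / 2) else 1.

Lemma Lit_gam k s : 1 < s -> Lit n k gam s = gcoef k * Rpower s (q - INR k).
Proof.
elim: k s => [|k IH] s hs.
  by rewrite /Lit /= /gam tau_right ?Rmult_1_l ?Rminus_0_r //; lra.
rewrite Lit_S (Lop_power n Rle_0_1 IH hs) S_INR /=; congr (_ * Rpower _ _); ring.
Qed.

(** After [m-1] Laplacians the power is [|z|^(2-n)], which is harmonic: the last factor vanishes. *)
Lemma gcoef_m : gcoef m = 0.
Proof.
rewrite -(prednK m0) /= /q.
have -> : INR m = INR m.-1 + 1 by rewrite -S_INR prednK.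
ring.
Qed.

(** Up to order [m-1] each Laplacian contributes a negative factor [q - k] and a positive factor
    [m - k - 1]. *)
Lemma gcoef_sign k : (k < m)%N -> 0 < (-1) ^ k * gcoef k.
Proof.
elim: k => [|k IH] hk; first by rewrite /=; lra.
have {}IH := IH (ltnW hk).
have km : INR k + 1 < INR m by rewrite -S_INR; apply: lt_INR; apply/ltP.
have k0 := pos_INR k.
have -> : (-1) ^ k.+1 * gcoef k.+1 =
   4 * ((-1) ^ k * gcoef k) * ((INR k - q) * (q - INR k - 1 + INR n / 2)) by rewrite /=; ring.
apply: Rmult_lt_0_compat; first lra.
apply: Rmult_lt_0_compat; first by lra.
by rewrite /q; lra.
Qed.

Let c1 := gcoef m.-1.

(** The exponent [m-1] in [gcoef_sign] is even because [m] is odd. *)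
Let c1_pos : 0 < c1.
Proof.
have mm : (m.-1 < m)%N by rewrite prednK.
have := gcoef_sign mm.
have -> : (-1) ^ m.-1 = 1.
  have h : ~~ odd m.-1 by have := hodd; rewrite -{1}(prednK m0).
  rewrite -[m.-1]odd_double_half (negbTE h) add0n -muln2 mulnC pow_mult.
  by rewrite (_ : (-1) ^ 2 = 1) ?pow1 //; ring.
by rewrite Rmult_1_l.
Qed.

(** The regularization of [|z|^(2m-n)] at scale [r], as a function of [s = |z|^2]; the prefactor
    restores homogeneity. *)
Definition Gam (r s : R) : R := / r ^ (n - 2 * m) * gam (/ (r * r) * s).

Lemma smooth1_Gam r : smooth1 (2 * m) (Gam r).
Proof. by apply: smooth_scal; apply: smooth1_scale; exact: smooth1_gam. Qed.

Lemma Lit_Gam k r : (k <= m)%N -> 0 < r ->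
  Lit n k (Gam r) = (fun s => / r ^ (n - 2 * (m - k)) * Lit n k gam (/ (r * r) * s)).
Proof.
move=> km r0; rewrite /Gam Lit_scal Lit_scale; last first.
  by apply: smooth_le smooth1_gam; rewrite leq_mul2l km orbT.
apply: functional_extensionality => s; rewrite -Rmult_assoc; congr (_ * _).
have -> : (n - 2 * (m - k) = n - 2 * m + 2 * k)%N.
  apply/eqP; rewrite -(eqn_add2r (2 * (m - k))) subnK; last first.
    by apply: leq_trans (ltnW hmn); rewrite leq_mul2l leq_subr orbT.
  by rewrite -addnA -mulnDr subnKC // subnK // ltnW.
rewrite pow_add pow_mult /= Rmult_1_r pow_inv; field; split; apply: pow_nonzero; nra.
Qed.

Lemma Lit_m_Gam r : 0 < r -> Lit n m (Gam r) = (fun s => / r ^ n * Lit n m gam (/ (r * r) * s)).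
Proof. by move=> r0; rewrite Lit_Gam // subnn muln0 subn0. Qed.

Lemma Gam_bound : exists C, 0 < C /\ forall r s, 0 < r -> 0 <= s ->
  0 < Gam r s /\ Gam r s <= C * / r ^ (n - 2 * m).
Proof.
exists (Rpower (/ INR N) q); split; first exact: Rpower_pos.
move=> r s r0 s0; have rp : 0 < / r ^ (n - 2 * m) by apply: Rinv_0_lt_compat; exact: pow_lt.
split; first by apply: Rmult_lt_0_compat => //; exact: Rpower_pos.
rewrite /Gam Rmult_comm; apply: Rmult_le_compat_r; first lra.
apply: Rpower_neg_le; [|exact: tau_lower|lra].
by apply: Rinv_0_lt_compat; have := INR_N N1 => ?; lra.
Qed.

(** The value is independent of [r], so differences of two such kernels have compact support. *)
Lemma Gam_far r s : 0 < r -> r * r <= s -> Gam r s = Rpower s q.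
Proof.
move=> r0 hs; have r2 : 0 < r * r by nra.
have i2 : 0 < / (r * r) by exact: Rinv_0_lt_compat.
rewrite /Gam /gam tau_right //; last first.
  rewrite -(Rinv_l (r * r)); last lra.
  by apply: Rmult_le_compat_l => //; lra.
have -> : Rpower (/ (r * r) * s) q = r ^ (n - 2 * m) * Rpower s q.
  rewrite -Rpower_mult_distr //; last lra.
  congr (_ * _); rewrite -Rpower_pow // /Rpower ln_Rinv // ln_mult //.
  congr exp; rewrite minus_INR; last by apply/leP; exact: ltnW.
  by rewrite mult_INR /q /=; field.
by rewrite -Rmult_assoc Rinv_l ?Rmult_1_l //; apply: pow_nonzero; lra.
Qed.

(** With [kernel_mass] this makes [-Delta^m Gam_r] serve as an approximate identity as [r] tends to
    0, up to a positive factor and without a pointwise sign. *)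
Lemma Lit_Gam_bound : exists C, 0 < C /\ forall r s, 0 < r -> 0 <= s ->
  Rabs (Lit n m (Gam r) s) <= C * / r ^ n /\ (r * r < s -> Lit n m (Gam r) s = 0).
Proof.
have sm : smooth1 0 (Lit n m gam) by exact: (@smooth_Lit n 0 m (fun _ => gam) smooth1_gam).
have [C hC] := smooth1_bound sm.
have z s : 1 < s -> Lit n m gam s = 0 by move=> hs; rewrite Lit_gam // gcoef_m Rmult_0_l.
have hC' s : 0 <= s -> Rabs (Lit n m gam s) <= Rabs C + 1.
  move=> s0; have C0 := Rabs_pos C; have [s1|s1] := Rle_or_lt s 1.
    by apply: Rle_trans (hC _ (conj s0 s1)) _; have := Rle_abs C => ?; lra.
  by rewrite z // Rabs_R0; lra.
exists (Rabs C + 1); split; first by have := Rabs_pos C => ?; lra.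
move=> r s r0 s0; have r2 : 0 < r * r by nra.
have i2 : 0 < / (r * r) by exact: Rinv_0_lt_compat.
have rp : 0 < / r ^ n by apply: Rinv_0_lt_compat; exact: pow_lt.
rewrite Lit_m_Gam //; split.
  rewrite Rabs_mult Rabs_pos_eq; last lra.
  rewrite Rmult_comm; apply: Rmult_le_compat_r; first lra.
  by apply: hC'; nra.
move=> hs; rewrite z ?Rmult_0_r // -(Rinv_l (r * r)); last lra.
by apply: Rmult_lt_compat_l.
Qed.

Lemma laplacian_const k c (x : point k) : laplacian (fun _ => c) x = 0.
Proof.
rewrite /laplacian big1 // => i _.
have d b z : partial i (fun _ : point k => b) z = 0 by apply: partial_is; exact: is_derive_const.
by rewrite (_ : partial i (fun _ => c) = (fun _ => 0)) ?d //; apply: functional_extensionality => z; rewrite d.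
Qed.

Lemma supp_rad S r (y : point n) U : enorm y + r < S -> 0 < r -> (forall s, r * r < s -> U s = 0) ->
  supp S (rad y U).
Proof.
move=> yS r0 hU; exists (enorm y + r); split => // x i hx.
have hyi := coord_le_enorm y i.
have A : r < Rabs (x i - y i).
  have := Rabs_triang (x i - y i) (y i); rewrite (_ : x i - y i + y i = x i); last ring.
  by move=> ?; lra.
apply: hU; apply: Rlt_le_trans (sqn_coord (fun i => x i - y i) i).
by rewrite Rsqr_abs /Rsqr; nra.
Qed.

(** The [(m-1)]-fold Laplacian [W] of the kernel equals [c1 |z|^(2-n)] outside the ball of radius
    [r], and so does [V], a rescaled multiple of the superharmonic [tau^(1-n/2)]. As [W - V] has
    compact support, Green's identity against the constant 1 lets [-Delta V >= 0] replace
    [-Delta W], and a lower bound on one small cube is enough. *)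
Lemma kernel_mass : exists c, 0 < c /\ forall S r (y : point n), 0 < r -> enorm y + r < S ->
  c <= Iint S (rad y (fun s => - Lit n m (Gam r) s)).
Proof.
have n2 : 2 < INR n.
  have : INR (2 * m) < INR n by apply: lt_INR; apply/ltP.
  have : 1 <= INR m by apply: (le_INR 1); apply/leP.
  by rewrite mult_INR /= => ? ?; lra.
pose t s := Rpower (tau N s) (1 - INR n / 2).
have NM : N = (2 * m.-1).+3 by rewrite /N -{1}(prednK m0) mulnS.
set M := (2 * m.-1)%N in NM.
have st : smooth1 2 t.
  apply: smooth1_Rpower; last exact: tau_pos.
  apply: smooth1_tau => //; by rewrite NM.
pose lo s := 4 * (INR n / 2 - 1) * s * Rpower (tau N s) (- (INR n / 2)) * (INR M.+2 * ppow M.+1 s).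
have tlo s : 0 <= s -> lo s <= - Lop n t s.
  by move=> s0; rewrite /lo /t; have := @Lop_tau_le M n s n2 s0; rewrite -NM.
(* On the small cube every coordinate of [x - y] lies between [a r] and [2 a r], so
   [s = |x-y|^2 / r^2] lies between [n a^2] and [4 n a^2 = a < 1/4], away from the zeros of [lo] at
   0 and 1. *)
pose a := / (4 * INR n).
have a0 : 0 < a by apply: Rinv_0_lt_compat; lra.
have a4 : 4 * INR n * a = 1 by rewrite /a; field; lra.
have a12 : a < / 8 by nra.
have lo0 s : 0 <= s -> 0 <= lo s.
  move=> s0; apply: Rmult_le_pos; last by apply: Rmult_le_pos; [exact: pos_INR|exact: ppow_ge0].
  by apply: Rmult_le_pos; [nra|apply: Rlt_le; exact: Rpower_pos].
pose c2 := 4 * (INR n / 2 - 1) * (INR n * (a * a)) * Rpower 2 (- (INR n / 2)) * (INR M.+2 * (3/4) ^ M.+1).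
have c20 : 0 < c2.
  apply: Rmult_lt_0_compat; last first.
    by apply: Rmult_lt_0_compat; [apply: lt_0_INR; apply/ltP|apply: pow_lt; lra].
  by apply: Rmult_lt_0_compat; [apply: Rmult_lt_0_compat; nra|exact: Rpower_pos].
have loc2 s : INR n * (a * a) <= s -> s <= 1/4 -> c2 <= lo s.
  move=> h1 h2; have s0 : 0 < s by apply: Rlt_le_trans h1; nra.
  have p2 : Rpower 2 (- (INR n / 2)) <= Rpower (tau N s) (- (INR n / 2)).
    by apply: Rpower_neg_le; [exact: tau_pos|have := tau_le N1 (Rlt_le _ _ s0) => ?; lra|lra].
  have pp : (3/4) ^ M.+1 <= ppow M.+1 s by rewrite ppow_left; [apply: pow_incr|]; lra.
  have pr := Rpower_pos 2 (- (INR n / 2)).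
  have M0 := pos_INR M.+2.
  apply: Rmult_le_compat; [|by apply: Rmult_le_pos => //; apply: pow_le; lra| |exact: Rmult_le_compat_l].
    by apply: Rmult_le_pos; [nra|lra].
  by apply: Rmult_le_compat; [nra|lra|apply: Rmult_le_compat_l; lra|].
exists (c1 * c2 * a ^ n); split; first by apply: Rmult_lt_0_compat; [nra|exact: pow_lt].
move=> S r y r0 yS; have S0 : 0 < S by have := enorm_ge0 y => ?; lra.
have r2 : 0 < r * r by nra.
have i2 : 0 < / (r * r) by exact: Rinv_0_lt_compat.
have rn : 0 < r ^ n by exact: pow_lt.
pose V s := c1 * / r ^ (n - 2) * t (/ (r * r) * s).
have sV : smooth1 2 V by apply: smooth_scal; exact: (smooth1_scale _ st).
have LV : Lop n V = (fun s => c1 * / r ^ n * Lop n t (/ (r * r) * s)).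
  rewrite /V Lop_scal Lop_scale //; apply: functional_extensionality => s.
  rewrite -!Rmult_assoc; congr (_ * _).
  rewrite (_ : r ^ n = r ^ (n - 2) * (r * r)).
    by field; split; [lra|apply: pow_nonzero; lra].
  have n2' : (2 <= n)%N by apply: leq_trans (ltnW hmn); rewrite -{1}(muln1 2%N) leq_mul2l.
  have e : n = (n - 2 + 2)%N by rewrite subnK.
  by rewrite {1}e pow_add /= Rmult_1_r.
pose W := Lit n m.-1 (Gam r).
have sW : smooth1 2 W.
  apply: (@smooth_Lit n 2 m.-1 (fun _ => Gam r)).
  by rewrite -mulnS prednK //; exact: smooth1_Gam.
have LW : Lop n W = Lit n m (Gam r) by rewrite /W -Lit_S prednK.
have VW s : r * r < s -> W s - V s = 0.
  move=> hs; rewrite /W Lit_Gam ?leq_pred //.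
  have s1 : 1 < / (r * r) * s by rewrite -(Rinv_l (r * r)); [apply: Rmult_lt_compat_l|lra].
  rewrite Lit_gam // /V /t tau_right //; last lra.
  rewrite -/c1 (_ : (2 * (m - m.-1) = 2)%N); last by rewrite -{1}(prednK m0) subSnn.
  rewrite (_ : q - INR m.-1 = 1 - INR n / 2); first ring.
  by rewrite /q -{1}(prednK m0) S_INR; ring.
pose P := rad y (fun s => W s - V s).
have sP : smooth1 2 (fun s => W s - V s) by exact: smooth1_sub.
have cLV : forall s, continuous (fun s => - Lop n V s) s.
  move=> s; apply: (@continuous_opp _ R_AbsRing R_NormedModule); exact: Lop_continuous.
have cLW : forall s, continuous (fun s => - Lit n m (Gam r) s) s.
  move=> s; apply: (@continuous_opp _ R_AbsRing R_NormedModule); rewrite -LW; exact: Lop_continuous.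
have E : Iint S (rad y (fun s => - Lit n m (Gam r) s)) = Iint S (rad y (fun s => - Lop n V s)).
  apply: Rminus_diag_uniq; rewrite -Iint_sub //; try exact: cont_rad.
  have G := green S0 (Ck_const (@opens_all n) 2 1) (Ck_rad y sP) (supp_rad yS r0 VW).
  have Z : Iint S (fun x => laplacian (fun _ => 1) x * P x) = 0.
    rewrite -(Iint_0 (n := n) S0); congr (Iint _); apply: functional_extensionality => x.
    by rewrite laplacian_const Rmult_0_l.
  rewrite -/P Z laplacian_rad // in G.
  rewrite -[RHS]Ropp_0 -[in RHS]G -[RHS]Rmult_1_l -Ropp_mult_distr_r Ropp_mult_distr_l -Iint_scal //.
    congr (Iint _); apply: functional_extensionality => x; rewrite /rad Lop_sub //  LW; ring.
  by apply: cont_mul; [exact: cont_const|apply: cont_rad => s; exact: Lop_continuous].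
rewrite E.
have -> : c1 * c2 * a ^ n = c1 * / r ^ n * c2 * (2 * (a * r / 2)) ^ n.
  by rewrite (_ : 2 * (a * r / 2) = a * r) ?Rpow_mult_distr; field; lra.
have ar : 0 < a * r by nra.
have K0 : 0 < c1 * / r ^ n by apply: Rmult_lt_0_compat => //; exact: Rinv_0_lt_compat.
apply: (@Iint_lower n S S0 _ (fun i => y i + 3 / 2 * (a * r)) (a * r / 2)).
- exact: cont_rad.
- lra.
- nra.
- move=> i; have := coord_le_enorm y i => /Rabs_le_between ?; split; nra.
- move=> x; rewrite /rad LV.
  have := sqn_ge0 (fun i => x i - y i); set s := sqn _ => s0.
  have h : 0 <= / (r * r) * s by apply: Rmult_le_pos => //; lra.
  have := tlo _ h; have := lo0 _ h => ? ?; nra.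
- move=> x hx; rewrite /rad LV.
  have hx' i : a * r < x i - y i < 2 * (a * r).
    by have := hx i => /Rabs_lt_between ?; lra.
  have l1 : INR n * Rsqr (a * r) <= sqn (fun i => x i - y i).
    rewrite -sumR_const; apply: sumR_le => i; apply: Rsqr_incr_1; have := hx' i => ?; lra.
  have l2 : sqn (fun i => x i - y i) <= INR n * Rsqr (2 * (a * r)).
    rewrite -sumR_const; apply: sumR_le => i; apply: Rsqr_incr_1; have := hx' i => ?; lra.
  move: l1 l2; set s := sqn _; rewrite /Rsqr => l1 l2.
  have e0 : r * r * (/ (r * r) * s) = s by field; lra.
  have e1 : INR n * (a * a) <= / (r * r) * s.
    by apply: (Rmult_le_reg_l (r * r)) => //; rewrite e0; lra.
  have e2 : / (r * r) * s <= 1 / 4.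
    apply: (Rmult_le_reg_l (r * r)) => //; rewrite e0; apply: Rle_trans l2 _.
    have -> : INR n * (2 * (a * r) * (2 * (a * r))) = (4 * INR n * a) * a * (r * r) by ring.
    by rewrite a4; nra.
  have h : 0 <= / (r * r) * s by apply: Rle_trans e1; nra.
  have Q : c2 <= - Lop n t (/ (r * r) * s) by have := tlo _ h; have := loc2 _ e1 e2 => ? ?; lra.
  have := Rmult_le_compat_l _ _ _ (Rlt_le _ _ K0) Q => ?; lra.
Qed.

End Kernel.

(** * Radial test functions for the mass bound *)

Lemma is_derive_RInt_left (h : R -> R) b s : (forall t, continuous h t) ->
  is_derive (fun s => RInt h s b) s (- h s).
Proof.
move=> ch; apply: (@is_derive_RInt' R_NormedModule h (fun s => RInt h s b) s b); last exact: ch.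
by apply: filter_forall => t; apply: RInt_correct; apply: ex_RInt_continuous.
Qed.

Lemma RInt_right_0 (h : R -> R) s b : b <= s -> (forall t, b <= t -> h t = 0) -> RInt h s b = 0.
Proof.
move=> bs h0; rewrite (@RInt_ext R_CompleteNormedModule h (fun _ => 0) s b); first exact: RInt_null.
by move=> t; rewrite Rmin_right // => ht; apply: h0; lra.
Qed.

Section Chain.
Context (m n : nat) (m0 : (0 < m)%N) (n2 : 2 < INR n).
Let N := (2 * m).+1.
Let al := INR n / 2 - 1.
(** Each of the [m] steps shortens the range of the lower bound by [2 T]. The range [s <= 3 T] left
    at the end contains [|x| <= 3 r / 2] when [T = r^2]. The extra 1 in [X1] keeps [X1 - s/T >= 1]
    up to [s = X0 T]. *)
Let X0 := 2 * INR m + 3.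
Let X1 := X0 + 1.

Let N1 : (1 < N)%N.
Proof. by rewrite /N ltnS muln_gt0. Qed.

Let al0 : 0 < al.
Proof. by rewrite /al; lra. Qed.

Let X3 : 3 < X0.
Proof. by have : 0 < INR m by [apply: lt_0_INR; apply/ltP]; rewrite /X0 => ?; lra. Qed.

Let X14 : 4 < X1.
Proof. by rewrite /X1; lra. Qed.

(* For [s >= 1], [Lop n F = 4 s^(1-n/2) (s^(n/2) F')']; the weights [wa] and [wb] regularize
   [s^(-n/2) / 4] and [s^(n/2-1)], with [al = n/2 - 1]. *)
Let wa s := / 4 * Rpower (tau N s) (- (al + 1)).
Let wb s := Rpower (tau N s) al.

Let smooth1_wa : smooth1 (2 * m) wa.
Proof. by apply: smooth_scal; apply: smooth1_Rpower; [exact: smooth1_tau|exact: tau_pos]. Qed.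

Let smooth1_wb : smooth1 (2 * m) wb.
Proof. by apply: smooth1_Rpower; [exact: smooth1_tau|exact: tau_pos]. Qed.

Let wa_pos s : 0 < wa s.
Proof. by have := Rpower_pos (tau N s) (- (al + 1)); rewrite /wa => ?; lra. Qed.

Let wb_pos s : 0 < wb s.
Proof. exact: Rpower_pos. Qed.

Let wb_le s : 0 <= s -> wb s <= Rpower (1 + s) al.
Proof.
by move=> s0; apply: Rle_Rpower_l; [lra|split; [exact: tau_pos|exact: tau_le]].
Qed.

Let wa_ge s : 0 <= s -> / 4 * Rpower (1 + s) (- (al + 1)) <= wa s.
Proof.
move=> s0; apply: Rmult_le_compat_l; first lra.
by apply: Rpower_neg_le; [exact: tau_pos|exact: tau_le|lra].
Qed.

Let wa_le : exists c, 0 < c /\ forall s, 0 <= s -> wa s <= c * Rpower (1 + s) (- (al + 1)).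
Proof.
have Np := INR_N N1.
exists (/ 4 * Rpower (/ (2 * INR N)) (- (al + 1))); split.
  by apply: Rmult_lt_0_compat; [lra|exact: Rpower_pos].
move=> s s0; rewrite Rmult_assoc; apply: Rmult_le_compat_l; first lra.
have i0 : 0 < / (2 * INR N) by apply: Rinv_0_lt_compat; lra.
rewrite Rpower_mult_distr //; last lra.
apply: Rpower_neg_le; [nra| |lra].
apply: (Rmult_le_reg_l (2 * INR N)); first lra.
rewrite -Rmult_assoc Rinv_r; last lra.
have t1 := tau_lower N1 s; have t2 := tau_ge N1 s.
have : 1 <= INR N * tau N s.
  by rewrite -(Rinv_r (INR N)); [apply: Rmult_le_compat_l|]; lra.
move=> ?; nra.
Qed.

(** The prescribed [m]-fold Laplacian, up to the factor [T^(-m)]; with [T = r^2] its amplitude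
    [Rpower T (- al)] is [r^(2-n)]. *)
Definition chain0 (T s : R) : R := Rpower T (- al) * Rmax 0 (X1 - s / T).

(** All constants are uniform in [T], the squared scale. As [wb s = s^al] for [s >= 1], [cs_upper]
    is decay like [|x|^(2-n)], and [cs_lower] is its counterpart up to distances of order [sqrt T].
    The division by [T^j] in [cs_Lit] compensates for the factor of order [T] gained by each
    inversion of the Laplacian. *)
Record chain_spec (j : nat) (F : R -> R -> R) : Prop := ChainSpec {
  cs_smooth : smooth (2 * j) F;
  cs_ge0 : forall T s, 1 <= T -> 0 <= s -> 0 <= F T s;
  cs_zero : forall T s, 1 <= T -> X1 * T <= s -> F T s = 0;
  cs_upper : exists C, 0 < C /\ forall T s, 1 <= T -> 0 <= s -> wb s * F T s <= C;
  cs_lower : exists c, 0 < c /\ forall T s, 1 <= T -> 0 <= s <= (X0 - 2 * INR j) * T ->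
    c * Rpower T (- al) <= F T s;
  cs_Lit : forall T s, 1 <= T -> 1 < s -> Lit n j (F T) s = chain0 T s / T ^ j }.

Lemma Rpower_cancel x p : 0 < x -> Rpower x p * Rpower x (- p) = 1.
Proof. by move=> x0; rewrite -Rpower_plus Rplus_opp_r Rpower_O. Qed.

Lemma Rpower_le1 x p : 1 <= x -> 0 <= p -> Rpower x (- p) <= 1.
Proof.
move=> x1 p0; rewrite -(Rpower_O x); last lra.
by apply: Rle_Rpower; lra.
Qed.

Lemma chain0_spec : chain_spec 0 chain0.
Proof.
have max_le T s : 1 <= T -> 0 <= s -> Rmax 0 (X1 - s / T) <= X1.
  move=> T1 s0; have : 0 <= s / T by apply: Rdiv_le_0_compat; lra.
  by move=> ?; apply: Rmax_lub; lra.
have ge0 T s : 0 <= chain0 T s.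
  by apply: Rmult_le_pos; [apply: Rlt_le; exact: Rpower_pos|exact: Rmax_l].
split=> //.
- split.
    exists X1 => T s T1 [s0 _]; rewrite Rabs_pos_eq //.
    rewrite -[X in _ <= X]Rmult_1_l; apply: Rmult_le_compat; [apply: Rlt_le; exact: Rpower_pos|exact: Rmax_l| |exact: max_le].
    by apply: Rpower_le1; lra.
  split=> // T s; apply: (@continuous_mult _ R_AbsRing); first exact: continuous_const.
  apply: (continuous_ext (fun s => Rmax 0 (1 - (1 - X1 + s * / T)))).
    by move=> t; congr Rmax; rewrite /Rdiv; ring.
  apply: (continuous_comp (fun s => 1 - X1 + s * / T) (fun u => Rmax 0 (1 - u))); last exact: continuous_pos_part.
  apply: (@continuous_plus _ R_AbsRing R_NormedModule); first exact: continuous_const.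
  by apply: (@continuous_mult _ R_AbsRing); [exact: continuous_id|exact: continuous_const].
- move=> T s T1 hs; rewrite /chain0 Rmax_left ?Rmult_0_r //.
  have : X1 <= s / T; last by move=> ?; lra.
  by apply: (Rmult_le_reg_r T); [lra|rewrite /Rdiv Rmult_assoc Rinv_l; lra].
- exists (Rpower (2 * X1) al * X1); split; first by apply: Rmult_lt_0_compat; [exact: Rpower_pos|lra].
  move=> T s T1 s0; have [hs|hs] := Rle_or_lt s (X1 * T); last first.
    have -> : chain0 T s = 0.
      rewrite /chain0 Rmax_left ?Rmult_0_r //.
      have : X1 <= s / T; last by move=> ?; lra.
      by apply: (Rmult_le_reg_r T); [lra|rewrite /Rdiv Rmult_assoc Rinv_l; lra].
    by rewrite Rmult_0_r; apply: Rmult_le_pos; [apply: Rlt_le; exact: Rpower_pos|lra].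
  have b1 : wb s <= Rpower (2 * X1) al * Rpower T al.
    apply: Rle_trans (wb_le s0) _; rewrite Rpower_mult_distr; try lra.
    apply: Rle_Rpower_l; first lra; split; first lra.
    by have : 1 <= X1 * T; [nra|move=> ?; lra].
  have -> : Rpower (2 * X1) al * X1 = (Rpower (2 * X1) al * Rpower T al) * (Rpower T (- al) * X1).
    have c : Rpower T al * Rpower T (- al) = 1 by apply: Rpower_cancel; lra.
    rewrite (_ : _ * _ = Rpower (2 * X1) al * X1 * (Rpower T al * Rpower T (- al))); first ring.
    by rewrite c; ring.
  apply: Rmult_le_compat => //; first by apply: Rlt_le.
  by apply: Rmult_le_compat_l; [apply: Rlt_le; exact: Rpower_pos|exact: max_le].
- exists 1; split; first lra.
  move=> T s T1 [s0 s1]; rewrite Rmult_1_l -[X in X <= _]Rmult_1_r.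
  apply: Rmult_le_compat_l; first by apply: Rlt_le; exact: Rpower_pos.
  apply: Rle_trans (Rmax_r _ _).
  have : s / T <= X0; last by rewrite /X1 => ?; lra.
  apply: (Rmult_le_reg_r T); first lra.
  by rewrite /Rdiv Rmult_assoc Rinv_l /=; move: s1 => /=; lra.
- by move=> T s _ _; rewrite /Lit /=; field.
Qed.

(* [G s = int_s^oo wa(t) int_t^oo wb(u) F(u) / T du dt] solves [Lop n G = F / T] for [s > 1]
   and inherits nonnegativity. *)
Lemma chain_step j F : (j < m)%N -> chain_spec j F -> exists G, chain_spec j.+1 G.
Proof.
move=> jm [sF F0 FX [C [C0 FC]] [c [c0 Fc]] FL].
have jm' : INR j + 1 <= INR m by rewrite -S_INR; apply: le_INR; apply/leP.
have j0 := pos_INR j.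
pose h T u := wb u * F T u / T.
have ch T u : continuous (h T) u.
  apply: (@continuous_mult _ R_AbsRing); last exact: continuous_const.
  by apply: (@continuous_mult _ R_AbsRing); [exact: (smooth1_cont smooth1_wb)|exact: (smooth_cont sF)].
pose B T t := RInt (h T) t (X1 * T).
have dB T t : is_derive (B T) t (- h T t) by exact: is_derive_RInt_left.
have cB T t : continuous (B T) t by apply: ex_derive_continuous; eexists; exact: dB.
pose k T t := wa t * B T t.
have ck T t : continuous (k T) t.
  by apply: (@continuous_mult _ R_AbsRing) => //; exact: (smooth1_cont smooth1_wa).
pose G T s := RInt (k T) s (X1 * T).
have dG T s : is_derive (G T) s (- k T s) by exact: is_derive_RInt_left.
have h0 T u : 1 <= T -> 0 <= u -> 0 <= h T u.
  move=> T1 u0; apply: Rdiv_le_0_compat; last lra.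
  by apply: Rmult_le_pos; [apply: Rlt_le|exact: F0].
have hz T u : 1 <= T -> X1 * T <= u -> h T u = 0.
  by move=> T1 hu; rewrite /h FX // /Rdiv; ring.
have Bz T t : 1 <= T -> X1 * T <= t -> B T t = 0.
  by move=> T1 ht; apply: RInt_right_0 => // u; exact: hz.
have B0 T t : 1 <= T -> 0 <= t -> 0 <= B T t.
  move=> T1 t0; have [ht|ht] := Rle_or_lt t (X1 * T); last by rewrite Bz //; lra.
  by apply: RInt_ge_0 => //; [apply: ex_RInt_continuous|move=> u hu; apply: h0; lra].
(* The integrand is at most [C / T] on an interval of length at most [X1 * T]: the division by [T]
   in [h] makes the bound uniform. *)
have BC T t : 1 <= T -> 0 <= t -> B T t <= C * X1.
  move=> T1 t0; have [ht|ht] := Rle_or_lt t (X1 * T); last by rewrite Bz //; [nra|lra].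
  apply: Rle_trans (_ : RInt (fun _ => C / T) t (X1 * T) <= _).
    apply: RInt_le => //; [by apply: ex_RInt_continuous|exact: ex_RInt_const|].
    move=> u hu; apply: Rmult_le_compat_r; first by apply: Rlt_le; apply: Rinv_0_lt_compat; lra.
    by apply: FC; lra.
  rewrite RInt_const /scal /= /mult /=.
  have -> : C * X1 = X1 * T * (C / T) by field; lra.
  apply: Rmult_le_compat_r; last lra.
  by apply: Rdiv_le_0_compat; lra.
have Gz T s : 1 <= T -> X1 * T <= s -> G T s = 0.
  by move=> T1 hs; apply: RInt_right_0 => // u hu; rewrite /k Bz //; ring.
have k0 T t : 1 <= T -> 0 <= t -> 0 <= k T t.
  by move=> T1 t0; apply: Rmult_le_pos; [apply: Rlt_le|exact: B0].
have G0 T s : 1 <= T -> 0 <= s -> 0 <= G T s.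
  move=> T1 s0; have [hs|hs] := Rle_or_lt s (X1 * T); last by rewrite Gz //; lra.
  by apply: RInt_ge_0 => //; [apply: ex_RInt_continuous|move=> u hu; apply: k0; lra].
have [ca [ca0 hca]] := wa_le.
(* [K * (1+s)^(-al)] is the integral from [s] to infinity of [ca * C * X1 * (1+t)^(-al-1)], which
   dominates [k T]. *)
pose K := ca * (C * X1) / al.
have K0 : 0 < K by apply: Rdiv_lt_0_compat => //; apply: Rmult_lt_0_compat => //; nra.
have GK T s : 1 <= T -> 0 <= s -> G T s <= K * Rpower (1 + s) (- al).
  move=> T1 s0; have rp u := Rpower_pos (1 + u) (- al).
  have [hs|hs] := Rle_or_lt s (X1 * T); last first.
    by rewrite Gz //; [have := rp s => ?; nra|lra].
  pose g t := ca * (C * X1) * Rpower (1 + t) (- (al + 1)).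
  have ig : is_RInt g s (X1 * T) (minus (- K * Rpower (1 + X1 * T) (- al)) (- K * Rpower (1 + s) (- al))).
    apply: (is_RInt_derive (fun t => - K * Rpower (1 + t) (- al))).
      move=> t; rewrite Rmin_left // => ht.
      have d1 : is_derive (fun t => 1 + t) t 1 by auto_derive => //; ring.
      have t1 : 0 < 1 + t by lra.
      have := is_derive_scal _ t (- K) _ (@is_derive_comp R_AbsRing R_NormedModule
         (fun u => Rpower u (- al)) (fun t => 1 + t) t _ _ (is_derive_Rpower (- al) t1) d1).
      rewrite /scal /= /mult /= (_ : - K * (1 * (- al * Rpower (1 + t) (- al - 1))) = g t) //.
      rewrite /g /K (_ : - al - 1 = - (al + 1)); [field; lra|ring].
    move=> t; rewrite Rmin_left // => ht; apply: ex_derive_continuous; rewrite /g.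
    have t1 : 0 < 1 + t by lra.
    have d1 : is_derive (fun t => 1 + t) t 1 by auto_derive => //; ring.
    eexists; apply: is_derive_scal; apply: (@is_derive_comp R_AbsRing R_NormedModule
         (fun u => Rpower u (- (al + 1))) (fun t => 1 + t)); [exact: is_derive_Rpower|exact: d1].
  apply: Rle_trans (_ : RInt g s (X1 * T) <= _).
    apply: RInt_le => //; [by apply: ex_RInt_continuous|by eexists; exact: ig|].
    move=> t ht; rewrite /k /g.
    have := hca t; have := BC T t T1; have := B0 T t T1.
    have := wa_pos t => p1 p2 p3 p4.
    have t0 : 0 <= t by lra.
    apply: Rle_trans (Rmult_le_compat _ _ _ _ (Rlt_le _ _ p1) (p2 t0) (p4 t0) (p3 t0)) _.
    by apply: Req_le; ring.
  rewrite (is_RInt_unique _ _ _ _ ig) /minus /plus /opp /=.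
  have := rp (X1 * T) => ?; nra.
(* Two windows of length [T] suffice: on the one above [Y1] the bound for [F] gives [B >= c] below
   [Y1], and the one below [Y1] is then used for [G]. They account for the loss of [2 T]. *)
have Glow : exists c, 0 < c /\ forall T s, 1 <= T -> 0 <= s <= (X0 - 2 * INR j.+1) * T ->
    c * Rpower T (- al) <= G T s.
  exists (/ 4 * Rpower (2 * X1) (- (al + 1)) * c); split.
    by apply: Rmult_lt_0_compat => //; have := Rpower_pos (2 * X1) (- (al + 1)) => ?; lra.
  rewrite S_INR => T s T1 [s0 s1].
  set Y1 := (X0 - 2 * INR j - 1) * T.
  have Y1T : 2 * T <= Y1 by rewrite /Y1 /X0; nra.
  have Y1X : Y1 + T <= X1 * T by rewrite /Y1 /X1; nra.
  have Y2 : s <= Y1 - T by rewrite /Y1; nra.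
  have Bc t : 0 <= t <= Y1 -> c <= B T t.
    move=> ht.
    have -> : c = c / T * (Y1 + T - Y1) by field; lra.
    apply: RInt_ge_sub => //; try lra; first by move=> u hu; apply: h0; lra.
    move=> u hu; apply: Rmult_le_compat_r; first by apply: Rlt_le; apply: Rinv_0_lt_compat; lra.
    have u1 : 0 <= u <= (X0 - 2 * INR j) * T by move: hu; rewrite /Y1 => hu; split; nra.
    have b1 : Rpower T al <= wb u.
      apply: Rle_Rpower_l; first lra; split; first lra.
      by have := tau_ge N1 u => ?; lra.
    have cc : Rpower T al * Rpower T (- al) = 1 by apply: Rpower_cancel; lra.
    have -> : c = Rpower T al * (c * Rpower T (- al)) by rewrite -{1}(Rmult_1_r c) -cc; ring.
    apply: Rmult_le_compat b1 (Fc _ _ T1 u1); first by apply: Rlt_le; exact: Rpower_pos.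
    by apply: Rmult_le_pos; [lra|apply: Rlt_le; exact: Rpower_pos].
  have e : / 4 * Rpower (2 * X1) (- (al + 1)) * c * Rpower T (- al) =
      / 4 * Rpower (2 * X1 * T) (- (al + 1)) * c * (Y1 - (Y1 - T)).
    have e1 : Rpower T (- al) = Rpower T (- (al + 1)) * T.
      by rewrite -{3}(Rpower_1 T) -?Rpower_plus; [congr Rpower; ring|lra].
    rewrite -(Rpower_mult_distr (2 * X1) T); try lra.
    by rewrite e1; ring.
  rewrite e; apply: RInt_ge_sub => //; try lra; first by move=> u hu; apply: k0; lra.
  move=> t ht; have t0 : 0 <= t by lra.
  apply: Rmult_le_compat; [|lra| |by apply: Bc; lra].
    by have := Rpower_pos (2 * X1 * T) (- (al + 1)) => ?; lra.
  apply: Rle_trans (wa_ge t0); apply: Rmult_le_compat_l; first lra.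
  by apply: Rpower_neg_le; [lra|nra|lra].
have sB : smooth (2 * j).+1 B.
  apply: (@smooth_intro _ _ (fun T t => (-1) * (wb t * F T t * / T))) => //.
  - by exists (C * X1) => T s T1 [s0 _]; rewrite Rabs_pos_eq; [exact: BC|exact: B0].
  - move=> T t; rewrite (_ : (-1) * (wb t * F T t * / T) = - h T t); [exact: dB|rewrite /h /Rdiv; ring].
  - apply: smooth_scal; apply: smooth_mul.
      apply: smooth_mul => //; apply: smooth_le smooth1_wb.
      by rewrite leq_mul2l ltnW.
    have : smooth (2 * j) (fun T _ => / T).
      have b : exists C, forall T s : R, 1 <= T -> 0 <= s <= 1 -> Rabs (/ T) <= C.
        exists 1 => T s T1 _; rewrite Rabs_pos_eq.
          by rewrite -Rinv_1; apply: Rinv_le_contravar; lra.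
        by apply: Rlt_le; apply: Rinv_0_lt_compat; lra.
      case: (2 * j)%N => [|i]; first by split=> //; split => // T s; exact: continuous_const.
      apply: (@smooth_intro _ _ (fun _ _ => 0)) => //; last exact: smooth_const.
      by move=> T s; exact: is_derive_const.
    by [].
exists G; split=> //.
- rewrite mulnS; apply: (@smooth_intro _ _ (fun T t => (-1) * k T t)).
  + exists K => T s T1 [s0 _]; rewrite Rabs_pos_eq; last exact: G0.
    apply: Rle_trans (GK T s T1 s0) _; rewrite -[X in _ <= X]Rmult_1_r.
    by apply: Rmult_le_compat_l; [lra|apply: Rpower_le1; lra].
  + move=> T t; rewrite (_ : (-1) * k T t = - k T t); [exact: dG|ring].
  + apply: smooth_scal; apply: smooth_mul sB; apply: smooth_le smooth1_wa.
    by rewrite ltn_mul2l.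
- exists K; split => // T s T1 s0.
  have cc : Rpower (1 + s) al * Rpower (1 + s) (- al) = 1 by apply: Rpower_cancel; lra.
  have -> : K = Rpower (1 + s) al * (K * Rpower (1 + s) (- al)) by transitivity (K * (Rpower (1 + s) al * Rpower (1 + s) (- al))); [rewrite cc|]; ring.
  by apply: Rmult_le_compat; [apply: Rlt_le|exact: G0|exact: wb_le|exact: GK].
- move=> T s T1 s1.
  have LG t : 1 < t -> Lop n (G T) t = / T * F T t.
    move=> t1; rewrite /Lop.
    have DG : Derive (G T) = (fun u => - k T u).
      by apply: functional_extensionality => u; exact: is_derive_unique (dG T u).
    rewrite DG.
    have t0 : 0 < t by lra.
    have da : is_derive wa t (/ 4 * (- (al + 1) * Rpower t (- (al + 1) - 1))).
      apply: (@is_derive_ext_loc _ _ (fun t => / 4 * Rpower t (- (al + 1)))).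
        by apply: filter_imp (open_gt 1 t t1) => u hu; rewrite /wa tau_right //; lra.
      by apply: is_derive_scal; exact: is_derive_Rpower.
    have dk := is_derive_opp _ _ _ (is_derive_mulR da (dB T t)).
    rewrite (is_derive_unique _ _ _ dk) /opp /= /k /h.
    have -> : wa t = / 4 * Rpower t (- (al + 1)) by rewrite /wa tau_right //; lra.
    have -> : wb t = Rpower t al by rewrite /wb tau_right //; lra.
    have e1 : Rpower t (- (al + 1)) = t * Rpower t (- (al + 1) - 1).
      by rewrite -{2}(Rpower_1 t) // -Rpower_plus; congr Rpower; ring.
    have e2 : t * Rpower t (- (al + 1)) * Rpower t al = 1.
      rewrite -{1}(Rpower_1 t) // -!Rpower_plus -(Rpower_O t) //; congr Rpower; ring.
    have -> : INR n = 2 * (al + 1) by rewrite /al; field.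
    transitivity ((t * Rpower t (- (al + 1)) * Rpower t al) * (/ T * F T t)); last by rewrite e2; ring.
    rewrite e1 /Rdiv; field; lra.
  rewrite Lit_Sr (@Lit_loc n j _ _ 1 LG) // Lit_scal FL //.
  rewrite -tech_pow_Rmult; field; split; [apply: pow_nonzero|]; lra.
Qed.

Lemma chain_exists j : (j <= m)%N -> exists F, chain_spec j F.
Proof.
elim: j => [|j IH] hj; first by exists chain0; exact: chain0_spec.
by have [F hF] := IH (ltnW hj); exact: chain_step hF.
Qed.


End Chain.

(** * Mass bounds on annuli *)

Lemma Rpower_sqr_neg (r : R) n : 0 < r -> (2 <= n)%N ->
  Rpower (r * r) (- (INR n / 2 - 1)) = / r ^ (n - 2).
Proof.
move=> r0 n2; rewrite Rpower_Ropp -Rpower_pow // /Rpower ln_mult //.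
by rewrite minus_INR; [congr (/ exp _); rewrite /=; field|apply/leP].
Qed.

Section Mass.
Context (m n : nat) (m0 : (0 < m)%N) (hmn : (2 * m < n)%N) (w : point n -> R).
Context (hw : Ck (2 * m) (fun _ => True) w) (w0 : forall x, 0 <= w x).
Let ft x := - iter_lap m w x.
Context (ft0 : forall x, 1 < enorm x -> 0 <= ft x).

Lemma cont_w : contg w.
Proof. exact: Ck_cont hw. Qed.

Lemma cont_ft : contg ft.
Proof. apply: cont_opp; exact: (@Ck_cont _ _ 0 _ (@Ck_iter_lap _ _ (@opens_all n) 0 m _ hw)). Qed.

Lemma two_le_n : (2 <= n)%N.
Proof. by apply: leq_trans (ltnW hmn); rewrite -{1}(muln1 2%N) leq_mul2l. Qed.

Lemma two_lt_INR : 2 < INR n.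
Proof.
have : INR (2 * m) < INR n by apply: lt_INR; apply/ltP.
have : 1 <= INR m by apply: (le_INR 1); apply/leP.
by rewrite mult_INR /= => ? ?; lra.
Qed.

Lemma rad0E U (x : point n) : rad (fun _ => 0) U x = U (enorm x * enorm x).
Proof.
rewrite enorm_sqr /rad; congr (U _); apply: eq_bigr => i _; by rewrite Rminus_0_r.
Qed.

Lemma enorm_0 : enorm (fun _ : 'I_n => 0) = 0.
Proof. by rewrite /enorm big1 ?sqrt_0 // => i _; rewrite /Rsqr; ring. Qed.

(* Test with the radial family of [chain_exists] at scale [T = r^2]: its top iterated Laplacian is
   nonnegative outside the unit ball, so [v] and [- Delta^m v] contribute with the same sign. *)
Lemma mass_bound : exists C, 0 < C /\ forall r S (th : point n -> R),
  4 <= r -> (2 * INR m + 5) * r <= S -> contg th ->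
  (forall x, 0 <= th x <= 1) -> (forall x, th x <> 0 -> r / 2 <= enorm x <= 3 / 2 * r) ->
  Iint S (fun x => ft x * th x) <= C * r ^ (n - 2) /\
  Iint S (fun x => w x * th x) <= C * (r ^ (n - 2) * r ^ (2 * m)).
Proof.
have n2 := two_lt_INR; have m1 := pos_INR m.
have [F [sF F0 FX _ [c [c0 Fc]] FL]] := chain_exists m0 n2 (leqnn m).
have [CF hCF] := smooth_bound sF.
have [CL hCL] := smooth_bound (@smooth_Lit n 0 m F sF).
have [Mw hMw] := bounded_cube 1 cont_w.
have [Mf hMf] := bounded_cube 1 cont_ft.
(* Bounds the integrand on the unit ball, where no sign is available. It does not depend on [r],
   because the family [F] is bounded on [[0,1]] uniformly in [T]. *)
pose K := Rabs Mf * Rabs CF + Rabs Mw * Rabs CL.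
have K0 : 0 <= K by apply: Rplus_le_le_0_compat; apply: Rmult_le_pos; exact: Rabs_pos.
pose c' := Rmin c 1.
have c'0 : 0 < c' by apply: Rmin_pos; lra.
pose C := K * (2 * (2 * 2) ^ n) / c' + 1.
have C4 : 0 <= 2 * (2 * 2) ^ n by apply: Rmult_le_pos; [lra|apply: pow_le; lra].
have C0 : 0 < C.
  have : 0 <= K * (2 * (2 * 2) ^ n) / c' by apply: Rdiv_le_0_compat => //; exact: Rmult_le_pos.
  by rewrite /C => ?; lra.
exists C; split => // r S th r4 rS cth th01 hth.
have S0 : 0 < S by nra.
set T := r * r; have T1 : 1 <= T by rewrite /T; nra.
pose o := fun _ : 'I_n => 0.
pose P := rad o (F T).
have sFT : smooth1 (2 * m) (F T).
  have H : forall k U, smooth k U -> smooth1 k (U T).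
    elim=> [|k IH] U hU; first by apply: smooth1_0 => s; exact: (smooth_cont hU).
    apply: (@smooth1_intro _ _ (Derive (U T))); last exact: (IH _ (smooth_derive hU)).
    by move=> s; apply: Derive_correct; exact: (smooth_ex_derive hU).
  exact: H.
have sP : supp S P.
  apply: (@supp_rad _ S ((2 * INR m + 4) * r)); [rewrite enorm_0; nra|nra|].
  by move=> s hs; apply: FX => //; rewrite /T; nra.
have G := green_iter S0 hw (Ck_rad o sFT) sP.
rewrite iter_lap_rad // in G.
have cw := cont_w; have cf := cont_ft.
have cP : contg P by apply: cont_rad; exact: (smooth1_cont sFT).
have cL : contg (rad o (Lit n m (F T))).
  by apply: cont_rad; exact: (smooth1_cont (@smooth_Lit n 0 m (fun _ => F T) sFT)).
(* A continuous substitute for the indicator of the unit ball: at least 1 there and 0 for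
   [|x|^2 >= 2]. *)
pose ze := rad o (fun s => Rmax 0 (1 - (s - 1))).
have cz : contg ze.
  apply: cont_rad => s; apply: (continuous_comp (fun s => s - 1) (fun u => Rmax 0 (1 - u))); last exact: continuous_pos_part.
  by apply: (@continuous_minus _ R_AbsRing R_NormedModule); [exact: continuous_id|exact: continuous_const].
have Iz : Iint S ze <= 2 * (2 * 2) ^ n.
  apply: (@Iint_upper _ _ S0 _ o 2 2); rewrite ?/o //; try lra.
  - by move=> i; split; nra.
  - move=> x; rewrite /ze /rad; apply: Rmax_lub; first lra.
    by have := sqn_ge0 (fun i => x i - o i) => ?; lra.
  - move=> x i hx; rewrite /ze /rad Rmax_left; first lra.
    have := sqn_coord (fun i => x i - o i) i; rewrite Rsqr_abs /Rsqr /o => ?; nra.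
(* By Green's identity the two contributions cancel. Both are nonnegative outside the unit ball, so
   each is controlled by the error inside it. *)
have Z : Iint S (fun x => ft x * P x + w x * rad o (Lit n m (F T)) x) = 0.
  rewrite Iint_add; [|exact: S0|exact: cont_mul|exact: cont_mul].
  rewrite G -Iint_add; [|exact: S0|exact: cont_mul|].
    rewrite -(Iint_0 (n := n) S0); congr (Iint _); apply: functional_extensionality => x.
    by rewrite /ft -/P; ring.
  apply: cont_mul => //; exact: (@Ck_cont _ _ 0 _ (@Ck_iter_lap _ _ (@opens_all n) 0 m _ hw)).
have rn : 0 < / r ^ (n - 2) by apply: Rinv_0_lt_compat; apply: pow_lt; lra.
have rm : 0 < / r ^ (2 * m) by apply: Rinv_0_lt_compat; apply: pow_lt; lra.
have Te : Rpower T (- (INR n / 2 - 1)) = / r ^ (n - 2) by apply: Rpower_sqr_neg; [lra|exact: two_le_n].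
have Tm : T ^ m = r ^ (2 * m) by rewrite /T pow_mult /= Rmult_1_r.
(* The pointwise inequality whose integral gives both mass bounds at once. The minimum [c'] serves
   the lower bound [c] for [F] and the lower bound 1 for [X1 - s/T]. *)
have low x : c' * / r ^ (n - 2) * (ft x * th x) + c' * (/ r ^ (n - 2) * / r ^ (2 * m)) * (w x * th x)
    <= (ft x * P x + w x * rad o (Lit n m (F T)) x) + K * ze x.
  rewrite /P /ze !rad0E; have e0 := enorm_ge0 x; set s := enorm x * enorm x.
  have [t0 t1] := th01 x; have wx := w0 x.
  have [h|h] := Rle_or_lt s 1.
    have ex1 : enorm x <= 1 by move: h; rewrite /s => h; nra.
    have -> : th x = 0.
      by case: (Req_dec (th x) 0) => // /hth ?; lra.
    have cx i : Rabs (x i) <= 1 by apply: Rle_trans (coord_le_enorm x i) ex1.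
    have s01 : 0 <= s <= 1 by split => //; rewrite /s; nra.
    have a1 : Rabs (ft x * F T s) <= Rabs Mf * Rabs CF.
      rewrite Rabs_mult; apply: Rmult_le_compat; try exact: Rabs_pos.
        by apply: Rle_trans (hMf x cx) (Rle_abs _).
      by apply: Rle_trans (hCF T s T1 s01) (Rle_abs _).
    have a2 : Rabs (w x * Lit n m (F T) s) <= Rabs Mw * Rabs CL.
      rewrite Rabs_mult; apply: Rmult_le_compat; try exact: Rabs_pos.
        by apply: Rle_trans (hMw x cx) (Rle_abs _).
      by apply: Rle_trans (hCL T s T1 s01) (Rle_abs _).
    move/Rabs_le_between: a1 => a1; move/Rabs_le_between: a2 => a2.
    have z1 : 1 <= Rmax 0 (1 - (s - 1)) by apply: Rle_trans (Rmax_r _ _); lra.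
    rewrite !Rmult_0_r; rewrite /K in K0 *; nra.
  have ex1 : 1 < enorm x by move: h; rewrite /s => h; nra.
  have fx := ft0 ex1.
  have z1 : 0 <= K * Rmax 0 (1 - (s - 1)) by apply: Rmult_le_pos => //; exact: Rmax_l.
  have s0 : 0 <= s by lra.
  have Fs := F0 T s T1 s0.
  rewrite FL // Tm.
  have ch0 : 0 <= chain0 m n T s by apply: Rmult_le_pos; [apply: Rlt_le; exact: Rpower_pos|exact: Rmax_l].
  case: (Req_dec (th x) 0) => [->|/hth [h1 h2]].
    rewrite !Rmult_0_r; have := Rmult_le_pos _ _ fx Fs.
    have := Rmult_le_pos _ _ wx (Rmult_le_pos _ _ ch0 (Rlt_le _ _ rm)); rewrite /Rdiv => ? ?; lra.
  have s3 : s <= 3 * T by rewrite /s /T; nra.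
  have b1 : c' * / r ^ (n - 2) <= F T s.
    apply: Rle_trans (_ : c * / r ^ (n - 2) <= _).
      by apply: Rmult_le_compat_r; [lra|exact: Rmin_l].
    rewrite -Te; apply: Fc => //; split => //.
    by apply: Rle_trans s3 _; apply: Req_le; ring.
  have b2 : c' * / r ^ (n - 2) <= chain0 m n T s.
    rewrite /chain0 Te Rmult_comm; apply: Rmult_le_compat_l; first lra.
    apply: Rle_trans (Rmin_r _ _) _; apply: Rle_trans (Rmax_r _ _).
    have : s / T <= 3; last by move=> ?; lra.
    by apply: (Rmult_le_reg_r T); [lra|rewrite /Rdiv Rmult_assoc Rinv_l; lra].
  have d1 : c' * / r ^ (n - 2) * (ft x * th x) <= ft x * F T s.
    rewrite Rmult_comm; apply: Rmult_le_compat => //; [exact: Rmult_le_pos|nra|].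
    by rewrite -[X in _ <= X]Rmult_1_r; apply: Rmult_le_compat_l.
  have d2 : c' * (/ r ^ (n - 2) * / r ^ (2 * m)) * (w x * th x) <= w x * (chain0 m n T s / r ^ (2 * m)).
    rewrite Rmult_comm; apply: Rmult_le_compat => //; [exact: Rmult_le_pos| | |].
    - by apply: Rmult_le_pos; [lra|apply: Rmult_le_pos; lra].
    - by rewrite -[X in _ <= X]Rmult_1_r; apply: Rmult_le_compat_l.
    - by rewrite -Rmult_assoc; apply: Rmult_le_compat_r => //; lra.
  lra.
have cft : contg (fun x => ft x * th x) by exact: cont_mul.
have cwt : contg (fun x => w x * th x) by exact: cont_mul.
have I1 : 0 <= Iint S (fun x => ft x * th x).
  rewrite -(Iint_0 (n := n) S0); apply: (Iint_le S0) => //; first exact: cont_const.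
  move=> x; case: (Req_dec (th x) 0) => [->|/hth [h1 _]]; first lra.
  by apply: Rmult_le_pos; [apply: ft0; lra|case: (th01 x)].
have I2 : 0 <= Iint S (fun x => w x * th x).
  rewrite -(Iint_0 (n := n) S0); apply: (Iint_le S0) => //; first exact: cont_const.
  by move=> x; apply: Rmult_le_pos => //; case: (th01 x).
have cq : contg (fun x => ft x * P x + w x * rad o (Lit n m (F T)) x) by apply: cont_add; exact: cont_mul.
have L := Iint_le S0 (cont_add (cont_scal _ cft) (cont_scal _ cwt)) (cont_add cq (cont_scal K cz)) low.
rewrite (Iint_add S0 (cont_scal _ cft) (cont_scal _ cwt)) (Iint_add S0 cq (cont_scal K cz)) in L.
rewrite Z (Iint_scal S0 _ cft) (Iint_scal S0 _ cwt) (Iint_scal S0 _ cz) in L.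
set If := Iint S (fun x => ft x * th x) in L I1 *.
set Iw := Iint S (fun x => w x * th x) in L I2 *.
have Kz : K * Iint S ze <= c' * C.
  have -> : c' * C = K * (2 * (2 * 2) ^ n) + c' by rewrite /C; field; lra.
  by have := Rmult_le_compat_l _ _ _ K0 Iz => ?; lra.
have p1 : 0 <= c' * / r ^ (n - 2) * If by apply: Rmult_le_pos => //; nra.
have p2 : 0 <= c' * (/ r ^ (n - 2) * / r ^ (2 * m)) * Iw.
  by apply: Rmult_le_pos => //; apply: Rmult_le_pos; [lra|nra].
have rn' : r ^ (n - 2) <> 0 by apply: pow_nonzero; lra.
have rm' : r ^ (2 * m) <> 0 by apply: pow_nonzero; lra.
split.
  apply: (Rmult_le_reg_l (c' * / r ^ (n - 2))); first nra.
  by have -> : c' * / r ^ (n - 2) * (C * r ^ (n - 2)) = c' * C; [field|lra].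
apply: (Rmult_le_reg_l (c' * (/ r ^ (n - 2) * / r ^ (2 * m)))).
  by apply: Rmult_lt_0_compat => //; nra.
by have -> : c' * (/ r ^ (n - 2) * / r ^ (2 * m)) * (C * (r ^ (n - 2) * r ^ (2 * m))) = c' * C; [field|lra].
Qed.

End Mass.

(** * The pointwise potential bound *)

Lemma off_cube n (y x : point n) i r : 0 < r -> r < Rabs (x i - y i) ->
  r * r < sqn (fun i => x i - y i).
Proof.
move=> r0 h; apply: Rlt_le_trans (sqn_coord (fun i => x i - y i) i).
by rewrite Rsqr_abs /Rsqr; nra.
Qed.

Lemma edist_sqr n (x y : point n) : edist x y * edist x y = sqn (fun i => x i - y i).
Proof. exact: enorm_sqr. Qed.

Lemma edist_le_sqr n (x y : point n) r : 0 <= r -> sqn (fun i => x i - y i) <= r * r -> edist x y <= r.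
Proof. move=> r0; rewrite -edist_sqr; have := enorm_ge0 (fun i => x i - y i); rewrite -/(edist x y) => ? ?; nra. Qed.

Lemma cube_window n (y : point n) r S : enorm y + r < S -> forall i, - S <= y i - r /\ y i + r <= S.
Proof. by move=> h i; have := coord_le_enorm y i => /Rabs_le_between ?; lra. Qed.

Section Potential.
Context (m n : nat) (m0 : (0 < m)%N) (hodd : odd m) (hmn : (2 * m < n)%N) (w : point n -> R).
Context (hw : Ck (2 * m) (fun _ => True) w) (w0 : forall x, 0 <= w x).
Let ft x := - iter_lap m w x.
Context (ft0 : forall x, 1 < enorm x -> 0 <= ft x).

Let rho (y : point n) r := rad y (fun s => - Lit n m (Gam m n r) s).
(** Plays the role of a mean of [w] over the ball of radius [r] around [y], with a weight of
    positive total mass. *)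
Let A S y r := Iint S (fun x => w x * rho y r x).

Lemma cont_rho (y : point n) r : contg (rho y r).
Proof.
apply: cont_rad => s; apply: (@continuous_opp _ R_AbsRing R_NormedModule).
exact: (smooth1_cont (@smooth_Lit n 0 m (fun _ => Gam m n r) (smooth1_Gam _ m0 _))).
Qed.

Lemma cont_Gam (y : point n) r : contg (rad y (Gam m n r)).
Proof. by apply: cont_rad; exact: (smooth1_cont (smooth1_Gam n m0 r)). Qed.

(** A representation formula for two finite scales: the kernels agree beyond [r2], so nothing is
    left at the boundary, and the singularity at [y] never appears. *)
Lemma Gam_green S y r1 r2 : 0 < r1 -> r1 <= r2 -> enorm y + r2 < S ->
  A S y r1 - A S y r2 = Iint S (fun x => ft x * (rad y (Gam m n r1) x - rad y (Gam m n r2) x)).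
Proof.
move=> r10 r12 yS; have S0 : 0 < S by have := enorm_ge0 y => ?; lra.
have cw := cont_w hw.
have s1 := smooth1_Gam n m0 r1; have s2 := smooth1_Gam n m0 r2.
have sd : smooth1 (2 * m) (fun s => Gam m n r1 s - Gam m n r2 s) by exact: smooth1_sub.
have sp : supp S (rad y (fun s => Gam m n r1 s - Gam m n r2 s)).
  apply: (supp_rad (r := r2)) => // [|s hs]; first lra.
  by rewrite !Gam_far //; nra.
have G := green_iter S0 hw (Ck_rad y sd) sp.
rewrite iter_lap_rad // Lit_sub // in G.
rewrite /A -(Iint_sub S0); try by apply: cont_mul => //; exact: cont_rho.
rewrite (_ : (fun x => _) = (fun x => (-1) * (w x * rad y (fun s => Lit n m (Gam m n r1) s - Lit n m (Gam m n r2) s) x))); last first.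
  by apply: functional_extensionality => x; rewrite /rho /rad; ring.
have cl : contg (iter_lap m w) by exact: (@Ck_cont _ _ 0 _ (@Ck_iter_lap _ _ (@opens_all n) 0 m _ hw)).
have cd : contg (rad y (fun s => Gam m n r1 s - Gam m n r2 s)) by apply: cont_rad; exact: (smooth1_cont sd).
have cd' : contg (rad y (fun s => Lit n m (Gam m n r1) s - Lit n m (Gam m n r2) s)).
  apply: cont_rad => s; apply: (@continuous_minus _ R_AbsRing R_NormedModule).
    exact: (smooth1_cont (@smooth_Lit n 0 m (fun _ => Gam m n r1) s1)).
  exact: (smooth1_cont (@smooth_Lit n 0 m (fun _ => Gam m n r2) s2)).
rewrite (Iint_scal S0); last exact: cont_mul.
rewrite G -(Iint_scal S0); last exact: cont_mul.
by congr (Iint _); apply: functional_extensionality => x; rewrite /ft /rad; ring.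
Qed.

(* Halving the radius repeatedly; the increments are summed against the geometric series 2^-k. *)
Lemma potential_local : exists c C, 0 < c /\ 0 < C /\ forall S y r B, 0 < r -> enorm y + r < S ->
  1 + r < enorm y -> (forall z, edist z y <= r -> ft z <= B) ->
  c * w y <= A S y r + C * (r ^ (2 * m) * B).
Proof.
have [c [c0 hc]] := kernel_mass m0 hodd hmn.
have [CG [CG0 hG]] := Gam_bound m0 hmn.
have [CL [CL0 hL]] := Lit_Gam_bound m0 hmn.
have cw := cont_w hw. have cf : contg ft := cont_ft hw.
(* One halving step from [t] costs the bound [CG * (t/2)^(2m-n)] for the kernel times the volume
   [(2 t)^n] of the cube. *)
pose K := CG * 2 ^ (n - 2 * m) * 2 ^ n.
have K0 : 0 < K by apply: Rmult_lt_0_compat; [apply: Rmult_lt_0_compat => //|]; apply: pow_lt; lra.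
exists c, (2 * K); split => //; split; first lra.
move=> S y r B r0 yS y1 hB.
have S0 : 0 < S by have := enorm_ge0 y => ?; lra.
have fB z : edist z y <= r -> 0 <= ft z <= B.
  move=> hz; split; last exact: hB.
  apply: ft0; have := enorm_edist y z; rewrite edist_sym => ?; lra.
have B0 : 0 <= B by have := fB y; rewrite edist_refl => /(_ (Rlt_le _ _ r0)) ?; lra.
have rp : 0 < r ^ (2 * m) by exact: pow_lt.
have step t : 0 < t -> t <= r -> A S y (t / 2) <= A S y t + K * (t ^ (2 * m) * B).
  move=> t0 tr.
  have t2 : 0 < t / 2 by lra.
  suff : A S y (t / 2) - A S y t <= K * (t ^ (2 * m) * B) by move=> ?; lra.
  rewrite Gam_green //; try lra.
  have tn : 0 < / (t / 2) ^ (n - 2 * m) by apply: Rinv_0_lt_compat; exact: pow_lt.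
  have -> : K * (t ^ (2 * m) * B) = B * (CG * / (t / 2) ^ (n - 2 * m)) * (2 * t) ^ n.
    have e : n = (n - 2 * m + 2 * m)%N by rewrite subnK // ltnW.
    have en : t ^ n = t ^ (n - 2 * m) * t ^ (2 * m) by rewrite {1}e pow_add.
    rewrite /K (Rpow_mult_distr 2 t n) en /Rdiv Rpow_mult_distr pow_inv.
    by field; split; apply: pow_nonzero; lra.
  have BC : 0 <= B * (CG * / (t / 2) ^ (n - 2 * m)) by apply: Rmult_le_pos => //; nra.
  have far x : t * t < sqn (fun i => x i - y i) -> ft x * (rad y (Gam m n (t / 2)) x - rad y (Gam m n t) x) = 0.
    by move=> h; rewrite /rad !Gam_far //; [ring|lra|nra].
  apply: (@Iint_upper _ _ S0 _ y t) => //; [|lra| | |].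
  - by apply: cont_mul => //; apply: cont_sub; exact: cont_Gam.
  - by apply: cube_window; lra.
  - move=> x; have [h|h] := Rle_or_lt (sqn (fun i => x i - y i)) (t * t); last by rewrite far.
    have xr : edist x y <= r by apply: (Rle_trans _ t) => //; apply: edist_le_sqr => //; lra.
    have [f0 fx] := fB x xr.
    have s0 := sqn_ge0 (fun i => x i - y i).
    have [_ g1] := hG _ _ t2 s0; have [g2 _] := hG _ _ t0 s0.
    rewrite /rad; apply: Rle_trans (_ : ft x * (CG * / (t / 2) ^ (n - 2 * m)) <= _).
      by apply: Rmult_le_compat_l => //; lra.
    by apply: Rmult_le_compat_r => //; nra.
  - by move=> x i hx; rewrite far; [lra|exact: (off_cube t0 hx)].
(* The factor [2 - 2 / 2^k] is the sum of the first [k] terms of the series, since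
   [(r / 2^k)^(2m) <= r^(2m) / 2^k]. *)
have iter_step k : A S y (r / 2 ^ k) <= A S y r + K * (r ^ (2 * m) * B) * (2 - 2 / 2 ^ k).
  elim: k => [|k IH]; first by rewrite /= /Rdiv Rinv_1 !Rmult_1_r; lra.
  have p2 : 1 <= 2 ^ k by apply: pow_R1_Rle; lra.
  have p0 : 0 < 2 ^ k by lra.
  have i1 : 0 < / 2 ^ k <= 1.
    split; first exact: Rinv_0_lt_compat.
    by rewrite -Rinv_1; apply: Rinv_le_contravar; lra.
  have rk : 0 < r / 2 ^ k by apply: Rdiv_lt_0_compat.
  have := step (r / 2 ^ k) rk _; have -> : r / 2 ^ k / 2 = r / 2 ^ k.+1 by rewrite /=; field; lra.
  have rk1 : r / 2 ^ k <= r by rewrite /Rdiv; nra.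
  move=> /(_ rk1) h.
  have h2 : (r / 2 ^ k) ^ (2 * m) <= r ^ (2 * m) * / 2 ^ k.
    rewrite /Rdiv Rpow_mult_distr; apply: Rmult_le_compat_l; first lra.
    have -> : (2 * m = (2 * m).-1.+1)%N by rewrite prednK // muln_gt0.
    rewrite -tech_pow_Rmult -[X in _ <= X]Rmult_1_r; apply: Rmult_le_compat_l; first lra.
    by rewrite -(pow1 (2 * m).-1); apply: pow_incr; lra.
  have h3 : K * ((r / 2 ^ k) ^ (2 * m) * B) <= K * (r ^ (2 * m) * B) * / 2 ^ k.
    have -> : K * (r ^ (2 * m) * B) * / 2 ^ k = K * (r ^ (2 * m) * / 2 ^ k * B) by ring.
    by apply: Rmult_le_compat_l; [lra|apply: Rmult_le_compat_r].
  have -> : K * (r ^ (2 * m) * B) * (2 - 2 / 2 ^ k.+1) =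
      K * (r ^ (2 * m) * B) * (2 - 2 / 2 ^ k) + K * (r ^ (2 * m) * B) * / 2 ^ k by rewrite /=; field; lra.
  lra.
(* At a small radius [t = r / 2^k] continuity replaces [w] by [w y]. The kernel is at most
   [CL * t^(-n)] on a cube of volume [(2 t)^n], so an oscillation [d = e / (CL * 2^n)] costs at most
   [e]. *)
apply: le_epsilon => e e0.
pose d := e / (CL * 2 ^ n).
have q0 : 0 < CL * 2 ^ n by apply: Rmult_lt_0_compat => //; apply: pow_lt; lra.
have d0 : 0 < d by exact: Rdiv_lt_0_compat.
have [dl [dl0 hdl]] := cw y I d d0.
have [k hk] : exists k, r / 2 ^ k < dl.
  have [k hk] := Pow_x_infinity 2 (ltac:(rewrite Rabs_pos_eq; lra)) (r / dl + 1).
  exists k; have := hk k (Nat.le_refl _); rewrite Rabs_pos_eq; last by apply: pow_le; lra.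
  move=> h; have p0 : 0 < 2 ^ k by apply: pow_lt; lra.
  apply: (Rmult_lt_reg_r (2 ^ k)) => //; rewrite /Rdiv Rmult_assoc Rinv_l; last lra.
  have : dl * (r / dl + 1) <= dl * 2 ^ k by apply: Rmult_le_compat_l; lra.
  have -> : dl * (r / dl + 1) = r + dl by field; lra.
  by move=> ?; lra.
set t := r / 2 ^ k in hk.
have p1 : 1 <= 2 ^ k by apply: pow_R1_Rle; lra.
have t0 : 0 < t by apply: Rdiv_lt_0_compat; lra.
have tr : t <= r.
  apply: (Rmult_le_reg_r (2 ^ k)); first lra.
  by rewrite /t /Rdiv Rmult_assoc Rinv_l; nra.
have crho := cont_rho y t.
have close : w y * Iint S (rho y t) - A S y t <= e.
  rewrite -(Iint_scal S0) // -(Iint_sub S0); [|exact: cont_scal|exact: cont_mul].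
  have -> : e = d * (CL * / t ^ n) * (2 * t) ^ n.
    rewrite Rpow_mult_distr /d; field; split; [|split]; try lra; apply: pow_nonzero; lra.
  have tn : 0 < / t ^ n by apply: Rinv_0_lt_compat; exact: pow_lt.
  have far x : t * t < sqn (fun i => x i - y i) -> w y * rho y t x - w x * rho y t x = 0.
    move=> h; rewrite /rho /rad; have [_ ->] := hL _ _ t0 (sqn_ge0 (fun i => x i - y i)); [ring|exact: h].
  apply: (@Iint_upper _ _ S0 _ y t) => //; [|lra| | | |].
  - by apply: cont_sub; [exact: cont_scal|exact: cont_mul].
  - by apply: Rmult_le_pos; [lra|nra].
  - by apply: cube_window; lra.
  - move=> x; have [h|h] := Rle_or_lt (sqn (fun i => x i - y i)) (t * t); last first.
      by rewrite far //; apply: Rmult_le_pos; [lra|nra].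
    have xt : edist x y <= t by apply: edist_le_sqr => //; lra.
    have wd : Rabs (w x - w y) < d by apply: hdl => //; apply: Rle_lt_trans xt hk.
    have [rb _] := hL _ _ t0 (sqn_ge0 (fun i => x i - y i)).
    have -> : w y * rho y t x - w x * rho y t x = (w x - w y) * - rho y t x by ring.
    apply: Rle_trans (Rle_abs _) _; rewrite Rabs_mult.
    apply: Rmult_le_compat; try exact: Rabs_pos; first lra.
    by rewrite /rho /rad Ropp_involutive.
  - by move=> x i hx; rewrite far; [lra|exact: (off_cube t0 hx)].
have mass : c * w y <= w y * Iint S (rho y t).
  by rewrite Rmult_comm; apply: Rmult_le_compat_l => //; apply: hc => //; lra.
have := iter_step k; rewrite -/t => it.
have KB : 0 <= K * (r ^ (2 * m) * B) by apply: Rmult_le_pos; [lra|apply: Rmult_le_pos; lra].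
have i0 : 0 < / 2 ^ k by apply: Rinv_0_lt_compat; lra.
have : K * (r ^ (2 * m) * B) * (2 - 2 / 2 ^ k) <= 2 * K * (r ^ (2 * m) * B).
  rewrite /Rdiv; nra.
move=> ?; lra.
Qed.

(** With [p] comparable to [r0], the difference of the means at the radii [r] and [p] is at most the
    size [r^(2m-n)] of the kernel times the mass of [ft]. The mean at [p] is at most [p^(-n)] times
    the mass of [w], of order [r0^(2m-2)]. The last term is that of [potential_local]. *)
Lemma potential_bound : exists C, 0 < C /\ forall r0 r y B, 16 <= r0 -> 0 < r <= r0 / 8 ->
  3 / 4 * r0 <= enorm y <= 5 / 4 * r0 -> (forall z, edist z y <= r -> ft z <= B) ->
  w y <= C * (r0 ^ (n - 2) * / r ^ (n - 2 * m) + r0 ^ (2 * m - 2) + r ^ (2 * m) * B).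
Proof.
have [c [K [c0 [K0 hloc]]]] := potential_local.
have [CG [CG0 hG]] := Gam_bound m0 hmn.
have [CL [CL0 hL]] := Lit_Gam_bound m0 hmn.
have [CM [CM0 hM]] := mass_bound m0 hmn hw w0 ft0.
have cw := cont_w hw. have cf : contg ft := cont_ft hw.
pose K1 := CG * CM; pose K2 := CL * 8 ^ n * CM.
have K10 : 0 < K1 by exact: Rmult_lt_0_compat.
have K20 : 0 < K2 by apply: Rmult_lt_0_compat => //; apply: Rmult_lt_0_compat => //; apply: pow_lt; lra.
exists ((K1 + K2 + K) / c); split; first by apply: Rdiv_lt_0_compat => //; lra.
move=> R r y B R16 [r0 rR] [y1 y2] hB.
have B0 : 0 <= B.
  apply: Rle_trans (hB y _); last by rewrite edist_refl; lra.
  by apply: ft0; lra.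
have mp := pos_INR m.
(* The test function [th] lives within [2 p = R / 4] of [y], hence in the annulus covered by
   [mass_bound]; [S] is the smallest cube allowed there. *)
pose S := (2 * INR m + 5) * R; pose p := R / 8.
have p0 : 0 < p by rewrite /p; lra.
have S5 : 5 * R <= S by rewrite /S; nra.
have S0 : 0 < S by lra.
have yp : enorm y + p < S by rewrite /p; lra.
have yr : enorm y + r < S by lra.
have hl := hloc S y r B r0 yr (ltac:(lra)) hB.
pose pp := fun u => Rmax 0 (1 - u).
(* Nesting two truncations gives a continuous plateau: 1 for [s <= p^2], 0 for [s >= 2 p^2]. *)
pose U := fun s => pp (pp (2 - s * / (p * p))).
have p2 : 0 < p * p by nra.
have rp2 : r * r <= p * p by apply: Rmult_le_compat; rewrite /p; lra.
have i2 : 0 < / (p * p) by exact: Rinv_0_lt_compat.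
pose th := rad y U.
have cth : contg th.
  apply: cont_rad => s; apply: (continuous_comp (fun s => pp (2 - s * / (p * p))) pp); last exact: continuous_pos_part.
  apply: (continuous_comp (fun s => 2 - s * / (p * p)) pp); last exact: continuous_pos_part.
  apply: (@continuous_minus _ R_AbsRing R_NormedModule); first exact: continuous_const.
  by apply: (@continuous_mult _ R_AbsRing); [exact: continuous_id|exact: continuous_const].
have pp0 u : 0 <= pp u by exact: Rmax_l.
have pp1 u : 0 <= u -> pp u <= 1 by move=> h; apply: Rmax_lub; lra.
have th01 x : 0 <= th x <= 1 by split; [exact: pp0|apply: pp1; exact: pp0].
have U1 s : s <= p * p -> U s = 1.
  move=> h; have e : s * / (p * p) <= 1 by rewrite -(Rinv_r (p * p)); [apply: Rmult_le_compat_r|]; lra.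
  by rewrite /U /pp (Rmax_left 0 (1 - (2 - _))); [rewrite Rmax_right|]; lra.
have U0 s : 2 * (p * p) <= s -> U s = 0.
  move=> h; have e : 2 <= s * / (p * p).
    by rewrite (_ : 2 = 2 * (p * p) * / (p * p)); [apply: Rmult_le_compat_r; lra|field; lra].
  rewrite /U /pp Rmax_left //; have := Rmax_r 0 (1 - (2 - s * / (p * p))) => ?; lra.
have hth x : th x <> 0 -> R / 2 <= enorm x <= 3 / 2 * R.
  move=> h; have sx : sqn (fun i => x i - y i) < 2 * (p * p).
    by apply: Rnot_le_lt => h'; apply: h; exact: U0.
  have dx : edist x y <= 2 * p by apply: edist_le_sqr; nra.
  have := enorm_edist x y; have := enorm_edist y x; rewrite (edist_sym y) => ? ?.
  by move: dx; rewrite /p => ?; lra.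
have [M1 M2] := hM R S th (ltac:(lra)) (Rle_refl S) cth th01 hth.
rewrite -/ft in M1.
have rn : 0 < / r ^ (n - 2 * m) by apply: Rinv_0_lt_compat; exact: pow_lt.
have pn : 0 < / p ^ n by apply: Rinv_0_lt_compat; exact: pow_lt.
have cft : contg (fun x => ft x * th x) by exact: cont_mul.
have cwt : contg (fun x => w x * th x) by exact: cont_mul.
have s1 : A S y r - A S y p <= K1 * (R ^ (n - 2) * / r ^ (n - 2 * m)).
  rewrite Gam_green //.
  apply: Rle_trans (_ : Iint S (fun x => CG * / r ^ (n - 2 * m) * (ft x * th x)) <= _).
    apply: (Iint_le S0); [|exact: cont_scal|].
      by apply: cont_mul => //; apply: cont_sub; exact: cont_Gam.
    move=> x; have s0 := sqn_ge0 (fun i => x i - y i).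
    have [t0 t1] := th01 x.
    have [h|h] := Rle_or_lt (sqn (fun i => x i - y i)) (p * p); last first.
      rewrite {1 2}/rad !Gam_far //; try lra.
      rewrite Rminus_diag Rmult_0_r; apply: Rmult_le_pos; first nra.
      case: (Req_dec (th x) 0) => [->|/hth [h1 _]]; first lra.
      by apply: Rmult_le_pos => //; apply: ft0; lra.
    have tx : th x = 1 by exact: U1.
    have fx : 0 <= ft x by apply: ft0; have := hth x; rewrite tx => /(_ R1_neq_R0) ?; lra.
    rewrite tx Rmult_1_r Rmult_comm; apply: Rmult_le_compat_r => //.
    have [_ g1] := hG _ _ r0 s0; have [g2 _] := hG _ _ p0 s0.
    by rewrite /rad; lra.
  rewrite (Iint_scal S0) // /K1.
  have -> : CG * CM * (R ^ (n - 2) * / r ^ (n - 2 * m)) = CG * / r ^ (n - 2 * m) * (CM * R ^ (n - 2)) by ring.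
  by apply: Rmult_le_compat_l => //; nra.
have s2 : A S y p <= K2 * R ^ (2 * m - 2).
  apply: Rle_trans (_ : Iint S (fun x => CL * / p ^ n * (w x * th x)) <= _).
    apply: (Iint_le S0); [|exact: cont_scal|].
      by apply: cont_mul => //; exact: cont_rho.
    move=> x; have s0 := sqn_ge0 (fun i => x i - y i).
    have [t0 t1] := th01 x; have wx := w0 x.
    have [b1 b2] := hL _ _ p0 s0.
    have [h|h] := Rle_or_lt (sqn (fun i => x i - y i)) (p * p); last first.
      rewrite /rho {1}/rad b2 // Ropp_0 Rmult_0_r; apply: Rmult_le_pos; first nra.
      exact: Rmult_le_pos.
    have tx : th x = 1 by exact: U1.
    rewrite tx Rmult_1_r Rmult_comm; apply: Rmult_le_compat_r => //.
    by rewrite /rho /rad; move/Rabs_le_between: b1; lra.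
  rewrite (Iint_scal S0) //.
  have -> : K2 * R ^ (2 * m - 2) = CL * / p ^ n * (CM * (R ^ (n - 2) * R ^ (2 * m))).
    have e : R ^ (n - 2) * R ^ (2 * m) = R ^ n * R ^ (2 * m - 2).
      have m2 : (2 <= 2 * m)%N by rewrite leq_pmulr.
      have e0 : (n - 2 + 2 * m = n + (2 * m - 2))%N by rewrite addnBA // addnBAC // (two_le_n m0 hmn).
      by rewrite -!pow_add; congr (R ^ _).
    rewrite e /K2 /p /Rdiv Rpow_mult_distr pow_inv; field.
    by split; apply: pow_nonzero; lra.
  by apply: Rmult_le_compat_l => //; nra.
have rB : 0 <= r ^ (2 * m) * B by apply: Rmult_le_pos => //; apply: pow_le; lra.
have Rm : 0 < R ^ (2 * m - 2) by apply: pow_lt; lra.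
have Rn : 0 < R ^ (n - 2) by apply: pow_lt; lra.
set a1 := R ^ (n - 2) * / r ^ (n - 2 * m) in s1 *; set a2 := R ^ (2 * m - 2) in s2 Rm *.
set a3 := r ^ (2 * m) * B in hl rB *.
have a10 : 0 < a1 by exact: Rmult_lt_0_compat.
apply: (Rmult_le_reg_l c) => //.
have -> : c * ((K1 + K2 + K) / c * (a1 + a2 + a3)) = (K1 + K2 + K) * (a1 + a2 + a3) by field; lra.
nra.
Qed.

End Potential.

(** * Doubling and the choice of the radius *)

Lemma opens_enorm_gt n c : opens (fun x : point n => c < enorm x).
Proof.
move=> x hx; have n0 := pos_INR n.
have d0 : 0 < (enorm x - c) / (INR n + 1) by apply: Rdiv_lt_0_compat; lra.
exists ((enorm x - c) / (INR n + 1)); split => // y hy.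
have h : edist x y <= INR n * ((enorm x - c) / (INR n + 1)).
  rewrite edist_sym; apply: enorm_le_coord; first lra.
  by move=> i; apply: Rlt_le; exact: hy.
have e : INR n * ((enorm x - c) / (INR n + 1)) = enorm x - c - (enorm x - c) / (INR n + 1) by field; lra.
have := enorm_edist x y => ?; lra.
Qed.

Lemma opens_enorm_lt n c : opens (fun x : point n => enorm x < c).
Proof.
move=> x hx; have n0 := pos_INR n.
have d0 : 0 < (c - enorm x) / (INR n + 1) by apply: Rdiv_lt_0_compat; lra.
exists ((c - enorm x) / (INR n + 1)); split => // y hy.
have h : edist y x <= INR n * ((c - enorm x) / (INR n + 1)).
  by apply: enorm_le_coord; [lra|move=> i; apply: Rlt_le; exact: hy].
have e : INR n * ((c - enorm x) / (INR n + 1)) = c - enorm x - (c - enorm x) / (INR n + 1) by field; lra.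
have := enorm_edist y x => ?; lra.
Qed.

(** The point [y] maximizes [w z * (p - |z - y0|)^k] over the ball up to a factor 2, so that a
    supremum is enough. At distance [d / 2] from [y] the weight has dropped by at most [2^k], which
    gives the last bound. *)
Lemma doubling n (w : point n -> R) y0 p k : contg w -> (forall x, 0 <= w x) ->
  0 < w y0 -> 0 < p -> (0 < k)%N ->
  exists y d, 0 < d <= p /\ edist y y0 = p - d /\ w y0 * p ^ k / 2 <= w y * d ^ k /\
    w y0 / 2 <= w y /\ forall z, edist z y <= d / 2 -> w z <= 2 * 2 ^ k * w y.
Proof.
move=> cw w0 wy0 p0 k0.
pose f z := w z * (p - edist z y0) ^ k.
have [C hC] := bounded_cube (enorm y0 + p) cw.
have fC z : edist z y0 <= p -> f z <= C * p ^ k.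
  move=> hz; have e0 : 0 <= edist z y0 by exact: enorm_ge0.
  apply: Rmult_le_compat => //; first by apply: pow_le; lra.
    apply: Rle_trans (Rle_abs _) (hC z _) => i.
    by apply: Rle_trans (coord_le_enorm z i) _; have := enorm_edist z y0 => ?; lra.
  by apply: pow_incr; lra.
have [M [ub lb]] : {M | is_lub (fun t => exists z, edist z y0 <= p /\ t = f z) M}.
  apply: completeness; first by exists (C * p ^ k) => t [z [hz ->]]; exact: fC.
  by exists (f y0), y0; split => //; rewrite edist_refl; lra.
have fy0 : f y0 = w y0 * p ^ k by rewrite /f edist_refl Rminus_0_r.
have pk : 0 < p ^ k by exact: pow_lt.
have M0 : w y0 * p ^ k <= M by rewrite -fy0; apply: ub; exists y0; rewrite edist_refl; split => //; lra.
have Mp : 0 < M by nra.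
have [y [hy fy]] : exists y, edist y y0 <= p /\ M / 2 < f y.
  apply: Classical_Prop.NNPP => h.
  have : M <= M / 2; last by move=> ?; lra.
  apply: lb => t [z [hz ->]]; apply: Rnot_lt_le => h'; apply: h; by exists z.
have ey0 : 0 <= edist y y0 by exact: enorm_ge0.
exists y, (p - edist y y0); set d := p - edist y y0 in fy *.
have d0 : 0 <= d by rewrite /d; lra.
have dp : 0 < d.
  case: d0 => // d0; move: fy; rewrite /f -/d -d0 pow_i; last exact/ltP.
  by rewrite Rmult_0_r => ?; lra.
have dle : d <= p by rewrite /d; lra.
have dk : 0 < d ^ k by exact: pow_lt.
have dpk : d ^ k <= p ^ k by apply: pow_incr; lra.
have H : w y0 * p ^ k / 2 <= w y * d ^ k by move: fy; rewrite /f -/d => fy; lra.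
split=> //; split; first by rewrite /d; ring.
split=> //; split.
  apply: (Rmult_le_reg_r (p ^ k)) => //.
  have := Rmult_le_compat_l _ _ _ (w0 y) dpk => ?; lra.
move=> z hz.
have zy0 : edist z y0 <= p - d / 2.
  by have := edist_triangle z y y0; move: hz; rewrite /d => ? ?; lra.
have fz : f z <= M by apply: ub; exists z; split => //; lra.
have d2 : (d / 2) ^ k <= (p - edist z y0) ^ k by apply: pow_incr; lra.
have h1 : w z * (d / 2) ^ k <= M by apply: Rle_trans fz; apply: Rmult_le_compat_l.
have e2 : d ^ k = 2 ^ k * (d / 2) ^ k by rewrite -Rpow_mult_distr; congr (_ ^ _); field.
have d2k : 0 < (d / 2) ^ k by apply: pow_lt; lra.
apply: (Rmult_le_reg_r ((d / 2) ^ k)) => //.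
have -> : 2 * 2 ^ k * w y * (d / 2) ^ k = 2 * (w y * d ^ k) by rewrite e2; ring.
by move: fy; rewrite /f -/d => fy; lra.
Qed.

(* The radius balances [R^(n-2) / r^(n-2m)], the potential of the far mass, against
   [r^(2m) A^sigma], the potential of the near mass; both then equal [A (R^b / A)^de]. *)
Lemma balance_radius (m n : nat) (sigma C H : R) :
  (0 < m)%N -> (2 * m < n)%N -> 0 < sigma -> sigma < INR n / (INR n - 2 * INR m) ->
  0 < C -> 0 < H ->
  let b := 2 * INR m * (INR n - 2) / (INR n - sigma * (INR n - 2 * INR m)) in
  0 < b /\ exists L, 1 <= L /\ forall R A d a0, 1 <= R -> 0 < d -> L * Rpower R b < a0 ->
    a0 * (R / 4) ^ (n - 2 * m) / 2 <= A * d ^ (n - 2 * m) -> a0 / 2 <= A ->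
    exists r, 0 < r <= d / 2 /\
      C * (R ^ (n - 2) * / r ^ (n - 2 * m) + R ^ (2 * m - 2) + r ^ (2 * m) * (H * Rpower A sigma)) < A.
Proof.
move=> m0 hmn s0 s1 C0 H0 b.
set N := INR n in s1 b *; set M := INR m in s1 b *.
have M1 : 1 <= M by apply: (le_INR 1); apply/leP.
have MN : 2 * M < N by have := lt_INR _ _ (ltP hmn); rewrite mult_INR /=.
(* The upper bound on [sigma], cleared of its denominator; both [b] and [de] are positive because of
   it. *)
have den0 : 0 < N - sigma * (N - 2 * M).
  have := Rmult_lt_compat_r (N - 2 * M) _ _ (ltac:(lra)) s1.
  by rewrite /Rdiv Rmult_assoc Rinv_l; lra.
set den := N - sigma * (N - 2 * M) in den0 b *.
have denN : den < N by rewrite /den; nra.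
have bden : b * den = 2 * M * (N - 2) by rewrite /b; field; lra.
have b0 : 0 < b by apply: Rdiv_lt_0_compat => //; nra.
(* By [den <= N] and [(2M-2) N <= 2M (N-2)], the latter being [2M <= N]. The middle term [R^(2m-2)]
   is thus at most [R^b]. *)
have b2 : 2 * M - 2 <= b.
  apply: (Rmult_le_reg_r den) => //; rewrite bden.
  apply: Rle_trans (_ : (2 * M - 2) * N <= _); last nra.
  by apply: Rmult_le_compat_l; lra.
split=> //.
pose de := den / N.
have de0 : 0 < de by apply: Rdiv_lt_0_compat; lra.
have de1 : de <= 1.
  by apply: (Rmult_le_reg_r N); [lra|rewrite /de /Rdiv Rmult_assoc Rinv_l; lra].
set k := (n - 2 * m)%N.
have kR : INR k = N - 2 * M by rewrite /k minus_INR ?mult_INR //; apply/leP; exact: ltnW.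
pose C2 := C * (8 ^ k + 2 + H).
have k8 : 0 < 8 ^ k by apply: pow_lt; lra.
have C20 : 0 < C2 by apply: Rmult_lt_0_compat; lra.
(* [L = 2 / x] forces [R^b <= x A]. The three terms are then at most a multiple of
   [A x^de = A / (C2 + 1)], and their total is at most [C2 * A / (C2 + 1) < A]. *)
pose x := Rpower (/ (C2 + 1)) (/ de).
have i1 : 0 < / (C2 + 1) by apply: Rinv_0_lt_compat; lra.
have i2 : / (C2 + 1) <= 1 by rewrite -Rinv_1; apply: Rinv_le_contravar; lra.
have x0 : 0 < x by exact: Rpower_pos.
have xde : Rpower x de = / (C2 + 1).
  by rewrite /x Rpower_mult Rinv_l ?Rpower_1 //; lra.
have x1 : x <= 1.
  rewrite -(Rpower_O 1); last lra.
  rewrite (_ : Rpower 1 0 = Rpower 1 (/ de)).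
    by apply: Rle_Rpower_l; [apply: Rlt_le; exact: Rinv_0_lt_compat|lra].
  by rewrite /Rpower ln_1 !Rmult_0_r.
have xle : x <= Rpower x de.
  rewrite -{1}(Rpower_1 x) // /Rpower.
  have : 1 * ln x <= de * ln x.
    by have : ln x <= ln 1 by [apply: ln_le]; rewrite ln_1 => ?; nra.
  by case=> [?|->]; [apply: Rlt_le; exact: exp_increasing|exact: Rle_refl].
exists (2 / x); split.
  by apply: (Rmult_le_reg_r x) => //; rewrite /Rdiv Rmult_assoc Rinv_l; lra.
move=> R A d a0 R1 d0 La hA1 hA2.
have Rb0 := Rpower_pos R b.
have a00 : 0 < a0 by apply: Rlt_trans La; apply: Rmult_lt_0_compat => //; apply: Rdiv_lt_0_compat; lra.
have A0 : 0 < A by lra.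
have xx : x * (2 / x * Rpower R b) = 2 * Rpower R b by field; lra.
have RbA : Rpower R b <= x * A.
  have : 2 / x * Rpower R b < 2 * A by lra.
  move=> h; have := Rmult_lt_compat_l _ _ _ x0 h.
  rewrite xx => ?; lra.
pose Q := Rpower R (N - 2) * Rpower A (- sigma).
have Q0 : 0 < Q by apply: Rmult_lt_0_compat; exact: Rpower_pos.
pose rs := Rpower Q (/ N).
have rs0 : 0 < rs by exact: Rpower_pos.
have rsn : rs ^ n = Q.
  by rewrite -Rpower_pow // /rs Rpower_mult Rinv_l ?Rpower_1 //; rewrite -/N; lra.
have Rn2 : R ^ (n - 2) = Rpower R (N - 2).
  rewrite -Rpower_pow; last lra.
  by rewrite minus_INR //; apply/leP; apply: leq_trans (ltnW hmn); rewrite -{1}(muln1 2%N) leq_mul2l.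
have Rm2 : R ^ (2 * m - 2) <= Rpower R b.
  rewrite -Rpower_pow; last lra.
  apply: Rle_Rpower; first lra.
  rewrite minus_INR; last by apply/leP; rewrite leq_pmulr.
  by rewrite mult_INR -/M; move: b2; rewrite /=; lra.
pose Y := rs ^ (2 * m) * Rpower A sigma.
have nk : n = (k + 2 * m)%N by rewrite /k subnK // ltnW.
have rsk : 0 < rs ^ k by exact: pow_lt.
have Yeq : R ^ (n - 2) * / rs ^ k = Y.
  have e : Rpower R (N - 2) = rs ^ n * Rpower A sigma.
    rewrite rsn /Q Rmult_assoc -Rpower_plus (_ : - sigma + sigma = 0); last ring.
    by rewrite Rpower_O // Rmult_1_r.
  by rewrite Rn2 e {1}nk pow_add /Y; field; lra.
(* In logarithms [Y = A (R^b / A)^de], because [de * b = 2M (N-2) / N]; then [R^b <= x A]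
   applies. *)
have YA : Y <= A * Rpower x de.
  have lnRb : b * ln R <= ln x + ln A.
    rewrite -ln_mult // -(ln_exp (b * ln R)); exact: ln_le.
  have -> : A * Rpower x de = exp (ln A + de * ln x) by rewrite exp_plus exp_ln.
  have -> : Y = exp (2 * M / N * ((N - 2) * ln R - sigma * ln A) + sigma * ln A).
    rewrite exp_plus /Y; congr (_ * _).
    rewrite -Rpower_pow // mult_INR /rs Rpower_mult /Q /Rpower ln_mult; try exact: exp_pos.
    rewrite !ln_exp -/M; congr exp; rewrite /=; field; lra.
  have -> : 2 * M / N * ((N - 2) * ln R - sigma * ln A) + sigma * ln A =
      de * (b * ln R) + (1 - de) * ln A.
    have e : de * b = 2 * M * (N - 2) / N by rewrite -bden /de; field; lra.
    by rewrite -Rmult_assoc e /de /den; field; lra.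
  have : de * (b * ln R) + (1 - de) * ln A <= ln A + de * ln x by nra.
  by case=> [?|->]; [apply: Rlt_le; exact: exp_increasing|exact: Rle_refl].
have dk : 0 < (d / 2) ^ k by apply: pow_lt; lra.
(* The case where the radius is cut down to [d / 2]. The doubling inequality bounds [(R / (d/2))^k]
   by [8^k * 2 A / a0], and the remaining factor [R^(2m-2)] is at most [R^b <= x a0 / 2], so [a0]
   cancels. *)
have far : R ^ (n - 2) * / (d / 2) ^ k <= 8 ^ k * (x * A).
  have Rk : 0 < R ^ k by apply: pow_lt; lra.
  have e : R ^ (n - 2) = R ^ k * R ^ (2 * m - 2).
    have e0 : (n - 2 = k + (2 * m - 2))%N by rewrite addnBA ?leq_pmulr // -nk.
    by rewrite e0 pow_add.
  have h1 : R ^ k * a0 <= 8 ^ k * (2 * A * (d / 2) ^ k).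
    have e1 : a0 * (R / 4) ^ k / 2 = R ^ k * a0 * / 4 ^ k / 2.
      by rewrite /Rdiv Rpow_mult_distr pow_inv; ring.
    have e2 : d ^ k = 2 ^ k * (d / 2) ^ k by rewrite -Rpow_mult_distr; congr (_ ^ _); field.
    have e3 : 8 ^ k = 4 ^ k * 2 ^ k by rewrite -Rpow_mult_distr; congr (_ ^ _); ring.
    have p4 : 0 < 4 ^ k by apply: pow_lt; lra.
    move: hA1; rewrite -/k e1 e2 => hA1.
    have := Rmult_le_compat_l (2 * 4 ^ k) _ _ (ltac:(lra)) hA1.
    rewrite (_ : 2 * 4 ^ k * (R ^ k * a0 * / 4 ^ k / 2) = R ^ k * a0); last by field; lra.
    by rewrite e3 => ?; lra.
  have h2 : R ^ (2 * m - 2) <= x * a0 / 2.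
    apply: Rle_trans Rm2 _.
    have := Rmult_lt_compat_l _ _ _ x0 La.
    rewrite xx => ?; lra.
  apply: (Rmult_le_reg_r ((d / 2) ^ k)) => //.
  rewrite Rmult_assoc Rinv_l ?Rmult_1_r; last lra.
  rewrite e; apply: Rle_trans (Rmult_le_compat_l _ _ _ (Rlt_le _ _ Rk) h2) _.
  have -> : R ^ k * (x * a0 / 2) = (x / 2) * (R ^ k * a0) by field.
  apply: Rle_trans (Rmult_le_compat_l _ _ _ _ h1) _; first lra.
  by apply: Req_le; field.
(* The balancing radius [rs] is capped at [d / 2], beyond which doubling does not control [w]. *)
pose r := Rmin (d / 2) rs.
have r0 : 0 < r by apply: Rmin_pos; lra.
exists r; split; first by split => //; exact: Rmin_l.
have t1 : R ^ (n - 2) * / r ^ k <= 8 ^ k * (x * A) + Y.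
  have Y0 : 0 <= Y by apply: Rmult_le_pos; [apply: pow_le; lra|apply: Rlt_le; exact: Rpower_pos].
  rewrite /r /Rmin; case: Rle_dec => _; first lra.
  by rewrite Yeq; have : 0 <= 8 ^ k * (x * A) by [apply: Rmult_le_pos; nra]; move=> ?; lra.
have t3 : r ^ (2 * m) * (H * Rpower A sigma) <= H * Y.
  have -> : H * Y = rs ^ (2 * m) * (H * Rpower A sigma) by rewrite /Y; ring.
  apply: Rmult_le_compat_r; first by apply: Rmult_le_pos; [lra|apply: Rlt_le; exact: Rpower_pos].
  by apply: pow_incr; split; [lra|exact: Rmin_r].
have xA : x * A <= A * Rpower x de by rewrite Rmult_comm; apply: Rmult_le_compat_l => //; lra.
set Z := A * Rpower x de in xA YA.
have tot : R ^ (n - 2) * / r ^ k + R ^ (2 * m - 2) + r ^ (2 * m) * (H * Rpower A sigma)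
   <= (8 ^ k + 2 + H) * Z.
  have q1 : 8 ^ k * (x * A) <= 8 ^ k * Z by apply: Rmult_le_compat_l; lra.
  have q2 : H * Y <= H * Z by apply: Rmult_le_compat_l; lra.
  lra.
apply: Rle_lt_trans (Rmult_le_compat_l _ _ _ (Rlt_le _ _ C0) tot) _.
rewrite -Rmult_assoc -/C2 /Z xde.
have -> : C2 * (A * / (C2 + 1)) = A - A * / (C2 + 1) by field; lra.
have : 0 < A * / (C2 + 1) by apply: Rmult_lt_0_compat.
lra.
Qed.

(** * Proof of the theorem *)

(** The inner power is 0 for [s <= 1/2] and at least 1 for [s >= 1], so the outer one is 1,
    respectively 0, on these ranges, without any normalization. The variable is [s = |x|^2]. *)
Definition cutoff (K : nat) (s : R) : R := 1 - ppow K (ppow K (2 - 2 * s)).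

Lemma smooth1_cutoff k : smooth1 k (cutoff k.+1).
Proof.
apply: smooth1_sub; first exact: smooth_const.
apply: smooth1_comp; first exact: smooth1_ppow.
apply: (smooth1_comp (smooth1_ppow k)); apply: smooth1_sub; first exact: smooth_const.
by apply: smooth_scal; exact: smooth_id.
Qed.

Lemma cutoff_left K s : s <= 1 / 2 -> cutoff K.+1 s = 0.
Proof.
move=> h; rewrite /cutoff (@ppow_right K (2 - 2 * s)); last lra.
by rewrite ppow_left ?Rminus_0_r ?pow1; [ring|lra].
Qed.

Lemma cutoff_right K s : 1 <= s -> cutoff K.+1 s = 1.
Proof.
move=> h; rewrite /cutoff ppow_right ?Rminus_0_r //.
rewrite ppow_left; last lra.
by apply: pow_R1_Rle; lra.
Qed.

Lemma cutoff_ge0 K s : 0 <= cutoff K s.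
Proof. by have := ppow_le1 K (ppow_ge0 K (2 - 2 * s)); rewrite /cutoff => ?; lra. Qed.

Lemma Ck_cutoff n k (v : point n -> R) : Ck k (fun y => 1 / 2 < enorm y) v ->
  Ck k (fun _ => True) (fun x => rad (fun _ => 0) (cutoff k.+1) x * v x).
Proof.
(* The radius [7/10] exceeds [1/2], so the two open sets cover the space, and its square is below
   [1/2], where the cutoff vanishes. *)
move=> hv; have o1 := @opens_enorm_gt n (1 / 2); have o2 := @opens_enorm_lt n (7 / 10).
apply: (@Ck_subset _ (fun x => 1 / 2 < enorm x \/ enorm x < 7 / 10)).
  by move=> x _; case: (Rlt_le_dec (1 / 2) (enorm x)) => h; [left|right; lra].
apply: Ck_union => //.
  apply: (Ck_mul o1) => //; apply: Ck_subset (Ck_rad _ (smooth1_cutoff k)) => //.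
apply: (Ck_ext o2 (f := fun _ => 0)); last exact: (Ck_const o2).
move=> x hx; have e0 := enorm_ge0 x.
by rewrite rad0E cutoff_left ?Rmult_0_l //; nra.
Qed.

Theorem theorem4p1 (m n : nat) (sigma : R) (g v : point n -> R)
  (hm : (2 <= m)%N) (hn : (2 <= n)%N) (hodd : odd m) (hmn : (2 * m < n)%N)
  (hsig0 : 0 < sigma) (hsig1 : sigma < INR n / (INR n - 2 * INR m))
  (hgc : cont_on (fun y => 1/2 <= enorm y) g)
  (hg1 : forall y, 1/2 <= enorm y -> 1 <= g y)
  (hgO : bigO_pow g (2 * INR m * (INR n - 2) / (INR n - sigma * (INR n - 2 * INR m))))
  (hv : Ck (2 * m) (fun y => 1/2 < enorm y) v)
  (hv0 : forall y, 1/2 < enorm y -> 0 <= v y)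
  (hineq : forall y, 1/2 < enorm y ->
     0 <= - iter_lap m v y /\ - iter_lap m v y <= Rpower (v y + g y) sigma) :
  bigO_pow v (2 * INR m * (INR n - 2) / (INR n - sigma * (INR n - 2 * INR m))).
Proof.
have m0 : (0 < m)%N by exact: ltnW.
set b := 2 * INR m * (INR n - 2) / (INR n - sigma * (INR n - 2 * INR m)) in hgO *.
pose w x := rad (fun _ => 0) (cutoff (2 * m).+1) x * v x.
have hw : Ck (2 * m) (fun _ => True) w by exact: Ck_cutoff.
have wv x : 1 < enorm x -> w x = v x.
  by move=> h; rewrite /w rad0E cutoff_right ?Rmult_1_l //; nra.
have w0 x : 0 <= w x.
  rewrite /w rad0E; case: (Rlt_le_dec (1 / 2) (enorm x)) => h.
    by apply: Rmult_le_pos; [exact: cutoff_ge0|exact: hv0].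
  by have e0 := enorm_ge0 x; rewrite cutoff_left ?Rmult_0_l; [lra|nra].
have fw x : 1 < enorm x -> iter_lap m w x = iter_lap m v x.
  exact: (iter_lap_loc (D := fun y => 1 < enorm y) m (@opens_enorm_gt n 1) wv).
have ft0 x : 1 < enorm x -> 0 <= - iter_lap m w x.
  by move=> h; rewrite fw //; have [] := hineq x (ltac:(lra)).
have [C [C0 hC]] := potential_bound m0 hodd hmn hw w0 ft0.
have [Cg [Rg hg]] := hgO.
set k := (n - 2 * m)%N in hC.
have k0 : (0 < k)%N by rewrite subn_gt0.
(* Near [y] this gives [v + g <= H1 * A]: the first summand is the doubling factor, the second
   bounds [g] by its growth at radius at most [5 R / 4] together with [R^b <= 2 A]. *)
pose H1 := 2 * 2 ^ k + 2 * Rabs Cg * Rpower (5 / 4) b.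
have H10 : 0 < H1.
  have := pow_lt 2 k (ltac:(lra)); have := Rpower_pos (5 / 4) b; have := Rabs_pos Cg.
  by rewrite /H1 => ? ? ?; nra.
have [b0 [L [L1 hL]]] := balance_radius m0 hmn hsig0 hsig1 C0 (Rpower_pos H1 sigma).
rewrite -/b -/k in b0 hL.
(* All points considered below have norm at least [3 R / 4]: the term [2 |Rg|] keeps them where the
   growth bound on [g] holds, and 16 meets the requirement of [potential_bound]. *)
exists L, (16 + 2 * Rabs Rg) => y0 hy0.
set R := enorm y0 in hy0 *.
have Rg0 := Rabs_pos Rg; have RgR := Rle_abs Rg.
have R16 : 16 <= R by lra.
have y01 : 1 < enorm y0 by rewrite -/R; lra.
rewrite -wv // Rabs_pos_eq //; apply: Rnot_lt_le => big.
have Rb0 := Rpower_pos R b.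
have wy0 : 0 < w y0 by apply: Rle_lt_trans big; apply: Rmult_le_pos; lra.
have [y [d [[d0 dR] [hd [hA1 [hA2 hdb]]]]]] :=
  doubling (Ck_cont hw) w0 wy0 (ltac:(lra) : 0 < R / 4) k0.
set A := w y in hA1 hA2 hdb.
have [r [[r0 rd] hr]] := hL R A d (w y0) (ltac:(lra)) d0 big hA1 hA2.
have A0 : 0 < A by lra.
have yR : 3 / 4 * R <= enorm y <= 5 / 4 * R.
  have := enorm_edist y y0; have := enorm_edist y0 y; rewrite (edist_sym y0) hd -/R => ? ?.
  lra.
have RA : Rpower R b <= 2 * A by nra.
have hB z : edist z y <= r -> - iter_lap m w z <= Rpower H1 sigma * Rpower A sigma.
  move=> hz.
  have zy0 : edist z y0 <= R / 4 by have := edist_triangle z y y0; rewrite hd => ?; lra.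
  have zR : 3 / 4 * R <= enorm z <= 5 / 4 * R.
    have := enorm_edist z y0; have := enorm_edist y0 z; rewrite (edist_sym y0) -/R => ? ?.
    lra.
  have z1 : 1 < enorm z by lra.
  rewrite fw //; have [_ le] := hineq z (ltac:(lra)); apply: Rle_trans le _.
  rewrite Rpower_mult_distr //; apply: Rle_Rpower_l; first lra.
  have gz := hg1 z (ltac:(lra)); have vz := hv0 z (ltac:(lra)).
  split; first lra.
  have wz : v z <= 2 * 2 ^ k * A by rewrite -wv //; apply: hdb; lra.
  have gz' : g z <= Rabs Cg * (Rpower (5 / 4) b * Rpower R b).
    apply: Rle_trans (Rle_abs _) _; apply: Rle_trans (hg z _) _; first lra.
    have p0 := Rpower_pos (enorm z) b.
    apply: Rle_trans (_ : Rabs Cg * Rpower (enorm z) b <= _).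
      by apply: Rmult_le_compat_r; [lra|exact: Rle_abs].
    apply: Rmult_le_compat_l; first exact: Rabs_pos.
    by rewrite Rpower_mult_distr; try lra; apply: Rle_Rpower_l; lra.
  have : Rabs Cg * (Rpower (5 / 4) b * Rpower R b) <= Rabs Cg * (Rpower (5 / 4) b * (2 * A)).
    by apply: Rmult_le_compat_l; [exact: Rabs_pos|apply: Rmult_le_compat_l; [apply: Rlt_le; exact: Rpower_pos|]].
  by rewrite /H1 => ?; lra.
have r8 : 0 < r <= R / 8 by lra.
have := hC R r y _ R16 r8 yR hB.
rewrite -/A => ?; lra.
Qed.
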